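(* Let $X$ be an infinite-dimensional complex Banach space and $T\in L(X)$. Then $$\partial\sigma_{gDR}(T)\subset\partial\sigma_{\mathbf{gDR}\mathcal M}(T)\subset\partial\sigma_{\mathbf{gDR}\mathcal W_+}(T)\subset\partial\sigma_{\mathbf{gDR}\Phi_+}(T)\subset\partial\sigma_{gKR}(T),$$ $$\partial\sigma_{gDR}(T)\subset\partial\sigma_{\mathbf{gDR}\mathcal W}(T)\subset\partial\sigma_{\mathbf{gDR}\Phi}(T)\subset\partial\sigma_{gKR}(T),$$ $$\partial\sigma_{gDR}(T)\subset\partial\sigma_{\mathbf{gDR}\mathcal Q}(T)\subset\partial\sigma_{\mathbf{gDR}\mathcal W_-}(T)\subset\partial\sigma_{\mathbf{gDR}\Phi_-}(T)\subset\partial\sigma_{gKR}(T),$$ $$\partial\sigma_{\mathbf{gDR}\Phi}(T)\subset\partial\sigma_{\mathbf{gDR}\Phi_+}(T),\ \partial\sigma_{\mathbf{gDR}\Phi}(T)\subset\partial\sigma_{\mathbf{gDR}\Phi_-}(T),\ \partial\sigma_{\mathbf{gDR}\mathcal W}(T)\subset\partial\sigma_{\mathbf{gDR}\mathcal W_+}(T),\ \partial\sigma_{\mathbf{gDR}\mathcal W}(T)\subset\partial\sigma_{\mathbf{gDR}\mathcal W_-}(T),$$ and $$\eta\sigma_{gKR}(T)=\eta\sigma_{\mathbf{gDR}\Phi_+}(T)=\eta\sigma_{\mathbf{gDR}\mathcal W_+}(T)=\eta\sigma_{\mathbf{gDR}\mathcal M}(T)=\eta\sigma_{\mathbf{gDR}\Phi_-}(T)=\eta\sigma_{\mathbf{gDR}\mathcal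 W_-}(T)=\eta\sigma_{\mathbf{gDR}\mathcal Q}(T)=\eta\sigma_{\mathbf{gDR}\Phi}(T)=\eta\sigma_{\mathbf{gDR}\mathcal W}(T)=\eta\sigma_{gDR}(T).$$
   Context: $S$ is Kato if $R(S)$ is closed and $N(S)\subset R(S^n)$ for all $n$; $S$ is Riesz if $S-\lambda$ is Fredholm for all $\lambda\ne0$. $\sigma_{gKR}(T)$ is the set of $\lambda$ for which there are no closed $(T-\lambda)$-invariant $M,N$ with $X=M\oplus N$, $(T-\lambda)_M$ Kato and $(T-\lambda)_N$ Riesz. Classes: $\mathcal M$ bounded below; $\mathcal Q$ surjective; $\Phi_+$: finite-dimensional kernel and closed range; $\Phi_-$: finite-codimensional range; $\Phi=\Phi_+\cap\Phi_-$; $\mathcal W_+$, $\mathcal W_-$, $\mathcal W$: operators in $\Phi_+$, $\Phi_-$, $\Phi$ with index $\le0$, $\ge0$, $=0$. For a class $\mathbf R$, $\sigma_{\mathbf{gDR}\mathbf R}(T)$ is the set of $\lambda$ for which there are no closed $(T-\lambda)$-invariant $M,N$ with $X=M\oplus N$, $(T-\lambda)_M\in\mathbf R$ and $(T-\lambda)_N$ Riesz; $\sigma_{gDR}(T)$ is this set for $\mathbf R$ the invertible operators (equivalently, the set of $\lambda$ with $T-\lambda$ not generalized Drazin-Riesz invertible, i.e. no $S$ with $S(T-\lambda)=(T-\lambda)S$, $S(T-\lambda)S=S$, $(T-\lambda)S(T-\lambda)-(T-\lambda)$ Riesz). For compact $K\subset\mathbb C$, the connected hull $\eta K$ is the complement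 of the unbounded component of $\mathbb C\setminus K$; $\partial$ is the boundary. *)

(* Defs.v *)
From HB Require Import structures.
From mathcomp Require Import all_boot all_order all_algebra.
From mathcomp Require Import all_classical all_reals all_analysis.
From mathcomp Require Export complex.
Export numFieldNormedType.Exports.

Set Implicit Arguments.
Unset Strict Implicit.
Unset Printing Implicit Defensive.

Import Order.TTheory GRing.Theory Num.Theory.
Local Open Scope classical_set_scope.
Local Open Scope ring_scope.

Section OperatorDefs.
Variables (R : realType) (X : completeNormedModType R[i]).

Definition opsub (S : X -> X) (l : R[i]) : X -> X := fun x => S x - l *: x.

Definition fspan (n : nat) (v : 'I_n -> X) : set X :=
  [set x | exists c : 'I_n -> R[i], x = \sum_(k < n) c k *: v k].

Definition is_subspace (M : set X) : Prop :=
  M 0 /\ forall (a : R[i]) (x y : X), M x -> M y -> M (a *: x + y).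

Definition closed_subspace (M : set X) : Prop := is_subspace M /\ closed M.

Definition invariant (S : X -> X) (M : set X) : Prop := S @` M `<=` M.

Definition direct_sum (M N : set X) : Prop :=
  (forall x : X, exists m n, M m /\ N n /\ x = m + n) /\ M `&` N = [set 0].

Definition dim_le (A : set X) (n : nat) : Prop :=
  exists v : 'I_n -> X, A `<=` fspan v.

Definition finite_dim (A : set X) : Prop := exists n, dim_le A n.

Definition fdim (A : set X) : nat :=
  xget 0%N [set n | dim_le A n /\ forall m, dim_le A m -> (n <= m)%N].

Definition codim_le (B M : set X) (n : nat) : Prop :=
  exists v : 'I_n -> X, (forall k, M (v k)) /\
    M `<=` [set x | exists b y, B b /\ fspan v y /\ x = b + y].

Definition finite_codim (B M : set X) : Prop := exists n, codim_le B M n.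

Definition fcodim (B M : set X) : nat :=
  xget 0%N [set n | codim_le B M n /\ forall m, codim_le B M m -> (n <= m)%N].

Definition ker_on (S : X -> X) (M : set X) : set X := [set x | M x /\ S x = 0].
Definition ran_on (S : X -> X) (M : set X) : set X := S @` M.

Definition invertible_on (S : X -> X) (M : set X) : Prop :=
  exists G : X -> X, G @` M `<=` M /\
    (forall x, M x -> G (S x) = x) /\ (forall x, M x -> S (G x) = x) /\
    exists C : R[i], forall x, M x -> `|G x| <= C * `|x|.

Definition bounded_below_on (S : X -> X) (M : set X) : Prop :=
  exists c : R[i], 0 < c /\ forall x, M x -> c * `|x| <= `|S x|.

Definition surjective_on (S : X -> X) (M : set X) : Prop := ran_on S M = M.

Definition Phi_plus_on (S : X -> X) (M : set X) : Prop :=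
  finite_dim (ker_on S M) /\ closed (ran_on S M).

Definition Phi_minus_on (S : X -> X) (M : set X) : Prop :=
  finite_codim (ran_on S M) M.

Definition Phi_on (S : X -> X) (M : set X) : Prop :=
  Phi_plus_on S M /\ Phi_minus_on S M.

(* index <= 0 (index = -oo when the range has infinite codimension) *)
Definition W_plus_on (S : X -> X) (M : set X) : Prop :=
  Phi_plus_on S M /\
  (Phi_minus_on S M -> (fdim (ker_on S M) <= fcodim (ran_on S M) M)%N).

(* index >= 0 (index = +oo when the kernel is infinite-dimensional) *)
Definition W_minus_on (S : X -> X) (M : set X) : Prop :=
  Phi_minus_on S M /\
  (Phi_plus_on S M -> (fcodim (ran_on S M) M <= fdim (ker_on S M))%N).

Definition W_on (S : X -> X) (M : set X) : Prop :=
  Phi_on S M /\ fdim (ker_on S M) = fcodim (ran_on S M) M.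

Definition Kato_on (S : X -> X) (M : set X) : Prop :=
  closed (ran_on S M) /\
  forall n : nat, ker_on S M `<=` ran_on (iter n S) M.

Definition Riesz_on (S : X -> X) (N : set X) : Prop :=
  forall mu : R[i], mu != 0 -> Phi_on (opsub S mu) N.

Definition sigma_gDR_cls (Rcl : (X -> X) -> set X -> Prop) (T : X -> X)
  : set R[i]^o :=
  [set l | ~ exists M N : set X,
      [/\ closed_subspace M, closed_subspace N, direct_sum M N,
          invariant (opsub T l) M /\ invariant (opsub T l) N &
          Rcl (opsub T l) M /\ Riesz_on (opsub T l) N]].

Definition sigma_gDR (T : X -> X) := sigma_gDR_cls invertible_on T.
Definition sigma_gKR (T : X -> X) := sigma_gDR_cls Kato_on T.

End OperatorDefs.

Section Hulls.
Variable R : realType.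

Definition cboundary (K : set R[i]^o) : set R[i]^o := closure K `\` interior K.

Definition chull (K : set R[i]^o) : set R[i]^o :=
  [set z | ~ exists w, (~` K) w /\
      ~ bounded_set (connected_component (~` K) w) /\
      connected_component (~` K) w z].
End Hulls.

(* Main.v *)
(* If T - l = K + Q with K Kato on M and Q Riesz on N, then for small w the kernel
   dimension and the defect of K - w on M do not depend on w, while Q - w is
   invertible for a dense open set of w. So if T - l - w lies in one of the classes
   R, possibly up to a Riesz summand, for arbitrarily small w, then K lies in R as
   well, and conversely K in R gives l + w outside sigma_gDRR for all small w.
   Hence, off sigma_gKR, the complement of each sigma_gDRR is locally everything or
   nothing. Since a semi-Fredholm operator is the sum of a Kato operator and a
   nilpotent one on a finite-dimensional space, sigma_gKR is contained in every
   sigma_gDRR, and the inclusions of boundaries and the equality of hulls follow by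
   point-set topology. *)
Require Import Defs.
From HB Require Import structures.
From mathcomp Require Import all_boot all_order all_algebra.
From mathcomp Require Import all_classical all_reals all_analysis.
From mathcomp Require Import complex.
From mathcomp Require Import zify ring lra.
Import numFieldNormedType.Exports.
Import Defs.
Import Order.TTheory GRing.Theory Num.Theory.
Set Implicit Arguments.
Unset Strict Implicit.
Unset Printing Implicit Defensive.
Local Open Scope classical_set_scope.
Local Open Scope ring_scope.

(** The decomposition at [l] and the one at a nearby point have unrelated summands, so they cannot
    be compared directly. Both are compared with the whole space, at a common parameter where both
    Riesz summands are bijective and hence invisible to kernel dimension and defect; finding that
    parameter takes openness as well as density. Kernel and defect on the Kato summand may both be
    infinite, so there is no index to rely on. Their constancy rests on a lifting constant for
    [K - w] that is uniform in small [w], obtained by working first inside the generalized range of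
    [K] and then modulo it. Dimensions occur as predicates [at least n], and a class enters only
    through these predicates and the closedness of the range. Riesz operators are given by
    Fredholmness alone, so the isolation of their nonzero spectral points comes from a connectedness
    argument along a ray. Operators stay functions on [X] restricted to sets, and quotients are
    replaced by independence modulo a subspace. *)

Lemma cauchy_seq_cvg (K : numFieldType) (V : completeNormedModType K)
  (u : nat -> V) :
  (forall e : K, 0 < e -> exists N : nat, forall m n,
     (N <= m)%N -> (N <= n)%N -> `|u m - u n| < e) ->
  exists l : V, forall e : K, 0 < e -> exists N : nat, forall n,
     (N <= n)%N -> `|l - u n| < e.
Proof.
move=> cu.
have cF : cauchy (u n @[n --> \oo]).
  apply: cauchy_exP => e e0.
  have [N HN] := cu e e0.
  exists (u N); exists N => //= n Nn.
  rewrite -ball_normE /=; exact: HN.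
have /cauchy_cvgP cv : cauchy (u n @[n --> \oo]) := cF.
exists (lim (u n @[n --> \oo])) => e e0.
have /cvgrPdist_lt/(_ e e0)[N _ HN] := cv.
by exists N => n Nn; apply: HN.
Qed.

(** * Geometric convergence in the real-valued norm *)

Section Norm.
Variable R : realType.
Local Notation C := R[i].

(* MathComp's norm takes values in [R[i]], which is not totally ordered. *)
Definition nm (V : normedZmodType C) (x : V) : R := complex.Re `|x|.

(** Sequences are built with an explicit rate [a * halfpow n], so that limits can be handled by
    inequalities instead of filters. *)
Definition halfpow (n : nat) : R := 2^-1 ^+ n.

Lemma halfpow_gt0 n : 0 < halfpow n.
Proof. by rewrite /halfpow exprn_gt0// invr_gt0. Qed.

Lemma halfpowS n : halfpow n.+1 = halfpow n / 2.
Proof. by rewrite /halfpow exprSr. Qed.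

Lemma halfpow_small (e : R) : 0 < e -> exists n, halfpow n < e.
Proof.
move=> e0; have ie0 : 0 < e^-1 by rewrite invr_gt0.
exists (Num.bound e^-1); rewrite /halfpow exprVn invf_plt ?posrE ?exprn_gt0//.
apply: (lt_trans (archi_boundP (ltW ie0))).
by rewrite -natrX ltr_nat ltn_expl.
Qed.

Lemma halfpow_small_mul (a e : R) : 0 < e -> exists n, a * halfpow n < e.
Proof.
move=> e0; have a1 : 0 < `|a| + 1 by rewrite ltr_wpDl.
have [n hn] := halfpow_small (divr_gt0 e0 a1); exists n.
rewrite ltr_pdivlMr// in hn.
have := halfpow_gt0 n; have := ler_norm a; nra.
Qed.

Lemma halfpow_le m n : (m <= n)%N -> halfpow n <= halfpow m.
Proof.
move=> mn; rewrite /halfpow; apply: ler_wiXn2l => //; lra.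
Qed.

Lemma le_halfpow (x y a : R) : (forall n, x <= y + a * halfpow n) -> x <= y.
Proof.
move=> H; apply/ler_addgt0Pr => e e0; have [n hn] := @halfpow_small_mul a e e0.
apply: (le_trans (H n)); lra.
Qed.

Section NormLemmas.
Variable V : normedZmodType C.
Implicit Types x y : V.

Lemma nmE x : `|x| = ((nm x)%:C)%C.
Proof. by rewrite /nm RRe_real// normr_real. Qed.

Lemma nm_ge0 x : 0 <= nm x.
Proof. by rewrite -lecR -nmE normr_ge0. Qed.

Lemma nm0 : nm (0 : V) = 0.
Proof. by rewrite /nm normr0. Qed.

Lemma nm_eq0 x : nm x <= 0 -> x = 0.
Proof.
move=> x0; apply/eqP; rewrite -normr_eq0 nmE.
by have /eqP -> : nm x == 0 by rewrite eq_le x0 nm_ge0.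
Qed.

Lemma nm_gt0 x : x != 0 -> 0 < nm x.
Proof.
move=> x0; rewrite ltNge; apply/negP => /nm_eq0/eqP; exact/negP.
Qed.

Lemma nmD x y : nm (x + y) <= nm x + nm y.
Proof.
have := ler_normD x y.
by rewrite !nmE -rmorphD /= lecR.
Qed.

Lemma nmN x : nm (- x) = nm x.
Proof. by rewrite /nm normrN. Qed.

Lemma nmBC x y : nm (x - y) = nm (y - x).
Proof. by rewrite -nmN opprB. Qed.

Lemma nmB x y : nm (x - y) <= nm x + nm y.
Proof. by rewrite -(nmN y) nmD. Qed.

Lemma nmD3 x y z : nm (x - z) <= nm (x - y) + nm (y - z).
Proof. by apply: le_trans (nmD _ _); rewrite addrA subrK. Qed.

Lemma nm_sum n (f : 'I_n -> V) : nm (\sum_i f i) <= \sum_i nm (f i).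
Proof.
elim/big_ind2: _ => [|a b c d ab cd|//]; first by rewrite nm0.
by rewrite (le_trans (nmD _ _))// lerD.
Qed.

Lemma nm_halfpow x (a : R) : (forall n, nm x <= a * halfpow n) -> x = 0.
Proof.
by move=> H; apply: nm_eq0; apply: (@le_halfpow _ _ a) => n; rewrite add0r.
Qed.

Lemma nm_halfpow_eq x y (a b : R) (u : nat -> V) :
  (forall n, nm (u n - x) <= a * halfpow n) ->
  (forall n, nm (u n - y) <= b * halfpow n) -> x = y.
Proof.
move=> Ha Hb; apply/eqP; rewrite -subr_eq0; apply/eqP.
apply: (@nm_halfpow _ (a + b)) => n.
by rewrite mulrDl (le_trans (nmD3 _ (u n) _))// lerD// nmBC.
Qed.

(** Keeping the difference of the two powers on the right, and not only [halfpow n], makes the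
    induction on [k] close. *)
Lemma geo_dist (u : nat -> V) (a : R) :
  (forall n, nm (u n.+1 - u n) <= a * halfpow n) ->
  forall n k, nm (u (n + k)%N - u n) <= 2 * a * (halfpow n - halfpow (n + k)).
Proof.
move=> H n; elim=> [|k IH]; first by rewrite addn0 !subrr nm0 mulr0.
have := nmD3 (u (n + k.+1)%N) (u (n + k)%N) (u n).
have := H (n + k)%N; rewrite addnS halfpowS; lra.
Qed.

End NormLemmas.

Lemma nmM (a b : C) : nm (a * b) = nm a * nm b.
Proof. by apply: complexI; rewrite rmorphM /= -!nmE normrM. Qed.

Lemma nm1 : nm (1 : C) = 1.
Proof. by rewrite /nm normr1. Qed.

Lemma nmV (a : C) : nm a^-1 = (nm a)^-1.
Proof. by apply: complexI; rewrite fmorphV /= -!nmE normfV. Qed.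

Lemma nmr (r : R) : nm (r%:C)%C = `|r|.
Proof. by rewrite /nm normc_def /= expr0n /= addr0 sqrtr_sqr. Qed.

Lemma nmZ (V : normedModType C) (a : C) (x : V) : nm (a *: x) = nm a * nm x.
Proof. by apply: complexI; rewrite rmorphM /= -!nmE normrZ. Qed.

Lemma nm_Re (a : C) : `|complex.Re a| <= nm a.
Proof. by rewrite -lecR -nmE normc_ge_Re. Qed.

Lemma nm_Im (a : C) : `|complex.Im a| <= nm a.
Proof.
case: a => x y /=; rewrite /nm normc_def /=.
rewrite -[leLHS]sqrtr_sqr; apply: ler_wsqrtr; rewrite lerDr; exact: sqr_ge0.
Qed.

Lemma nm_le_ReIm (a : C) : nm a <= `|complex.Re a| + `|complex.Im a|.
Proof.
case: a => x y /=; rewrite /nm normc_def /=.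
rewrite -[leRHS]ger0_norm ?addr_ge0// -sqrtr_sqr; apply: ler_wsqrtr.
rewrite sqrrD !real_normK ?num_real//.
have := mulr_ge0 (normr_ge0 x) (normr_ge0 y); lra.
Qed.

Section GeoLim.
Lemma geo_lim_gen (V : normedZmodType C) (u : nat -> V) (a : R) (l : V) :
  (forall n, nm (u n.+1 - u n) <= a * halfpow n) ->
  (forall e : R, 0 < e -> exists N : nat, forall n,
     (N <= n)%N -> nm (l - u n) < e) ->
  forall n, nm (u n - l) <= 2 * a * halfpow n.
Proof.
move=> H Hl n; apply/ler_addgt0Pr => e /Hl [N /(_ (n + N)%N)].
rewrite leq_addl => /(_ isT) h.
have := geo_dist H n N; have := nmD3 (u n) (u (n + N)%N) l.
rewrite (nmBC (u n) (u _)) (nmBC (u (n + N)%N) l).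
have a0 : 0 <= a.
  have := le_trans (nm_ge0 _) (H 0); rewrite /halfpow expr0 mulr1//.
have := mulr_ge0 a0 (ltW (halfpow_gt0 (n + N))).
lra.
Qed.

Lemma geo_lim (V : completeNormedModType C) (u : nat -> V) (a : R) :
  (forall n, nm (u n.+1 - u n) <= a * halfpow n) ->
  exists l, forall n, nm (u n - l) <= 2 * a * halfpow n.
Proof.
move=> H; have a0 : 0 <= a.
  have := le_trans (nm_ge0 _) (H 0); rewrite /halfpow expr0 mulr1//.
have [|l Hl] := @cauchy_seq_cvg _ V u.
  move=> e; rewrite ltcE /= => /andP[/eqP ei e0].
  have [N hN] := @halfpow_small_mul (4 * a) (complex.Re e) e0; exists N => m n Nm Nn.
  rewrite nmE ltcE /= ei eqxx /=.
  have h k : (N <= k)%N -> nm (u k - u N) <= 2 * a * halfpow N.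
    move=> Nk; have := geo_dist H N (k - N); rewrite subnKC// => h.
    have := mulr_ge0 a0 (ltW (halfpow_gt0 k)); lra.
  have := nmD3 (u m) (u N) (u n); have := h _ Nm; have := h _ Nn.
  rewrite (nmBC (u N)); lra.
exists l; apply: geo_lim_gen => // e e0.
have [|N HN] := Hl (e%:C)%C; first by rewrite ltcR.
by exists N => n /HN; rewrite nmE ltcR.
Qed.

Lemma geo_limR (u : nat -> R) (a : R) :
  (forall n, `|u n.+1 - u n| <= a * halfpow n) ->
  exists l, forall e : R, 0 < e -> exists N : nat, forall n,
     (N <= n)%N -> `|l - u n| < e.
Proof.
move=> H; have a0 : 0 <= a.
  have := le_trans (normr_ge0 _) (H 0); rewrite /halfpow expr0 mulr1//.
apply: (@cauchy_seq_cvg _ R^o u) => e e0.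
have [N hN] := @halfpow_small_mul (4 * a) e e0; exists N => m n Nm Nn.
have g n' k : `|u (n' + k)%N - u n'| <= 2 * a * (halfpow n' - halfpow (n' + k)).
  elim: k => [|k IH]; first by rewrite addn0 !subrr normr0 mulr0.
  have := ler_distD (u (n' + k)%N) (u (n' + k.+1)%N) (u n').
  have := H (n' + k)%N; rewrite addnS halfpowS; lra.
have h k : (N <= k)%N -> `|u k - u N| <= 2 * a * halfpow N.
  move=> Nk; have := g N (k - N)%N; rewrite subnKC// => h.
  have := mulr_ge0 a0 (ltW (halfpow_gt0 k)); lra.
have := ler_distD (u N) (u m) (u n); have := h _ Nm; have := h _ Nn.
rewrite (distrC (u N)); lra.
Qed.

(** Needed for coefficient sequences; completeness of the scalars is reduced to the reals by real
    and imaginary parts. *)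
Lemma geo_limC (u : nat -> C) (a : R) :
  (forall n, nm (u n.+1 - u n) <= a * halfpow n) ->
  exists l, forall n, nm (u n - l) <= 2 * a * halfpow n.
Proof.
move=> H.
have [|x hx] := @geo_limR (fun n => complex.Re (u n)) a.
  move=> n; apply: le_trans (H n); rewrite -raddfB; exact: nm_Re.
have [|y hy] := @geo_limR (fun n => complex.Im (u n)) a.
  move=> n; apply: le_trans (H n); rewrite -raddfB; exact: nm_Im.
exists (Complex x y); apply: geo_lim_gen => // e e0.
have e2 : 0 < e / 2 by lra.
have [N HN] := hx _ e2; have [M HM] := hy _ e2.
exists (maxn N M) => n; rewrite geq_max => /andP[/HN h1 /HM h2].
apply: (le_lt_trans (nm_le_ReIm _)); rewrite !raddfB /=; lra.
Qed.
End GeoLim.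

End Norm.

(** * Subspaces, bounded operators and the open mapping theorem *)

Section Subspaces.
Variables (R : realType) (X : completeNormedModType R[i]).
Local Notation C := R[i].
Implicit Types (M N F A : set X) (x y z : X).

Definition eclosed M := forall x,
  (forall e : R, 0 < e -> exists y, M y /\ nm (x - y) < e) -> M x.

Lemma closedE M : closed M <-> eclosed M.
Proof.
split=> [cM x H|cM x clx].
- apply: cM => U /nbhs_ballP[e /= e0 eU].
  move: e0; rewrite ltcE /= => /andP[/eqP ei e0].
  have [y [My xy]] := H _ e0; exists y; split=> //; apply: eU.
  by rewrite -ball_normE /= nmE ltcE /= ei eqxx.
- apply: cM => e e0.
  have [|y [My]] := clx (ball x (e%:C)%C).
    by apply: nbhsx_ballx; rewrite ltcR.
  rewrite -ball_normE /= nmE ltcR => xy; by exists y.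
Qed.

Lemma eclosed_geo M (u : nat -> X) (l : X) (a : R) : eclosed M ->
  (forall n, M (u n)) -> (forall n, nm (u n - l) <= a * halfpow R n) -> M l.
Proof.
move=> cM Mu H; apply: cM => e /(@halfpow_small_mul _ a)[n hn].
by exists (u n); split=> //; rewrite nmBC (le_lt_trans (H n)).
Qed.

Section IsSub.
Variables (M : set X) (sM : is_subspace M).

Lemma sub_0 : M 0. Proof. exact: sM.1. Qed.

Lemma sub_D x y : M x -> M y -> M (x + y).
Proof. by move=> ? ?; rewrite -[x]scale1r; apply: sM.2. Qed.

Lemma sub_Z a x : M x -> M (a *: x).
Proof. by move=> ?; rewrite -[_ *: _]addr0; apply: sM.2 => //; exact: sM.1. Qed.

Lemma sub_N x : M x -> M (- x).
Proof. by rewrite -scaleN1r; apply: sub_Z. Qed.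

Lemma sub_B x y : M x -> M y -> M (x - y).
Proof. by move=> ? ?; apply: sub_D => //; apply: sub_N. Qed.

Lemma sub_sum (I : Type) (r : seq I) (P : pred I) (f : I -> X) :
  (forall i, M (f i)) -> M (\sum_(i <- r | P i) f i).
Proof.
by move=> Mf; elim/big_ind : _ => //; [exact: sub_0|exact: sub_D].
Qed.

Lemma sub_comb n (c : 'I_n -> C) (v : 'I_n -> X) :
  (forall i, M (v i)) -> M (\sum_i c i *: v i).
Proof. by move=> Mv; apply: sub_sum => i; apply: sub_Z. Qed.
End IsSub.

Definition csub M := is_subspace M /\ eclosed M.

Lemma csubE M : closed_subspace M <-> csub M.
Proof. by split=> -[? /closedE]. Qed.

Lemma csubT : csub setT. Proof. by []. Qed.

Lemma is_subspace0 : is_subspace [set (0 : X)].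
Proof. by split=> // a x y /= -> ->; rewrite scaler0 addr0. Qed.

Lemma csub0 : csub [set (0 : X)].
Proof.
split; first exact: is_subspace0.
move=> x H; apply: nm_eq0; apply/ler_addgt0Pr => e /H[y [-> ]].
by rewrite subr0 add0r => /ltW.
Qed.

Lemma csubI M N : csub M -> csub N -> csub (M `&` N).
Proof.
move=> [sM cM] [sN cN]; split; first split.
- by split; [exact: sM.1|exact: sN.1].
- by move=> a x y [? ?] [? ?]; split; [apply: sM.2|apply: sN.2].
- by move=> x H; split; [apply: cM|apply: cN] => e /H[y [[? ?] ?]]; exists y.
Qed.

Definition sumset M N : set X := [set x | exists m n : X, [/\ M m, N n & x = m + n]].

Lemma is_subspaceD M N : is_subspace M -> is_subspace N -> is_subspace (sumset M N).
Proof.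
move=> sM sN; split; first by exists 0, 0; split; rewrite ?addr0//; [exact: sM.1|exact: sN.1].
move=> a x y [m [n [Mm Nn ->]]] [m' [n' [Mm' Nn' ->]]].
exists (a *: m + m'), (a *: n + n'); split; [exact: sM.2|exact: sN.2|].
by rewrite scalerDr addrACA.
Qed.

(** A predicate on bare functions, since the classes of the statement apply to functions such as
    [opsub T l] that carry no linear structure. *)
Definition bounded_op (S : X -> X) :=
  (forall a x y, S (a *: x + y) = a *: S x + S y) /\
  exists2 b : R, 0 < b & forall x : X, nm (S x) <= b * nm x.

Section Blin.
Variables (S : X -> X) (bS : bounded_op S).

Lemma blinD x y : S (x + y) = S x + S y.
Proof. by rewrite -{1}[x]scale1r bS.1 scale1r. Qed.

Lemma blin0 : S 0 = 0.
Proof. by apply: (@addrI _ (S 0)); rewrite -blinD !addr0. Qed.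

Lemma blinZ a x : S (a *: x) = a *: S x.
Proof. by rewrite -{1}[a *: x]addr0 bS.1 blin0 addr0. Qed.

Lemma blinN x : S (- x) = - S x.
Proof. by rewrite -scaleN1r blinZ scaleN1r. Qed.

Lemma blinB x y : S (x - y) = S x - S y.
Proof. by rewrite blinD blinN. Qed.

Lemma blin_sum (I : Type) (r : seq I) (P : pred I) (f : I -> X) :
  S (\sum_(i <- r | P i) f i) = \sum_(i <- r | P i) S (f i).
Proof. exact: (big_morph S blinD blin0). Qed.

Lemma blin_comb n (c : 'I_n -> C) (v : 'I_n -> X) :
  S (\sum_i c i *: v i) = \sum_i c i *: S (v i).
Proof. by rewrite blin_sum; apply: eq_bigr => i _; rewrite blinZ. Qed.

Lemma is_subspace_ran M : is_subspace M -> is_subspace (ran_on S M).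
Proof.
move=> sM; split; first by exists 0; [exact: sM.1|exact: blin0].
move=> a _ _ [x Mx <-] [y My <-].
by exists (a *: x + y); [exact: sM.2|rewrite bS.1].
Qed.

Lemma csub_ker M : csub M -> csub (ker_on S M).
Proof.
move=> [sM cM]; split; first split.
- by split; [exact: sM.1|exact: blin0].
- by move=> a x y [Mx Sx] [My Sy]; split; [exact: sM.2|rewrite bS.1 Sx Sy scaler0 addr0].
- move=> x H; split; first by apply: cM => e /H[y [[My _] xy]]; exists y.
  have [b b0 hb] := bS.2; apply: nm_eq0; apply/ler_addgt0Pr => e e0.
  have [y [[_ Sy] xy]] := H _ (divr_gt0 e0 b0).
  rewrite add0r -[S x]subr0 -Sy -blinB; apply: (le_trans (hb _)).
  by rewrite mulrC -ler_pdivlMr// ltW.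
Qed.

Lemma blin_opsub l : bounded_op (opsub S l).
Proof.
split=> [a x y|]; rewrite /opsub.
  rewrite bS.1 scalerDr !scalerA scalerBr !scalerA [l * a]mulrC opprD.
  by rewrite addrACA.
have [b b0 hb] := bS.2; exists (b + nm l) => [|x].
  by have := nm_ge0 l; lra.
by rewrite mulrDl (le_trans (nmB _ _))// nmZ lerD2r.
Qed.

Lemma blin_iter n : bounded_op (iter n S).
Proof.
elim: n => [|n [IH1 [b b0 hb]]].
  by split=> //; exists 1 => //= x; rewrite mul1r.
have [c c0 hc] := bS.2.
split=> [a x y|]; first by rewrite !iterS IH1 bS.1.
exists (c * b) => [|x]; first by rewrite mulr_gt0.
by rewrite iterS (le_trans (hc _))// -mulrA ler_pM2l.
Qed.

Lemma blin_geo (u : nat -> X) (l : X) (a : R) :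
  (forall n, nm (u n - l) <= a * halfpow R n) ->
  exists b, forall n, nm (S (u n) - S l) <= b * halfpow R n.
Proof.
have [b b0 hb] := bS.2 => H; exists (b * a) => n.
by rewrite -blinB (le_trans (hb _))// -mulrA ler_pM2l.
Qed.
End Blin.

Lemma opsubD (S : X -> X) (l m : C) : opsub (opsub S l) m = opsub S (l + m).
Proof. by apply/funext => x; rewrite /opsub scalerDl opprD addrA. Qed.

Lemma opsub0 (S : X -> X) : opsub S 0 = S.
Proof. by apply/funext => x; rewrite /opsub scale0r subr0. Qed.

Lemma inv_opsub (S : X -> X) (l : C) M : is_subspace M ->
  invariant S M -> invariant (opsub S l) M.
Proof.
move=> sM iM _ [x Mx <-]; apply: sub_B => //; last exact: sub_Z.
by apply: iM; exists x.
Qed.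

Lemma invP (S : X -> X) M : invariant S M <-> forall x, M x -> M (S x).
Proof.
by split=> [iM x Mx|H _ [x Mx <-]]; [apply: iM; exists x|exact: H].
Qed.

Lemma inv_iter (S : X -> X) M n x : invariant S M -> M x -> M (iter n S x).
Proof. by move=> /invP iM Mx; elim: n => //= n; exact: iM. Qed.

Lemma linear_blin (T : {linear X -> X}) : continuous T -> bounded_op T.
Proof.
move=> cT; split; first by move=> a x y; rewrite linearP.
have /cvgrPdist_lt/(_ 1 ltr01) := cT 0.
rewrite linear0 => /nbhs_ballP[e /=]; rewrite ltcE /= => /andP[/eqP ei e0] H.
exists (2 / complex.Re e) => [|x]; first by rewrite divr_gt0.
have [->|x0] := eqVneq x 0; first by rewrite linear0 !nm0 mulr0.
have n0 := nm_gt0 x0.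
pose t := complex.Re e / (2 * nm x).
have t0 : 0 < t by rewrite divr_gt0// mulr_gt0.
have := H ((t%:C)%C *: x).
rewrite -ball_normE /= !sub0r !normrN linearZ !nmE !nmZ nmr (ger0_norm (ltW t0)).
rewrite !ltcE /= ei !eqxx /= => /(_ _)/ltW; rewrite /t.
have -> : complex.Re e / (2 * nm x) * nm x = complex.Re e / 2.
  by field; rewrite gt_eqF.
have h : complex.Re e / 2 < complex.Re e by lra.
move=> /(_ h); rewrite mulrAC ler_pdivrMr ?mulr_gt0// mul1r => h2.
rewrite mulrAC ler_pdivlMr//; lra.
Qed.

(** Baire's theorem inside [F]. If no [B n] were dense in a ball of [F], balls could be nested so
    that the one after stage [n] misses [B n]; their common point would contradict the cover. *)
Lemma baire_family F (B : nat -> set X) : csub F ->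
  (forall y, F y -> exists n, B n y) ->
  exists n y d, [/\ F y, 0 < d & forall y', F y' -> nm (y' - y) <= d ->
    forall e : R, 0 < e -> exists z, B n z /\ nm (z - y') <= e].
Proof.
move=> [sF cF] cov; apply: contrapT => H.
(* A pair is the centre and radius of a ball. The two halved bounds place [q] inside [p], and [q]
   misses [B n]. *)
pose good (n : nat) (p q : X * R) := F p.1 -> 0 < p.2 ->
  [/\ F q.1, 0 < q.2, nm (q.1 - p.1) <= p.2 / 2, q.2 <= p.2 / 2 &
   forall z, nm (z - q.1) <= q.2 -> ~ B n z].
have /choice[g gP] : forall np : nat * (X * R), exists q, good np.1 np.2 q.
  move=> [n [y d]]; rewrite /good /=.
  have [[Fy d0]|nFd] := pselect (F y /\ 0 < d); last first.
    by exists (0, 0) => Fy d0; case: nFd.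
  apply: contrapT => H2; apply: H; exists n, y, (d / 2); split=> //.
    by rewrite divr_gt0.
  move=> y' Fy' yy' e e0; apply: contrapT => H3; apply: H2.
  exists (y', Num.min e (d / 2)) => _ _; split=> //=.
  - by rewrite lt_min e0 divr_gt0.
  - by rewrite ge_min lexx orbT.
  - move=> z zy Bz; apply: H3; exists z; split=> //.
    by rewrite (le_trans zy)// ge_min lexx.
pose s := fix s n := if n is n.+1 then g (n, s n) else (0 : X, 1 : R).
have sP n : F (s n).1 /\ 0 < (s n).2.
  elim: n => [|n [Fn dn]]; first by split=> //=; exact: sF.1.
  by have [] := gP (n, s n) Fn dn.
have sS n : [/\ nm ((s n.+1).1 - (s n).1) <= (s n).2 / 2,
   (s n.+1).2 <= (s n).2 / 2 & forall z, nm (z - (s n.+1).1) <= (s n.+1).2 -> ~ B n z].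
  by have [Fn dn] := sP n; have [] := gP (n, s n) Fn dn.
have dn n : (s n).2 <= halfpow R n.
  elim: n => [|n IH]; first by rewrite /halfpow expr0.
  by have [_ h _] := sS n; rewrite halfpowS; lra.
have [|l Hl] := @geo_lim R X (fun n => (s n).1) 1.
  by move=> n; have [h _ _] := sS n; have := dn n; have := (sP n).2; lra.
(* Each move of the centre is paid for by a loss of radius, so the limit lies in every ball. *)
have tail n k : nm ((s (n + k)%N).1 - (s n).1) <= (s n).2 - (s (n + k)%N).2.
  elim: k => [|k IH]; first by rewrite addn0 !subrr nm0.
  have [h1 h2 _] := sS (n + k)%N; rewrite addnS.
  have := nmD3 (s (n + k).+1).1 (s (n + k)%N).1 (s n).1; lra.
have ln n : nm (l - (s n).1) <= (s n).2.
  apply: (@le_halfpow _ _ _ 2) => k.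
  have := tail n k; have := Hl (n + k)%N; have := (sP (n + k)%N).2.
  have := nmD3 l (s (n + k)%N).1 (s n).1; rewrite (nmBC l (s (n + k)%N).1) /=.
  have := halfpow_le R (leq_addl n k); lra.
have Fl : F l by apply: (eclosed_geo cF (u := fun n => (s n).1)) Hl => n; have [] := sP n.
have [n Bn] := cov l Fl.
by have [_ _] := sS n; move/(_ l (ln n.+1)).
Qed.

(* [B r] is the image of the ball of radius [r] under a bounded linear surjection
   onto [F]; the domain itself never has to be built. *)
Lemma open_mapping F (B : R -> set X) : csub F ->
  (forall y, F y -> exists r, B r y) ->
  (forall r y, B r y -> F y) ->
  (forall r s y, r <= s -> B r y -> B s y) ->
  (forall r s y z, B r y -> B s z -> B (r + s) (y + z)) ->
  (forall r a y, B r y -> B (nm a * r) (a *: y)) ->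
  (forall r (y : nat -> X) s, (forall k, B (r * halfpow R k) (y k)) ->
    (exists a, forall n, nm (\sum_(k < n) y k - s) <= a * halfpow R n) -> B (2 * r) s) ->
  exists2 c : R, 0 < c & forall y, F y -> B (c * nm y) y.
Proof.
move=> cF cov BF mono addB scB comp; have sF := cF.1.
have [|n [y0 [d [Fy0 d0 H]]]] := @baire_family F (fun n => B n%:R) cF.
  move=> y /cov[r Br]; exists (Num.bound `|r|).
  apply: mono Br; apply: (le_trans (ler_norm _)); apply: ltW.
  exact: archi_boundP.
have B00 : B 0 0.
  have [r] := cov 0 sF.1; move=> /(@scB _ 0); by rewrite nm0 mul0r scale0r.
(* Subtracting an approximant of [y0] from one of [y0 + w] moves the ball from [y0] to the origin
   and doubles the bound [n%:R]. *)
have small w : F w -> nm w <= d -> forall e : R, 0 < e ->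
    exists z, B (2 * n%:R) z /\ nm (z - w) <= e.
  move=> Fw wd e e0; have e2 : 0 < e / 2 by lra.
  have [||z1 [Bz1 h1]] := H (y0 + w) _ _ _ e2.
  - by apply: sub_D.
  - by rewrite addrAC subrr add0r.
  have [|z0 [Bz0 h0]] := H y0 Fy0 _ _ e2; first by rewrite subrr nm0 ltW.
  exists (z1 + (-1) *: z0); split.
    have -> : 2 * n%:R = n%:R + nm (-1 : C) * n%:R by rewrite nmN nm1; lra.
    by apply: addB => //; apply: scB.
  have -> : z1 + -1 *: z0 - w = (z1 - (y0 + w)) - (z0 - y0).
    rewrite scaleN1r opprB opprD [RHS](AC (1*2*2) (1*5*3*(4*2)))/=.
    by rewrite subrr addr0.
  by apply: (le_trans (nmB _ _)); lra.
(* Scaling [w] to norm [d] and approximating within [d / 2] costs this much per unit of norm and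
   halves the remainder. *)
pose c := 2 * n%:R / d : R.
have c0 : 0 <= c by rewrite divr_ge0 ?mulr_ge0 ?ler0n// ltW.
have half w : F w -> exists z, [/\ B (c * nm w) z, F (w - z) & nm (w - z) <= nm w / 2].
  move=> Fw; have [->|w0] := eqVneq w 0.
    exists 0; rewrite subrr nm0 mulr0 mul0r; split=> //; exact: sF.1.
  have nw := nm_gt0 w0; pose t := d / nm w; have t0 : 0 < t by rewrite divr_gt0.
  have [|||z [Bz hz]] := small ((t%:C)%C *: w) _ _ (d / 2).
  - exact: sub_Z.
  - by rewrite nmZ nmr ger0_norm ?(ltW t0)// /t divfK ?gt_eqF.
  - by rewrite divr_gt0.
  exists ((t^-1%:C)%C *: z).
  have Bz' : B (c * nm w) ((t^-1%:C)%C *: z).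
    have := @scB _ (t^-1%:C)%C _ Bz; rewrite nmr ger0_norm ?invr_ge0 ?(ltW t0)//.
    suff -> : t^-1 * (2 * n%:R) = c * nm w by [].
    by rewrite /t /c; field; rewrite !gt_eqF.
  split=> //; first by apply: sub_B => //; apply: BF Bz'.
  rewrite nmBC; have -> : (t^-1%:C)%C *: z - w = (t^-1%:C)%C *: (z - (t%:C)%C *: w).
    rewrite scalerBr scalerA -rmorphM /= mulVf ?gt_eqF// scale1r //.
  rewrite nmZ nmr ger0_norm ?invr_ge0 ?(ltW t0)//.
  rewrite mulrC ler_pdivrMr//; apply: (le_trans hz); rewrite /t.
  suff -> : nm w / 2 * (d / nm w) = d / 2 by [].
  by field; rewrite gt_eqF.
(* The factor 2 sums the geometric series of remainders; the added 1 keeps the constant positive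
   when [c] is 0. *)
exists (2 * c + 1) => [|y Fy]; first by lra.
have /choice[g gP] : forall w, exists z, F w -> [/\ B (c * nm w) z, F (w - z) & nm (w - z) <= nm w / 2].
  by move=> w; have [/half[z ?]|nF] := pselect (F w); [exists z|exists 0].
pose w := fix w n := if n is n.+1 then w n - g (w n) else y.
have Fw k : F (w k) by elim: k => // k /gP[].
have nw k : nm (w k) <= nm y * halfpow R k.
  elim: k => [|k IH]; first by rewrite /halfpow expr0 mulr1.
  by have [_ _ /=] := gP _ (Fw k); rewrite halfpowS; lra.
have sumw k : \sum_(i < k) g (w i) = y - w k.
  elim: k => [|k IH]; first by rewrite big_ord0 subrr.
  by rewrite big_ord_recr /= IH opprB addrA [RHS]addrAC.
apply: (@mono (2 * (c * nm y))); first by have := nm_ge0 y; nra.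
apply: (comp _ (fun k => g (w k))).
  move=> k; have [Bk _ _] := gP _ (Fw k); apply: mono Bk.
  by rewrite -mulrA; apply: ler_wpM2l.
exists (nm y) => k; rewrite sumw addrAC subrr add0r nmN //.
Qed.

End Subspaces.

(** * Independence modulo a subspace *)

Section LinearAlgebra.
Variables (R : realType) (X : completeNormedModType R[i]).
Local Notation C := R[i].
Implicit Types (M N F A G : set X) (x y z : X).

Definition findep F n (g : 'I_n -> X) := forall a : 'I_n -> C,
  F (\sum_i a i *: g i) -> forall i, a i = 0.

(* [dim A/F >= n]; this also makes sense when [F] is not contained in [A] *)
Definition has_indep F A n :=
  exists g : 'I_n -> X, (forall i, A (g i)) /\ findep F g.

(** The coefficient matrix has more rows than columns, hence a nonzero row vector in its left
    kernel; that combination of the [g i] cancels all [v k] and falls into [F]. *)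
Lemma dependent F m n (v : 'I_n -> X) (g : 'I_m -> X) : is_subspace F ->
  (n < m)%N ->
  (forall i, exists f (c : 'I_n -> C), F f /\ g i = f + \sum_k c k *: v k) ->
  ~ findep F g.
Proof.
move=> sF nm /choice[f /choice[c H]] ind.
pose A : 'M[C]_(m, n) := \matrix_(i, k) c i k.
have : kermx A != 0.
  rewrite -mxrank_eq0 mxrank_ker subn_eq0 -ltnNge.
  exact: leq_ltn_trans (rank_leq_col A) nm.
case/rowV0Pn => u /sub_kermxP uA u0; case/negP: u0; apply/eqP/rowP => i.
rewrite mxE; apply: (ind (fun i => u 0 i)).
have -> : \sum_i u 0 i *: g i = \sum_i u 0 i *: f i.
  have -> : \sum_i u 0 i *: g i =
     \sum_i (u 0 i *: f i + \sum_k (u 0 i * c i k) *: v k).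
    apply: eq_bigr => j _; rewrite (H j).2 scalerDr scaler_sumr; congr (_ + _).
    by apply: eq_bigr => k _; rewrite scalerA.
  rewrite big_split /= exchange_big /= [X in _ + X]big1 ?addr0// => k _.
  rewrite -scaler_suml; have /rowP/(_ k) := uA.
  rewrite !mxE => E; suff -> : \sum_j u 0 j * c j k = 0 by rewrite scale0r.
  by rewrite -[RHS]E; apply: eq_bigr => j _; rewrite mxE.
by apply: sub_comb => // j; exact: (H j).1.
Qed.

Definition fcons n x (g : 'I_n -> X) : 'I_n.+1 -> X :=
  fun i => if unlift ord0 i is Some j then g j else x.

Lemma fcons0 n x (g : 'I_n -> X) : fcons x g ord0 = x.
Proof. by rewrite /fcons unlift_none. Qed.

Lemma fconsS n x (g : 'I_n -> X) i : fcons x g (lift ord0 i) = g i.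
Proof. by rewrite /fcons liftK. Qed.

Lemma fconsP n x (g : 'I_n -> X) (P : X -> Prop) :
  P x -> (forall i, P (g i)) -> forall i, P (fcons x g i).
Proof. by move=> Px Pg i; rewrite /fcons; case: unlift. Qed.

Lemma sum_fcons n x (g : 'I_n -> X) (a : 'I_n.+1 -> C) :
  \sum_i a i *: fcons x g i = a ord0 *: x + \sum_i a (lift ord0 i) *: g i.
Proof.
by rewrite big_ord_recl fcons0; congr (_ + _); apply: eq_bigr => i _; rewrite fconsS.
Qed.

Lemma findep_cons F n x (g : 'I_n -> X) : is_subspace F -> findep F g ->
  ~ (exists f (c : 'I_n -> C), F f /\ x = f + \sum_k c k *: g k) ->
  findep F (fcons x g).
Proof.
move=> sF ig nx a; rewrite sum_fcons => Fa.
have a0 : a ord0 = 0.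
  apply: contrapT => /eqP a0; apply: nx.
  exists ((a ord0)^-1 *: (a ord0 *: x + \sum_i a (lift ord0 i) *: g i)).
  exists (fun i => - ((a ord0)^-1 * a (lift ord0 i))); split.
    exact: sub_Z.
  rewrite scalerDr scalerA mulVf// scale1r -addrA scaler_sumr -big_split /=.
  by rewrite big1 ?addr0// => i _; rewrite scaleNr scalerA subrr.
move: Fa; rewrite a0 scale0r add0r => /ig ai i.
by case: (unliftP ord0 i) => [j ->|->].
Qed.

Lemma has_indep0 F A : has_indep F A 0.
Proof. by exists (fun=> 0); split=> [[]|a _ []]. Qed.

Lemma has_indep_tail F A n : has_indep F A n.+1 -> has_indep F A n.
Proof.
move=> [g [Ag ig]]; exists (fun i => g (lift ord0 i)); split=> // a Fa i.
pose b j := if unlift ord0 j is Some k then a k else 0.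
have := ig b; rewrite big_ord_recl /b unlift_none scale0r add0r.
under eq_bigr do rewrite liftK.
by move=> /(_ Fa (lift ord0 i)); rewrite liftK.
Qed.

Lemma has_indep_leq F A m n : (m <= n)%N -> has_indep F A n -> has_indep F A m.
Proof.
elim: n => [|n IH]; first by rewrite leqn0 => /eqP ->.
by rewrite leq_eqVlt => /orP[/eqP ->//|/IH h /has_indep_tail].
Qed.

Lemma codim_leS F A n : A 0 -> codim_le F A n -> codim_le F A n.+1.
Proof.
move=> A0 [v [Av H]]; exists (fcons 0 v); split; first exact: fconsP.
move=> x /H[b [y [Fb [[c ->] ->]]]]; exists b, (\sum_k c k *: v k); split=> //.
split=> //; exists (fun i => if unlift ord0 i is Some j then c j else 0).
by rewrite sum_fcons unlift_none scale0r add0r; apply: eq_bigr => i _; rewrite liftK.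
Qed.

Lemma codim_le_leq F A m n : A 0 -> (m <= n)%N -> codim_le F A m -> codim_le F A n.
Proof.
move=> A0; elim: n => [|n IH]; first by rewrite leqn0 => /eqP ->.
by rewrite leq_eqVlt => /orP[/eqP ->//|/IH h /h]; exact: codim_leS.
Qed.

(** A family independent modulo [F] that cannot be extended within [A] spans [A] modulo [F]. This
    trades spanning families for counts of independent vectors. *)
Lemma codim_leP F A n : is_subspace F -> is_subspace A ->
  codim_le F A n <-> ~ has_indep F A n.+1.
Proof.
move=> sF sA; split.
- move=> [v [_ H]] [g [Ag ig]]; apply: (@dependent F _ _ v g) => // i.
  by have [f [y [Ff [[c ->] ->]]]] := H _ (Ag i); exists f, c.
- apply: contra_notP => nc.
  suff h k : (k <= n.+1)%N -> has_indep F A k by exact: h.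
  elim: k => [_|k IH kn]; first exact: has_indep0.
  have [g [Ag ig]] := IH (ltnW kn).
  have nk : ~ codim_le F A k by move=> h; apply: nc; apply: codim_le_leq h => //; exact: sA.1.
  suff [x [Ax nx]] : exists x, A x /\
      ~ (exists f (c : 'I_k -> C), F f /\ x = f + \sum_i c i *: g i).
    exists (fcons x g); split; first exact: fconsP.
    exact: findep_cons.
  apply: contrapT => H; apply: nk; exists g; split=> // x Ax.
  apply: contrapT => H2; apply: H; exists x; split=> // -[f [c [Ff xE]]].
  by apply: H2; exists f, (\sum_i c i *: g i); split=> //; split=> //; exists c.
Qed.

Lemma dim_leP A n : is_subspace A -> dim_le A n <-> ~ has_indep [set 0] A n.+1.
Proof.
move=> sA; split.
- move=> [v H] [g [Ag ig]]; apply: (@dependent [set 0] _ _ v g) => //.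
    exact: is_subspace0.
  by move=> i; have [c ->] := H _ (Ag i); exists 0, c; rewrite add0r.
- move/(codim_leP _ (is_subspace0 X) sA) => [v [_ H]]; exists v => x /H.
  by move=> [b [y [/= -> [vy ->]]]]; rewrite add0r.
Qed.

Definition line x : set X := [set y | exists c : C, y = c *: x].

Lemma is_subspace_line x : is_subspace (line x).
Proof.
split; first by exists 0; rewrite scale0r.
by move=> a _ _ [c ->] [d ->]; exists (a * c + d); rewrite scalerDl scalerA.
Qed.

(** Used twice for each Jordan block split off: for its vector in the kernel and for its vector
    outside the range. *)
Lemma has_indep_line F A x n : is_subspace F -> is_subspace A -> A x -> ~ F x ->
  has_indep F A n.+1 <-> has_indep (sumset F (line x)) A n.
Proof.
move=> sF sA Ax nFx; have sL := is_subspace_line x.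
have sG : is_subspace (sumset F (line x)) by exact: is_subspaceD.
split=> [H|[g [Ag ig]]].
- apply: contrapT => nG; case: n => [|n] in H nG *.
    by apply: nG; exact: has_indep0.
  move/(codim_leP _ sG sA): nG => [v [Av Hv]].
  apply: (codim_leP n.+1 sF sA).1 H; exists (fcons x v); split; first exact: fconsP.
  move=> y /Hv[_ [_ [[f [_ [Ff [c ->] ->]]] [[d ->] ->]]]].
  exists f, (c *: x + \sum_k d k *: v k); rewrite addrA; split=> //; split=> //.
  exists (fun i => if unlift ord0 i is Some j then d j else c).
  rewrite sum_fcons unlift_none; congr (_ + _).
  by apply: eq_bigr => i _; rewrite liftK.
- exists (fcons x g); split; first exact: fconsP.
  move=> a; rewrite sum_fcons => Fa.
  have ai : forall i, a (lift ord0 i) = 0.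
    apply: ig; exists (a ord0 *: x + \sum_i a (lift ord0 i) *: g i), (- a ord0 *: x).
    split=> //; first by exists (- a ord0).
    by rewrite scaleNr addrAC subrr add0r.
  move=> i; case: (unliftP ord0 i) => [j ->//|->].
  apply: contrapT => /eqP a0; apply: nFx.
  rewrite -[x]scale1r -(mulVf a0) -scalerA; apply: sub_Z => //.
  by move: Fa; rewrite big1 ?addr0// => k _; rewrite ai scale0r.
Qed.

(** The second isomorphism theorem, with [F1] as the intersection of [A1] and [G]: representatives
    of vectors of [A] modulo [G] can be chosen in [A1]. *)
Lemma has_indep_iso F1 A1 G A n : is_subspace F1 -> is_subspace G ->
  (forall x, A1 x -> A x) -> (forall x, A x -> sumset A1 G x) ->
  is_subspace A1 -> (forall x, F1 x <-> A1 x /\ G x) ->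
  has_indep F1 A1 n <-> has_indep G A n.
Proof.
move=> sF1 sG A1A AA sA1 FE; split=> -[g [Ag ig]].
- exists g; split=> [i|a Ga]; first exact: A1A.
  by apply: ig; apply/FE; split=> //; exact: sub_comb.
- have /choice[h hP] : forall i, exists m, A1 m /\ G (g i - m).
    move=> i; have [m [y [Am Gy ->]]] := AA _ (Ag i).
    by exists m; rewrite addrAC subrr add0r.
  exists h; split=> [i|a Fa]; first exact: (hP i).1.
  apply: ig; have -> : \sum_i a i *: g i = \sum_i a i *: h i + \sum_i a i *: (g i - h i).
    by rewrite -big_split /=; apply: eq_bigr => i _; rewrite -scalerDr addrC subrK.
  apply: sub_D => //; first by have /FE[] := Fa.
  by apply: sub_comb => // i; exact: (hP i).2.
Qed.

End LinearAlgebra.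

(** * Almost orthonormal families and closed ranges *)

Section ClosedRange.
Variables (R : realType) (X : completeNormedModType R[i]).
Local Notation C := R[i].
Implicit Types (M N F A G Z : set X) (x y z : X) (S K : X -> X).

Lemma basis_mod F A n : is_subspace F -> is_subspace A -> codim_le F A n ->
  exists k, has_indep F A k /\ ~ has_indep F A k.+1.
Proof.
move=> sF sA /(codim_leP _ sF sA); elim: n => [|n IH] h.
  by exists 0; split=> //; exact: has_indep0.
have [h'|/IH//] := pselect (has_indep F A n.+1).
by exists n.+1.
Qed.

Lemma spans_mod F A k (g : 'I_k -> X) : is_subspace F -> is_subspace A ->
  (forall i, A (g i)) -> findep F g -> ~ has_indep F A k.+1 ->
  forall x, A x -> exists f (c : 'I_k -> C), F f /\ x = f + \sum_i c i *: g i.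
Proof.
move=> sF sA Ag ig nk x Ax; apply: contrapT => H; apply: nk.
exists (fcons x g); split; first exact: fconsP.
exact: findep_cons.
Qed.

(** Quantitative independence: each coordinate is at most [q] times the distance of the combination
    from [F]. *)
Definition qindep F n (g : 'I_n -> X) (q : R) := forall (a : 'I_n -> C) f,
  F f -> forall i, nm (a i) <= q * nm (\sum_j a j *: g j + f).

Lemma qindep_findep F n (g : 'I_n -> X) q : is_subspace F -> qindep F g q -> findep F g.
Proof.
move=> sF H a Fa i; apply: nm_eq0.
by have := H a _ (sub_N sF Fa) i; rewrite subrr nm0 mulr0.
Qed.

Definition modspan F n (g : 'I_n -> X) : set X :=
  [set x | exists f (c : 'I_n -> C), F f /\ x = f + \sum_i c i *: g i].

Lemma is_subspace_modspan F n (g : 'I_n -> X) : is_subspace F ->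
  is_subspace (modspan F g).
Proof.
move=> sF; split.
  exists 0, (fun=> 0); rewrite big1 ?addr0; last by move=> i _; rewrite scale0r.
  by split=> //; exact: sub_0.
move=> a _ _ [f [c [Ff ->]]] [f' [c' [Ff' ->]]].
exists (a *: f + f'), (fun i => a * c i + c' i); split; first exact: sF.2.
rewrite scalerDr addrACA scaler_sumr -big_split /=; congr (_ + _).
by apply: eq_bigr => i _; rewrite scalerDl scalerA.
Qed.

(** When vectors of the span converge, [qindep] makes their coefficients converge, and then the
    components in [F] converge too. *)
Lemma csub_modspan F n (g : 'I_n -> X) q : csub F -> qindep F g q ->
  csub (modspan F g).
Proof.
move=> [sF cF] qg; split; first exact: is_subspace_modspan.
move=> x H.
have /choice[y yP] : forall k, exists y, modspan F g y /\ nm (x - y) < halfpow R k.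
  by move=> k; apply: H; exact: halfpow_gt0.
have /choice[f /choice[c fP]] : forall k, exists f (c : 'I_n -> C),
    F f /\ y k = f + \sum_i c i *: g i.
  by move=> k; exact: (yP k).1.
have q0 i : 0 <= q * nm (g i) by have := qg (fun=> 0) _ (sub_0 sF) i; rewrite nm0;
  have := qg (fun j => (j == i)%:R) _ (sub_0 sF) i; rewrite eqxx nm1 addr0 (bigD1 i)//=
  eqxx scale1r big1 ?addr0; [lra|by move=> j /negPf ->; rewrite scale0r].
have dc i k : nm (c k.+1 i - c k i) <= (2 * `|q|) * halfpow R k.
  have E : y k.+1 - y k = \sum_j (c k.+1 j - c k j) *: g j + (f k.+1 - f k).
    rewrite (fP k.+1).2 (fP k).2 opprD addrACA addrC; congr (_ + _).
    by rewrite -sumrB; apply: eq_bigr => j _; rewrite scalerBl.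
  have := qg (fun j => c k.+1 j - c k j) _ (sub_B sF (fP k.+1).1 (fP k).1) i.
  rewrite /= -E => h; apply: (le_trans h).
  have h1 := ltW (yP k.+1).2; have h2 := ltW (yP k).2.
  have h3 : nm (y k.+1 - y k) <= 2 * halfpow R k.
    have := nmD3 (y k.+1) x (y k); rewrite (nmBC (y k.+1) x).
    have := halfpow_le R (leqnSn k); lra.
  have := ler_norm q; have := nm_ge0 (y k.+1 - y k); have := normr_ge0 q; nra.
have /choice[l lP] : forall i, exists l, forall k, nm (c k i - l) <= 2 * (2 * `|q|) * halfpow R k.
  by move=> i; exact: geo_limC (dc i).
exists (x - \sum_i l i *: g i), l; split; last by rewrite subrK.
apply: (eclosed_geo cF (u := f)) => [k|]; first exact: (fP k).1.
move=> k; instantiate (1 := 1 + \sum_i 2 * (2 * `|q|) * nm (g i)).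
have -> : f k - (x - \sum_i l i *: g i) = (y k - x) - \sum_i (c k i - l i) *: g i.
  rewrite (fP k).2 opprB; under [X in _ = _ - X]eq_bigr do rewrite scalerBl.
  rewrite sumrB opprB (AC (1*2) ((1*3)*2)) /=.
  by rewrite [RHS](AC ((2*1)*2) ((1*3)*(2*5)*4)) /= subrr addr0.
apply: (le_trans (nmB _ _)); rewrite mulrDl mul1r; apply: lerD.
  by rewrite nmBC; exact: ltW (yP k).2.
apply: (le_trans (nm_sum _)); rewrite mulr_suml; apply: ler_sum => i _.
rewrite nmZ; have := lP i k; have := nm_ge0 (g i); nra.
Qed.

(** Riesz's lemma, iterated. The new vector is [x - y] normalized, with [y] in the span so far and
    nearest to [x] up to a factor 2. Its coefficient is then at most [2 * s], the rest of the
    combination has norm at most [3 * s], and every step multiplies the constant by 3. *)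
Lemma almost_orthonormal F A n : csub F -> is_subspace A ->
  (forall x, F x -> A x) -> has_indep F A n ->
  exists g : 'I_n -> X, [/\ forall i, A (g i), forall i, nm (g i) <= 1 &
    qindep F g (3 ^+ n)].
Proof.
move=> cF sA FA; have sF := cF.1; elim: n => [|n IH] hn.
  by exists (fun=> 0); split=> [[]|[]|a f _ []].
have [g [Ag g1 qg]] := IH (has_indep_tail hn).
have [sG cG] := csub_modspan cF qg.
have [x [Ax nx]] : exists x, A x /\ ~ modspan F g x.
  apply: contrapT => H; have : codim_le F A n.
    exists g; split=> // x Ax; apply: contrapT => H2; apply: H; exists x; split=> //.
    move=> [f [c [Ff xE]]]; apply: H2; exists f, (\sum_i c i *: g i).
    by split=> //; split=> //; exists c.
  by move/(codim_leP _ sF sA).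
have [d [d0 dP]] : exists d : R, 0 < d /\ forall y, modspan F g y -> d <= nm (x - y).
  apply: contrapT => H; apply: nx; apply: cG => e e0; apply: contrapT => H2.
  apply: H; exists e; split=> // y Gy; rewrite leNgt; apply/negP => h; apply: H2.
  by exists y.
pose D := [set r : R | exists y, modspan F g y /\ r = nm (x - y)].
have D0 : has_inf D.
  split; first by exists (nm (x - 0)), 0; split=> //; exact: sub_0.
  by exists 0 => _ [y [_ ->]]; exact: nm_ge0.
have id : d <= inf D.
  by apply: lb_le_inf; [exact: D0.1|move=> _ [y [Gy ->]]; exact: dP].
have i0 : 0 < inf D by exact: lt_le_trans id.
have [_ [y [Gy ->]] xy] := inf_adherent i0 D0.
have infP z : modspan F g z -> inf D <= nm (x - z).
  by move=> Gz; apply: inf_lbound; [exact: D0.2|exists z].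
have nxy : 0 < nm (x - y) by apply: lt_le_trans (infP _ Gy).
have Ay : A y.
  have [f [c [Ff ->]]] := Gy; apply: sub_D => //; first exact: FA.
  exact: sub_comb.
pose t := ((nm (x - y))^-1%:C)%C : C; pose h := t *: (x - y).
have nt : nm t = (nm (x - y))^-1 by rewrite nmr ger0_norm// invr_ge0 ltW.
have t0 : t != 0 by apply/eqP => t0; move: nt; rewrite t0 nm0 => /eqP; rewrite eq_sym invr_eq0 gt_eqF.
have h1 : nm h <= 1 by rewrite nmZ nt mulVf// gt_eqF.
exists (fcons h g); split; first by apply: fconsP => //; apply: sub_Z => //; exact: sub_B.
  exact: (fconsP (P := fun x => nm x <= 1)).
move=> a f Ff.
set s := nm _.
have key : nm (a ord0) <= 2 * s.
  have [->|a0] := eqVneq (a ord0) 0; first by rewrite nm0; have := nm_ge0 (\sum_j a j *: fcons h g j + f); rewrite -/s; lra.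
  have na := nm_gt0 a0.
  pose z := \sum_i a (lift ord0 i) *: g i + f.
  (* Divided by the coefficient of [x - y], the whole combination becomes [x] minus a vector of the
     span, so its norm is at least [inf D]. *)
  have Gz : modspan F g (y - (a ord0 * t)^-1 *: z).
    apply: sub_B => //; apply: sub_Z => //.
    by exists f, (fun i => a (lift ord0 i)); rewrite /z addrC.
  have := infP _ Gz; rewrite opprB addrCA addrC.
  have -> : x - y + (a ord0 * t)^-1 *: z = (a ord0 * t)^-1 *: (a ord0 *: h + z).
    rewrite (scalerDr _ (a ord0 *: h) z) /h !scalerA -(mulrA _ (a ord0)) mulVf ?scale1r//.
    by rewrite mulf_neq0.
  have -> : a ord0 *: h + z = \sum_j a j *: fcons h g j + f by rewrite sum_fcons addrA.
  rewrite nmZ nmV nmM nt -/s => h2.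
  have h3 : nm (x - y) < 2 * inf D by rewrite mulrC mulr_natr mulr2n.
  have E : (nm (a ord0) * (nm (x - y))^-1)^-1 * s = nm (x - y) * (s / nm (a ord0)).
    by field; rewrite !gt_eqF.
  rewrite E in h2.
  have : 1 < 2 * (s / nm (a ord0)) by rewrite -(ltr_pM2l nxy); lra.
  by rewrite mulrA ltr_pdivlMr// mul1r => /ltW.
have s0 : 0 <= s by exact: nm_ge0.
have p1 : 1 <= 3 ^+ n :> R by rewrite exprn_ege1// ler1n.
move=> i; case: (unliftP ord0 i) => [j ->|->]; rewrite exprS; last by nra.
have h2 : nm (\sum_i a (lift ord0 i) *: g i + f) <= 3 * s.
  have -> : \sum_i a (lift ord0 i) *: g i + f =
     (\sum_j a j *: fcons h g j + f) - a ord0 *: h.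
    by rewrite sum_fcons [RHS](AC (3*1) ((1*4)*(2*3))) /= subrr add0r.
  apply: (le_trans (nmB _ _)); rewrite -/s nmZ; have := nm_ge0 (a ord0); nra.
have := qg (fun i => a (lift ord0 i)) f Ff j.
rewrite /=; nra.
Qed.

Lemma csub_codim F A n : csub F -> is_subspace A -> (forall x, F x -> A x) ->
  codim_le F A n -> csub A.
Proof.
move=> cF sA FA /(basis_mod cF.1 sA)[k [hk nk]].
have [g [Ag _ qg]] := almost_orthonormal cF sA FA hk.
suff -> : A = modspan F g by exact: csub_modspan qg.
apply/seteqP; split=> x.
  exact: (spans_mod cF.1 sA Ag (qindep_findep cF.1 qg) nk).
move=> [f [c [Ff ->]]]; apply: sub_D => //; first exact: FA.
exact: sub_comb.
Qed.

Lemma csub_add_findim M N n : csub M -> is_subspace N -> dim_le N n ->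
  csub (sumset M N).
Proof.
move=> cM sN [v Nv]; have sM := cM.1.
have sMN := is_subspaceD sM sN.
apply: (@csub_codim M _ n) => //.
  by move=> x Mx; exists x, 0; split; rewrite ?addr0//; exact: sub_0.
apply/(codim_leP _ sM sMN) => -[g [Ag ig]]; apply: (@dependent _ _ M _ _ v g) => // i.
have [m [y [Mm /Nv[c ->] ->]]] := Ag i.
by exists m, c.
Qed.

Lemma csub_findim N n : is_subspace N -> dim_le N n -> csub N.
Proof.
move=> sN dN; have : csub (sumset [set 0] N) by apply: csub_add_findim dN => //; exact: csub0.
congr csub; apply/seteqP; split=> x.
  by move=> [_ [y [-> Ny ->]]]; rewrite add0r.
by move=> Nx; exists 0, x; rewrite add0r.
Qed.

(** The open mapping theorem for the map from [M] times the space of coefficient families [a] that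
    sends the pair of [x] and [a] to [S x + \sum_i a i *: v i]. The finite factor gives control over
    a complement of the range. *)
Lemma open_mapping_fin S M n (v : 'I_n -> X) F : bounded_op S -> csub M -> csub F ->
  (forall x (a : 'I_n -> C), M x -> F (S x + \sum_i a i *: v i)) ->
  (forall y, F y -> exists x (a : 'I_n -> C), M x /\ y = S x + \sum_i a i *: v i) ->
  exists2 c : R, 0 < c & forall y, F y -> exists x (a : 'I_n -> C),
    [/\ M x, nm x <= c * nm y, forall i, nm (a i) <= c * nm y &
        y = S x + \sum_i a i *: v i].
Proof.
move=> bS [sM cM] cF MF FM.
pose B (r : R) : set X := [set y | exists x (a : 'I_n -> C),
    [/\ M x, nm x <= r, forall i, nm (a i) <= r & y = S x + \sum_i a i *: v i]].
have := @open_mapping R X F B cF; case.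
- move=> y /FM[x [a [Mx yE]]]; exists (nm x + \sum_i nm (a i)), x, a; split=> //.
    by rewrite lerDl sumr_ge0// => i _; exact: nm_ge0.
  move=> i; rewrite (bigD1 i)//= addrCA lerDl addr_ge0 ?nm_ge0//.
  by rewrite sumr_ge0// => j _; exact: nm_ge0.
- by move=> r y [x [a [Mx _ _ ->]]]; exact: MF.
- move=> r s y rs [x [a [Mx xr ar ->]]]; exists x, a; split=> //.
    exact: le_trans rs.
  by move=> i; exact: le_trans rs.
- move=> r s _ _ [x [a [Mx xr ar ->]]] [x' [a' [Mx' xr' ar' ->]]].
  exists (x + x'), (fun i => a i + a' i); split.
  + exact: sub_D.
  + by rewrite (le_trans (nmD _ _))// lerD.
  + by move=> i; rewrite (le_trans (nmD _ _))// lerD.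
  + rewrite (blinD bS) addrACA -big_split /=; congr (_ + _).
    by apply: eq_bigr => i _; rewrite scalerDl.
- move=> r b _ [x [a [Mx xr ar ->]]]; exists (b *: x), (fun i => b * a i); split.
  + exact: sub_Z.
  + by rewrite nmZ ler_wpM2l// nm_ge0.
  + by move=> i; rewrite nmM ler_wpM2l// nm_ge0.
  + rewrite (blinZ bS) scalerDr scaler_sumr; congr (_ + _).
    by apply: eq_bigr => i _; rewrite scalerA.
- move=> r y s /choice[x /choice[a H]] [b hb].
  have [|l lP] := @geo_lim R X (fun k => \sum_(j < k) x j) r.
    by move=> k; rewrite big_ord_recr /= addrAC subrr add0r; have [] := H k.
  have /choice[m mP] : forall i, exists m, forall k, nm (\sum_(j < k) a j i - m) <= 2 * r * halfpow R k.
    move=> i; apply: (@geo_limC R (fun k => \sum_(j < k) a j i)) => k.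
    by rewrite big_ord_recr /= addrAC subrr add0r; have [] := H k.
  exists l, m; split.
  + by apply: (eclosed_geo cM _ lP) => k; apply: sub_sum => // j; have [] := H j.
  + by have := lP 0%N; rewrite big_ord0 sub0r nmN /halfpow expr0 mulr1.
  + by move=> i; have := mP i 0%N; rewrite big_ord0 sub0r nmN /halfpow expr0 mulr1.
  + have [b' hb'] := blin_geo bS lP.
    apply: (@nm_halfpow_eq R X _ _ b (b' + \sum_i 2 * r * nm (v i)) _ hb) => k.
    have -> : \sum_(j < k) y j - (S l + \sum_i m i *: v i) =
       (S (\sum_(j < k) x j) - S l) + \sum_i (\sum_(j < k) a j i - m i) *: v i.
      under [X in _ = _ + X]eq_bigr do rewrite scalerBl scaler_suml.
      rewrite sumrB exchange_big /= addrACA -opprD (blin_sum bS) -big_split /=.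
      by congr (_ - _); apply: eq_bigr => j _; have [] := H j.
    rewrite mulrDl (le_trans (nmD _ _))// lerD//.
    rewrite (le_trans (nm_sum _))// mulr_suml; apply: ler_sum => i _.
    by rewrite nmZ mulrAC ler_wpM2r// nm_ge0.
- by move=> c c0 cP; exists c.
Qed.

(* The conclusion of the open mapping theorem for [S : M -> S M]. *)
Definition lifts S M (c : R) := forall x, M x ->
  exists w, [/\ M w, S w = S x & nm w <= c * nm (S x)].

Lemma closed_ran_lifts S M : bounded_op S -> csub M -> eclosed (ran_on S M) ->
  exists2 c : R, 0 < c & lifts S M c.
Proof.
move=> bS cM cR.
have [|||c c0 H] := @open_mapping_fin S M 0 (fun=> 0) (ran_on S M) bS cM.
- by split=> //; apply: is_subspace_ran => //; exact: cM.1.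
- by move=> x a Mx; rewrite big_ord0 addr0; exists x.
- by move=> _ [x Mx <-]; exists x, (fun=> 0); rewrite big_ord0 addr0.
exists c => // x Mx; have [|w [a [Mw wc _]]] := H (S x); first by exists x.
by rewrite big_ord0 addr0 => E; exists w.
Qed.

(** Coefficients along a basis [g] modulo the range are unique. For [y] in the closure of the range
    they agree with those of [y - S x'], which the open mapping theorem bounds by a multiple of an
    arbitrarily small norm; so they vanish. *)
Lemma closed_codim S M n : bounded_op S -> csub M -> invariant S M ->
  codim_le (ran_on S M) M n -> eclosed (ran_on S M).
Proof.
move=> bS cM /invP iM; have sM := cM.1; have sR := is_subspace_ran bS sM.
move=> /(basis_mod sR sM)[k [[g [Mg ig]] nk]].
have [x a Mx|y My|c c0 H] := @open_mapping_fin S M k g M bS cM cM.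
- by apply: sub_D => //; [exact: iM|exact: sub_comb].
- have [_ [a [[x Mx <-] yE]]] := spans_mod sR sM Mg ig nk My.
  by exists x, a.
move=> y cly.
have My : M y.
  by apply: cM.2 => e /cly[_ [[x Mx <-] h]]; exists (S x); split=> //; exact: iM.
have [x [a [Mx _ _ yE]]] := H y My.
suff a0 i : a i = 0.
  rewrite yE big1 ?addr0; first by exists x.
  by move=> i _; rewrite a0 scale0r.
apply: nm_eq0; apply/ler_addgt0Pr => e e0; rewrite add0r.
have [_ [[x' Mx' <-] h]] := cly _ (divr_gt0 e0 c0).
have [|w [b [Mw _ bc E]]] := H (y - S x'); first by apply: sub_B => //; exact: iM.
suff -> : a i = b i.
  by rewrite (le_trans (bc i))// mulrC -ler_pdivlMr// ltW.
apply/eqP; rewrite -subr_eq0; apply/eqP.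
apply: (ig (fun i => a i - b i)); exists (w + x' - x).
  by apply: sub_B => //; exact: sub_D.
rewrite (blinB bS) (blinD bS); under eq_bigr do rewrite scalerBl.
rewrite sumrB; apply/eqP; rewrite eq_sym subr_eq addrC; apply/eqP.
have : y = S x' + (S w + \sum_i b i *: g i) by rewrite -E addrC subrK.
rewrite {1}yE => E2; apply: (@addrI _ (S x)); rewrite E2.
by rewrite [RHS](AC (1*(1*((1*1)*1))) (1*5*4*(3*2))) /= subrr add0r addrC.
Qed.

(** A convergent sequence in the range is lifted difference by difference, so that the preimages
    converge as well. *)
Lemma lifts_closed_ran S M c : bounded_op S -> csub M -> lifts S M c -> eclosed (ran_on S M).
Proof.
move=> bS [sM cM] om y cly.
have /choice[u uP] : forall k, exists x, M x /\ nm (y - S x) < halfpow R k.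
  by move=> k; have [_ [[x Mx <-] h]] := cly _ (halfpow_gt0 R k); exists x.
have /choice[w wP] : forall k, exists w, [/\ M w, S w = S (u k.+1 - u k) & nm w <= c * nm (S (u k.+1 - u k))].
  by move=> k; apply: om; apply: sub_B => //; exact: (uP _).1.
pose s k := u 0%N + \sum_(j < k) w j.
have Ss k : S (s k) = S (u k).
  elim: k => [|k IH]; first by rewrite /s big_ord0 addr0.
  have [_ E _] := wP k; rewrite /s big_ord_recr /= addrA (blinD bS) -/(s k) IH E (blinB bS).
  by rewrite addrC subrK.
have Ms k : M (s k).
  by apply: sub_D => //; [exact: (uP _).1|apply: sub_sum => // j; have [] := wP j].
have [|l lP] := @geo_lim R X s (2 * `|c|).
  move=> k; rewrite /s big_ord_recr /= addrA [X in nm X]addrAC subrr add0r.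
  have [_ _ h] := wP k; apply: (le_trans h); rewrite (blinB bS).
  have h1 := (uP k.+1).2; have h2 := (uP k).2.
  have := nmD3 (S (u k.+1)) y (S (u k)); rewrite (nmBC _ y).
  have := halfpow_le R (leqnSn k); have := ler_norm c; have := normr_ge0 c.
  have := nm_ge0 (S (u k.+1) - S (u k)); nra.
exists l; first exact: (eclosed_geo cM Ms lP).
have [b hb] := blin_geo bS lP.
apply: (nm_halfpow_eq hb (b := 1)) => k; rewrite Ss nmBC mul1r; exact: ltW (uP k).2.
Qed.

(** A lift of [S x] differs from [x] by a kernel vector, hence stays in [F]; the lifting constant of
    [M] is inherited. *)
Lemma closed_ran_of_ker S M c F : bounded_op S -> csub M -> lifts S M c -> csub F ->
  (forall x, F x -> M x) -> (forall x, ker_on S M x -> F x) ->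
  eclosed (ran_on S F).
Proof.
move=> bS cM om cF FM kF; apply: (@lifts_closed_ran S F c) => // x Fx.
have [w [Mw Sw wc]] := om _ (FM _ Fx); exists w; split=> //.
rewrite -[w](subrK x); apply: sub_D => //; first exact: cF.1.
apply: kF; split; first by apply: sub_B => //; [exact: cM.1|exact: FM].
by rewrite (blinB bS) Sw subrr.
Qed.

(** Successive correction: solving again for the remainder halves it each time, and the geometric
    series of corrections accounts for the factor 2. *)
Lemma approx_surjective S Z c : bounded_op S -> csub Z ->
  (forall z, Z z -> exists w, [/\ Z w, Z (S w), nm w <= c * nm z & nm (z - S w) <= nm z / 2]) ->
  forall z, Z z -> exists w, [/\ Z w, S w = z & nm w <= 2 * c * nm z].
Proof.
move=> bS [sZ cZ] H z Zz.
have /choice[g gP] : forall y, exists w, Z y -> [/\ Z w, Z (S w), nm w <= c * nm y & nm (y - S w) <= nm y / 2].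
  by move=> y; have [/H[w ?]|nZ] := pselect (Z y); [exists w|exists 0].
pose u := fix u n := if n is n.+1 then u n - S (g (u n)) else z.
have Zu k : Z (u k) by elim: k => // k IH; have [] := gP _ IH => *; exact: sub_B.
have nu k : nm (u k) <= nm z * halfpow R k.
  elim: k => [|k IH]; first by rewrite /halfpow expr0 mulr1.
  have [_ _ _ /=] := gP _ (Zu k); rewrite halfpowS; lra.
pose s k := \sum_(j < k) g (u j).
have Ss k : S (s k) = z - u k.
  elim: k => [|k IH]; first by rewrite /s big_ord0 (blin0 bS) subrr.
  by rewrite /s big_ord_recr /= (blinD bS) -/(s k) IH opprB addrA [RHS]addrAC.
have gu k : nm (g (u k)) <= c * nm z * halfpow R k.
  have [_ _ h _] := gP _ (Zu k); have := nu k.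
  (* A negative [c] is compatible with the hypothesis only when [z] has norm 0. *)
  have [c0|c0] := lerP 0 c; first by nra.
  have z0 : nm z <= 0.
    have [w [_ _ h1 _]] := H _ Zz; have := nm_ge0 w; nra.
  have -> : nm z = 0 by apply/eqP; rewrite eq_le z0 nm_ge0.
  rewrite mulr0 mul0r => h2; have := nm_ge0 (u k); nra.
have [|l lP] := @geo_lim R X s (c * nm z).
  by move=> k; rewrite /s big_ord_recr /= addrAC subrr add0r.
exists l; split.
- apply: (eclosed_geo cZ _ lP) => k; apply: sub_sum => // j.
  by have [] := gP _ (Zu j).
- have [b hb] := blin_geo bS lP.
  by apply: (nm_halfpow_eq hb (b := nm z)) => k; rewrite Ss addrAC subrr add0r nmN.
- by have := lP 0%N; rewrite /s big_ord0 sub0r nmN /halfpow expr0; lra.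
Qed.

End ClosedRange.

(** * Perturbation of Kato operators *)

Section KatoPerturbation.
Variables (R : realType) (X : completeNormedModType R[i]).
Local Notation C := R[i].
Implicit Types (M N F A G Z : set X) (x y z : X) (S K : X -> X).

(** Each iterated range is the image of the previous one, which contains the kernel. The kernel
    inclusion is assumed only below [n] so that the lemma also serves in [peel], where it fails
    later on. *)
Lemma csub_iter_ran K M n : bounded_op K -> csub M -> invariant K M ->
  eclosed (ran_on K M) ->
  (forall m, (m < n)%N -> ker_on K M `<=` ran_on (iter m K) M) ->
  csub (ran_on (iter n K) M).
Proof.
move=> bK cM iM cR.
have [c c0 om] := closed_ran_lifts bK cM cR.
elim: n => [_|n IH kR].
  congr csub : cM; apply/seteqP; split=> x; first by exists x.
  by move=> [y My <-].
have {}IH : csub (ran_on (iter n K) M) by apply: IH => m /ltnW; exact: kR.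
have -> : ran_on (iter n.+1 K) M = ran_on K (ran_on (iter n K) M).
  apply/seteqP; split=> x.
    by move=> [y My <-]; exists (iter n K y) => //; exists y.
  by move=> [_ [y My <-] <-]; exists y.
split; first by apply: is_subspace_ran => //; exact: IH.1.
apply: (closed_ran_of_ker bK cM om IH); last exact: kR.
by move=> _ [y My <-]; exact: inv_iter.
Qed.

(** The generalized range, or hyperrange, of [K] on [M]. *)
Definition gen_range K M : set X := [set x | forall n, ran_on (iter n K) M x].

Lemma gen_rangeP K M : bounded_op K -> csub M -> invariant K M -> Kato_on K M ->
  [/\ csub (gen_range K M), forall z, gen_range K M z -> M z,
      forall z, gen_range K M z -> gen_range K M (K z),
      forall x, M x -> gen_range K M (K x) -> gen_range K M x &
      forall x, ker_on K M x -> gen_range K M x].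
Proof.
move=> bK cM iM [/closedE cR kR]; have sM := cM.1.
have cn n : csub (ran_on (iter n K) M) by exact: csub_iter_ran.
split.
- split; first split.
  + by move=> n; exact: (sub_0 (cn n).1).
  + by move=> a x y Zx Zy n; apply: (cn n).1.2.
  + move=> x H n; apply: (cn n).2 => e /H[y [Zy xy]].
    by exists y; split=> //; exact: Zy.
- by move=> z /(_ 0%N)[y My <-].
- move=> z Zz n; have [y My <-] := Zz n; exists (K y).
    by apply: iM; exists y.
  by rewrite -iterSr.
- move=> x Mx Zx n; have [y My E] := Zx n.+1.
  rewrite iterS in E; rewrite -[x](subrK (iter n K y)).
  apply: (sub_D (cn n).1); last by exists y.
  apply: kR; split; first by apply: (sub_B sM) => //; exact: inv_iter.
  by rewrite (blinB bK) E subrr.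
- by move=> x kx n; exact: kR.
Qed.

(** On the generalized range [Z], [K] is onto with a bounded choice of preimages, and [K - l]
    remains so. Modulo [Z], which contains the kernel, [K] is bounded below, and [K - l] remains so.
    Hence [x] may be replaced by [x - z + w], where [z] in [Z] is close to [x] and [w] lifts
    [K z - l z] inside [Z]. *)
Lemma Kato_lifts_perturb K M : bounded_op K -> csub M -> invariant K M -> Kato_on K M ->
  exists e c : R, [/\ 0 < e, 0 < c & forall l : C, nm l <= e -> lifts (opsub K l) M c].
Proof.
move=> bK cM iM kM; have [cZ ZM KZ ZK kZ] := gen_rangeP bK cM iM kM.
have [/closedE cR _] := kM; have [c c0 om] := closed_ran_lifts bK cM cR.
have [b b0 hb] := bK.2; have sZ := cZ.1; have sM := cM.1.
set Z := gen_range K M in cZ ZM KZ ZK kZ sZ.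
have KsZ z : Z z -> exists w, [/\ Z w, K w = z & nm w <= c * nm z].
  move=> Zz; have [y My E] := Zz 1%N; rewrite /= in E.
  have [w [Mw Kw wc]] := om y My; exists w; rewrite Kw E in wc *; split=> //.
  by apply: ZK => //; rewrite Kw E.
(* Chosen so that [nm l * c] is at most one half, which makes both corrections below contract. *)
pose e := (2 * c)^-1; have e0 : 0 < e by rewrite invr_gt0 mulr_gt0.
have ec : e * c = 2^-1 by rewrite /e; field; rewrite gt_eqF.
pose B := b + e; have B0 : 0 < B by rewrite addr_gt0.
(* The first term bounds [x - z] and the second bounds [w]; [B] bounds the norm of [K - l] on the
   disc. *)
pose c2 := 3 * c + 2 * c * (1 + B * (3 * c)).
have c20 : 0 < c2 by rewrite /c2 addr_gt0 ?mulr_gt0 ?addr_gt0 ?mulr_gt0.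
exists e, c2; split=> // l le.
have bKl := blin_opsub bK l.
have nKl x : nm (opsub K l x) <= B * nm x.
  rewrite /opsub (le_trans (nmB _ _))// nmZ /B mulrDl lerD//.
  by rewrite ler_wpM2r// nm_ge0.
have lc t : 0 <= t -> nm l * (c * t) <= t / 2.
  move=> t0; rewrite mulrA; have -> : t / 2 = (e * c) * t by rewrite ec mulrC.
  by rewrite ler_wpM2r// ler_wpM2r// ltW.
have KlsZ : forall z, Z z -> exists w, [/\ Z w, opsub K l w = z & nm w <= 2 * c * nm z].
  apply: (approx_surjective bKl cZ) => z Zz; have [w [Zw Kw wc]] := KsZ z Zz.
  exists w; split=> //.
    by rewrite /opsub; apply: (sub_B sZ); [exact: KZ|exact: (sub_Z sZ)].
  rewrite /opsub Kw opprB addrCA subrr addr0 nmZ.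
  apply: le_trans (lc _ (nm_ge0 z)).
  by rewrite ler_wpM2l// nm_ge0.
have ZKl z : Z z -> Z (opsub K l z).
  by move=> Zz; apply: (sub_B sZ); [exact: KZ|exact: (sub_Z sZ)].
move=> x Mx; set y := opsub K l x.
(* The distance from [x] to [Z] is improved step by step: modulo [Z], [K x] equals
   [y + l *: (x - z)], and lifting this replaces the error by [c * nm y] plus half of it, with fixed
   point [2 * c * nm y]. *)
have near : forall n, exists z, Z z /\ nm (x - z) <= 2 * c * nm y + nm x * halfpow R n.
  elim=> [|n [z [Zz xz]]].
    exists 0; split; first exact: (sub_0 sZ).
    by rewrite subr0 /halfpow expr0 mulr1 lerDr mulr_ge0 ?nm_ge0// mulr_ge0// ltW.
  have [z' [Zz' Kz' _]] := KsZ _ (sub_N sZ (ZKl _ Zz)).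
  have [w [Mw Kw wc]] := om (x - z - z') (sub_B sM (sub_B sM Mx (ZM _ Zz)) (ZM _ Zz')).
  have E : K (x - z - z') = y + l *: (x - z).
    rewrite !(blinB bK) Kz' opprK /y /opsub scalerBr.
    by rewrite !addrA !subrK.
  exists (x - w); split.
    have -> : x - w = (x - z - z' - w) + (z + z').
      by rewrite [RHS](AC (4*2) (1*4*(5*2)*(6*3))) /= !subrr !addr0.
    apply: (sub_D sZ); last exact: (sub_D sZ).
    apply: kZ; split; last by rewrite (blinB bK) Kw subrr.
    by do 3?[apply: (sub_B sM) => //]; exact: ZM.
  rewrite opprB addrCA subrr addr0; apply: (le_trans wc); rewrite E.
  have h1 := nmD y (l *: (x - z)); rewrite nmZ in h1.
  have := lc _ (nm_ge0 (x - z)); rewrite halfpowS; nra.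
(* For nonzero [y] a slack of [c * nm y] is available to stop the approximation, giving [3 * c]; for
   [y = 0] the lift is 0. *)
have [y0|y0] := eqVneq y 0.
  exists 0; rewrite y0 !nm0 mulr0; split=> //; first exact: (sub_0 sM).
  by rewrite (blin0 bKl).
have [n hn] := @halfpow_small_mul R (nm x) (c * nm y) (mulr_gt0 c0 (nm_gt0 y0)).
have [z [Zz xz]] := near n.
have {}xz : nm (x - z) <= 3 * c * nm y by lra.
have [w [Zw Kw wc]] := KlsZ _ (ZKl z Zz).
exists (x - z + w); split.
- by apply: (sub_D sM); [apply: (sub_B sM) => //|]; exact: ZM.
- by rewrite (blinD bKl) (blinB bKl) Kw subrK.
- apply: (le_trans (nmD _ _)).
  have E : opsub K l z = y - opsub K l (x - z) by rewrite (blinB bKl) -/y opprB addrC subrK.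
  have h1 := nmB y (opsub K l (x - z)); rewrite -E in h1.
  have h2 := nKl (x - z).
  have h3 : B * nm (x - z) <= B * (3 * c * nm y) by rewrite ler_wpM2l// ltW.
  have h4 : nm (opsub K l z) <= nm y * (1 + B * (3 * c)) by lra.
  have : 2 * c * nm (opsub K l z) <= 2 * c * (nm y * (1 + B * (3 * c))).
    by rewrite ler_wpM2l// mulr_ge0// ltW.
  rewrite /c2; lra.
Qed.

(** Summing the [n] bounds gives [s <= n%:R * t * s], which forces [s = 0]. *)
Lemma small_sum0 n (a : 'I_n -> C) (t : R) : n%:R * t < 1 ->
  (forall i, nm (a i) <= t * \sum_j nm (a j)) -> forall i, a i = 0.
Proof.
move=> nt H; set s := \sum_j nm (a j) in H.
have s0 : 0 <= s by apply: sumr_ge0 => j _; exact: nm_ge0.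
have : s <= n%:R * t * s.
  rewrite {1}/s; apply: (le_trans (ler_sum _ (fun i _ => H i))).
  by rewrite sumr_const card_ord -[leLHS]mulr_natl mulrA.
move=> h; have {}s0 : s = 0.
  by apply/eqP; rewrite eq_le s0 andbT; nra.
by move=> i; apply: nm_eq0; have := H i; rewrite s0 mulr0.
Qed.

Lemma nm_comb_le n (a : 'I_n -> C) (v : 'I_n -> X) (d : R) :
  (forall i, nm (v i) <= d) -> nm (\sum_i a i *: v i) <= d * \sum_i nm (a i).
Proof.
move=> vd; apply: (le_trans (nm_sum _)); rewrite mulr_sumr.
by apply: ler_sum => i _; rewrite nmZ mulrC ler_wpM2r// nm_ge0.
Qed.

Section Steps.
Variables (S : X -> X) (M : set X) (c : R).
Hypotheses (bS : bounded_op S) (cM : csub M) (c0 : 0 < c).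

Lemma opsub_swap l m x : opsub S l x = opsub S m x + (m - l) *: x.
Proof. by rewrite /opsub scalerBl addrA subrK. Qed.

(* Correcting each vector of an almost orthonormal family in one kernel moves it
   into the other kernel, by too little to destroy independence. *)
Lemma ker_step n l m : lifts (opsub S m) M c ->
  n%:R * (3 ^+ n * (c * nm (l - m))) < 1 ->
  has_indep [set 0] (ker_on (opsub S l) M) n ->
  has_indep [set 0] (ker_on (opsub S m) M) n.
Proof.
move=> om small; have bl := blin_opsub bS l; have bm := blin_opsub bS m.
have cl := csub_ker bl cM.
move=> /(almost_orthonormal (csub0 X) cl.1)[|g [kg g1 qg]].
  by move=> _ ->; exact: (sub_0 cl.1).
have /choice[w wP] : forall i, exists w, [/\ M w, opsub S m w = opsub S m (g i) & nm w <= c * nm (l - m)].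
  move=> i; have [Mg Sg] := kg i; have [w [Mw E wc]] := om _ Mg; exists w; split=> //.
  apply: (le_trans wc); rewrite ler_wpM2l ?(ltW c0)//.
  rewrite (opsub_swap m l) Sg add0r nmZ -[leRHS]mulr1; apply: ler_wpM2l => //.
  exact: nm_ge0.
exists (fun i => g i - w i); split.
  move=> i; have [Mg _] := kg i; have [Mw E _] := wP i; split.
    by apply: (sub_B cM.1).
  by rewrite (blinB bm) E subrr.
move=> a a0; apply: (small_sum0 small) => i.
have := qg a 0 erefl i; rewrite addr0.
have -> : \sum_j a j *: g j = \sum_j a j *: w j.
  apply/eqP; rewrite -subr_eq0 -sumrB.
  by under eq_bigr do rewrite -scalerBr; rewrite a0.
move=> h; apply: (le_trans h); rewrite -mulrA ler_wpM2l ?exprn_ge0//.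
by apply: nm_comb_le => j; have [] := wP j.
Qed.

(** The same family works for both ranges. A combination in the range of [S - m] has a small
    preimage [w], so it is within [nm (l - m) * nm w] of the range of [S - l], and [qindep] makes
    the coefficients vanish. *)
Lemma ran_step n l m : invariant S M -> lifts (opsub S m) M c -> lifts (opsub S l) M c ->
  n%:R * (3 ^+ n * (c * nm (l - m))) < 1 ->
  has_indep (ran_on (opsub S l) M) M n -> has_indep (ran_on (opsub S m) M) M n.
Proof.
move=> iM om ol small; have bl := blin_opsub bS l; have bm := blin_opsub bS m.
have cl : csub (ran_on (opsub S l) M).
  by split; [exact: (is_subspace_ran bl cM.1)|exact: lifts_closed_ran ol].
move=> /(almost_orthonormal cl cM.1)[|g [Mg g1 qg]].
  exact: inv_opsub cM.1 iM.
exists g; split=> // a [y My yE]; apply: (small_sum0 small) => i.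
have [w [Mw wE wc]] := om y My.
have h := qg a (- opsub S l w) (sub_N cl.1 _) i.
have {}h := h (ex_intro2 _ _ w Mw erefl).
rewrite (opsub_swap l m) wE yE opprD addrA subrr add0r nmN nmZ in h.
apply: (le_trans h); rewrite -mulrA ler_wpM2l ?exprn_ge0//.
rewrite -(nmN (m - l)) opprB [c * _]mulrC -mulrA ler_wpM2l ?nm_ge0//.
apply: (le_trans wc); rewrite yE ler_wpM2l ?(ltW c0)//.
by have := nm_comb_le a g1; rewrite mul1r.
Qed.
End Steps.

(** Finitely many steps of length at most [d] along the segment from [l] to [m], which stays in the
    disc by convexity. *)
Lemma disc_chain (P : C -> Prop) (e d : R) : 0 < d ->
  (forall l m, nm l <= e -> nm m <= e -> nm (l - m) <= d -> P l -> P m) ->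
  forall l m, nm l <= e -> nm m <= e -> P l -> P m.
Proof.
move=> d0 H l m le me Pl.
pose n := (Num.bound ((nm (m - l)) / d)).+1.
have n0 : (0 : R) < n%:R by rewrite ltr0n.
have nd : nm (m - l) / n%:R <= d.
  rewrite ler_pdivrMr// mulrC -ler_pdivrMr//.
  apply: (@le_trans _ _ (Num.bound (nm (m - l) / d))%:R).
    by apply/ltW/archi_boundP; rewrite divr_ge0 ?nm_ge0// ltW.
  by rewrite ler_nat.
pose p k := l + ((k%:R / n%:R)%:C)%C * (m - l).
suff h : forall k, (k <= n)%N -> P (p k).
  by have := h n (leqnn n); rewrite /p divff ?gt_eqF// mul1r addrC subrK.
have pe k : (k <= n)%N -> nm (p k) <= e.
  move=> kn; pose t := k%:R / n%:R : R.
  have t0 : 0 <= t by rewrite divr_ge0.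
  have t1 : t <= 1 by rewrite ler_pdivrMr// mul1r ler_nat.
  have -> : p k = ((1 - t)%:C)%C * l + (t%:C)%C * m.
    by rewrite /p -/t rmorphB /= rmorph1; ring.
  apply: (le_trans (nmD _ _)); rewrite !nmM !nmr !ger0_norm ?subr_ge0//.
  nra.
elim=> [|k IH] kn; first by rewrite /p mul0r mul0r addr0.
apply: (H (p k)) => //; [exact/pe/ltnW|exact: pe| |exact/IH/ltnW].
have -> : p k - p k.+1 = - ((n%:R^-1%:C)%C * (m - l)).
  rewrite /p -[k.+1]addn1 natrD mulrDl mul1r rmorphD /=; ring.
by rewrite nmN nmM nmr ger0_norm ?invr_ge0 ?ler0n// mulrC.
Qed.

(** The radius [e] must serve all [n], while the step allowed by [ker_step] and [ran_step] shrinks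
    with [n]. As the lifting constant is uniform on the disc, the steps can be chained. *)
Lemma Kato_profile K M : bounded_op K -> csub M -> invariant K M -> Kato_on K M ->
  exists e : R, 0 < e /\ forall l : C, nm l <= e ->
   [/\ eclosed (ran_on (opsub K l) M),
    forall n, has_indep [set 0] (ker_on (opsub K l) M) n <->
              has_indep [set 0] (ker_on K M) n &
    forall n, has_indep (ran_on (opsub K l) M) M n <->
              has_indep (ran_on K M) M n].
Proof.
move=> bK cM iM kM; have [e [c [e0 c0 om]]] := Kato_lifts_perturb bK cM iM kM.
have ze : nm (0 : C) <= e by rewrite nm0; exact: ltW.
have dn n : exists2 d : R, 0 < d & forall l m : C, nm (l - m) <= d ->
    n%:R * (3 ^+ n * (c * nm (l - m))) < 1.
  pose t := n%:R * (3 ^+ n * c) + 1 : R.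
  have t0 : 0 < t by rewrite ltr_wpDl// !mulr_ge0// ?exprn_ge0// ltW.
  exists t^-1; rewrite ?invr_gt0// => l m lm.
  have : t * nm (l - m) <= 1 by rewrite mulrC -ler_pdivlMr// mul1r.
  have [->|h] := eqVneq (l - m) 0; first by rewrite nm0 !mulr0.
  by have := nm_gt0 h; rewrite /t; lra.
exists e; split=> // l le; split.
- exact: lifts_closed_ran (blin_opsub bK l) cM (om l le).
- move=> n; have [d d0 dP] := dn n.
  pose P l := has_indep [set 0] (ker_on (opsub K l) M) n.
  have ch : forall l m : C, nm l <= e -> nm m <= e -> P l -> P m.
    apply: (disc_chain d0) => k m ke me km.
    by apply: (ker_step bK cM c0 (om m me)); exact: dP.
  by rewrite -{2}(opsub0 K); split; apply: ch.
- move=> n; have [d d0 dP] := dn n.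
  pose P l := has_indep (ran_on (opsub K l) M) M n.
  have ch : forall l m : C, nm l <= e -> nm m <= e -> P l -> P m.
    apply: (disc_chain d0) => k m ke me km.
    by apply: (ran_step bK cM c0 iM (om m me) (om k ke)); exact: dP.
  by rewrite -{2}(opsub0 K); split; apply: ch.
Qed.

End KatoPerturbation.

(** * The Hahn-Banach theorem *)

Section HahnBanach.
Variables (R : realType) (X : completeNormedModType R[i]).
Local Notation C := R[i].
Local Notation "r %:k" := (real_complex _ r : C) (at level 2).
Implicit Types (M N F A : set X) (x y z : X).

Let realN1 : (-1)%:k = -1. Proof. exact: rmorphN1. Qed.

(** Partial functionals are represented by their graphs, so that extension is inclusion and a chain
    has its union as upper bound. Single-valuedness follows from the bound at the vector 0. *)
Lemma hahn_banach_real F x : csub F -> ~ F x ->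
  exists (u : X -> R) (b : R), [/\ 0 < b,
    forall (r : R) y z, u (r%:k *: y + z) = r * u y + u z,
    forall y, u y <= b * nm y, forall y, F y -> u y = 0 & u x = 1].
Proof.
move=> [sF cF] nFx.
have [d [d0 dP]] : exists d : R, 0 < d /\ forall y, F y -> d <= nm (x - y).
  apply: contrapT => H; apply: nFx; apply: cF => e e0; apply: contrapT => H2.
  apply: H; exists e; split=> // y Fy; rewrite leNgt; apply/negP => h; apply: H2.
  by exists y.
pose b := d^-1; have b0 : 0 < b by rewrite invr_gt0.
pose G0 : set (X * R) := [set p | exists y, F y /\ p.1 = y + p.2%:k *: x].
pose good (G : set (X * R)) := [/\ G0 `<=` G,
  forall (r : R) p q, G p -> G q -> G (r%:k *: p.1 + q.1, r * p.2 + q.2) &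
  forall p, G p -> p.2 <= b * nm p.1].
have goodG0 : good G0.
  split=> //.
  - move=> r p q [y [Fy ->]] [z [Fz ->]]; exists (r%:k *: y + z); split; first exact: sF.2.
    by rewrite /= scalerDr scalerA rmorphD /= scalerDl addrACA rmorphM.
  - move=> [_ r] [y [Fy /= ->]].
    have [r0|r0] := lerP r 0; first by rewrite (le_trans r0)// mulr_ge0 ?nm_ge0// ltW.
    have rk : r%:k != 0 by rewrite (_ : 0 = 0%:k)// (inj_eq (@complexI _)) gt_eqF.
    have -> : y + r%:k *: x = r%:k *: (x - (- r%:k^-1 *: y)).
      by rewrite scalerBr scalerA mulrN divff// scaleN1r opprK addrC.
    rewrite nmZ nmr gtr0_norm// /b mulrC -ler_pdivrMr ?invr_gt0// invrK.
    by rewrite ler_pM2l//; apply: dP; exact: sub_Z.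
pose P (G : set (X * R)) := G = set0 \/ good G.
have [G [[GE|[G0G linG bndG]] maxG]] : exists G, P G /\ forall B, G `<` B -> ~ P B.
  apply: Zorn_bigcup => FF FP tot.
  have [H|H] := pselect (exists2 G, FF G & good G); last first.
    left; apply/seteqP; split=> // p [G FG Gp]; apply: H; exists G => //.
    by have [GE|//] := FP G FG; rewrite GE in Gp.
  right; have gG G p : FF G -> G p -> good G.
    by move=> FG Gp; have [GE|//] := FP G FG; rewrite GE in Gp.
  have [G FG [G0G _ _]] := H; split.
  - by move=> p /G0G Gp; exists G.
  - move=> r p q [A FA Ap] [B FB Bq].
    have [_ lA _] := gG _ _ FA Ap; have [_ lB _] := gG _ _ FB Bq.
    have [AB|BA] := tot A B FA FB.
      by exists B => //; apply: lB => //; exact: AB.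
    by exists A => //; apply: lA => //; exact: BA.
  - by move=> p [A FA Ap]; have [_ _ bA] := gG _ _ FA Ap; exact: bA.
- exfalso; apply: (maxG G0); last by right.
  rewrite GE; split=> // /(_ (0, 0)); apply; exists 0; split; first exact: sub_0.
  by rewrite scale0r addr0.
have G00 : G (0, 0).
  by apply: G0G; exists 0; split; [exact: sub_0|rewrite scale0r addr0].
have scG (r : R) p : G p -> G (r%:k *: p.1, r * p.2).
  by move=> Gp; have := linG r _ _ Gp G00; rewrite !addr0.
(* One-dimensional extension: a value at [y0] lying between the two families compared in [sep] keeps
   the bound. *)
have total y0 : exists t, G (y0, t).
  apply: contrapT => ny0.
  have sep y t y' t' : G (y, t) -> G (y', t') ->
      t - b * nm (y - y0) <= b * nm (y' + y0) - t'.
    move=> Gy Gy'; have := linG 1 _ _ Gy Gy'; rewrite /= mul1r scale1r => /bndG /=.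
    have := nmD (y - y0) (y' + y0).
    rewrite (AC (2*2) ((1*3)*(4*2))) /= subrr addr0.
    by move=> h1 h2; have := ler_wpM2l (ltW b0) h1; lra.
  pose D := [set s : R | exists y t, G (y, t) /\ s = t - b * nm (y - y0)].
  have D0 : D !=set0 by exists (0 - b * nm (0 - y0)), 0, 0.
  pose t0 := sup D.
  have ub0 y t : G (y, t) -> t - b * nm (y - y0) <= t0.
    move=> Gy; apply: ub_le_sup; last by exists y, t.
    by exists (b * nm (0 + y0) - 0) => _ [z [s [Gz ->]]]; exact: sep.
  have lb0 y t : G (y, t) -> t0 <= b * nm (y + y0) - t.
    by move=> Gy; apply: ge_sup => // _ [z [s [Gz ->]]]; exact: sep.
  pose G' : set (X * R) := [set p | exists q (r : R), G q /\
     p = (q.1 + r%:k *: y0, q.2 + r * t0)].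
  have GG' : G `<=` G'.
    by move=> [y t] Gy; exists (y, t), 0; rewrite /= scale0r mul0r !addr0.
  apply: (maxG G').
    split=> // G'G; apply: ny0; exists t0; apply: G'G; exists (0, 0), 1.
    by rewrite /= scale1r mul1r !add0r.
  right; split; first exact: subset_trans GG'.
  - move=> r _ _ [q [s [Gq ->]]] [q' [s' [Gq' ->]]] /=.
    exists (r%:k *: q.1 + q'.1, r * q.2 + q'.2), (r * s + s'); split; first exact: linG.
    congr pair => /=; last by ring.
    by rewrite scalerDr scalerA rmorphD rmorphM /= scalerDl addrACA.
  - move=> _ [[y t] [r [Gq ->]]] /=.
    have [r0|r0|r0] := ltgtP r 0; last by rewrite r0 scale0r mul0r !addr0; exact: bndG Gq.
    + have nr0 : 0 < - r by lra.
      have rk : r%:k != 0 by rewrite (_ : 0 = 0%:k)// (inj_eq (@complexI _)) lt_eqF.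
      have := ub0 _ _ (scG (- r)^-1 _ Gq) => /=.
      have -> : (- r)^-1%:k *: y - y0 = (- r)^-1%:k *: (y + r%:k *: y0).
        rewrite scalerDr scalerA -rmorphM /= invrN mulNr mulVf ?lt_eqF//.
        by rewrite realN1 scaleN1r.
      rewrite nmZ nmr gtr0_norm ?invr_gt0// => h.
      have := ler_wpM2l (ltW nr0) h; rewrite mulrBr mulVKf ?gt_eqF//.
      have -> : - r * (b * ((- r)^-1 * nm (y + r%:k *: y0))) = b * nm (y + r%:k *: y0).
        by field; rewrite lt_eqF.
      lra.
    + have := lb0 _ _ (scG r^-1 _ Gq) => /=.
      have -> : r^-1%:k *: y + y0 = r^-1%:k *: (y + r%:k *: y0).
        by rewrite scalerDr scalerA -rmorphM /= mulVf ?gt_eqF// rmorph1 scale1r.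
      rewrite nmZ nmr gtr0_norm ?invr_gt0// => h.
      have := ler_wpM2l (ltW r0) h; rewrite mulrBr mulVKf ?gt_eqF//.
      have -> : r * (b * (r^-1 * nm (y + r%:k *: y0))) = b * nm (y + r%:k *: y0).
        by field; rewrite gt_eqF.
      lra.
have uniq y t t' : G (y, t) -> G (y, t') -> t' <= t.
  move=> Gt Gt'; have := bndG _ (linG (-1) _ _ Gt Gt').
  rewrite [_.2]/= [_.1]/= realN1 scaleN1r addNr nm0 mulr0; lra.
have /choice[u uG] := total; exists u, b.
have uE y t : G (y, t) -> u y = t.
  by move=> Gy; apply/eqP; rewrite eq_le (uniq _ _ _ Gy (uG y)) (uniq _ _ _ (uG y) Gy).
split=> //.
- by move=> r y z; apply: uE; exact: (linG r _ _ (uG y) (uG z)).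
- by move=> y; exact: bndG (uG y).
- by move=> y Fy; apply: uE; apply: G0G; exists y; rewrite /= scale0r addr0.
- apply: uE; apply: G0G; exists 0; rewrite /= scale1r add0r; split=> //.
  exact: sub_0.
Qed.

(** The real functional [u] is complexified as [u y - i u (i y)]. At [x] this has real part 1 and an
    unknown imaginary part, hence the division by [f x]. *)
Lemma hahn_banach F x : csub F -> ~ F x ->
  exists (f : X -> C), [/\ forall a y z, f (a *: y + z) = a * f y + f z,
    exists2 b : R, 0 < b & forall y, nm (f y) <= b * nm y,
    forall y, F y -> f y = 0 & f x = 1].
Proof.
move=> cF /(hahn_banach_real cF)[u [b [b0 lu bu uF ux]]].
have sF := cF.1; pose I : C := Complex 0 1.
have uD y z : u (y + z) = u y + u z by rewrite -[y]scale1r lu mul1r scale1r.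
have u0 : u 0 = 0 by exact: uF (sub_0 sF).
have uZ (r : R) y : u (r%:k *: y) = r * u y by rewrite -[_ *: y]addr0 lu u0 addr0.
pose f y : C := Complex (u y) (- u (I *: y)).
have aE (a : C) : a = (complex.Re a)%:k + (complex.Im a)%:k * I.
  by case: a => p q; apply/eqP; rewrite eq_complex /=; apply/andP; split; apply/eqP; ring.
have lf a y z : f (a *: y + z) = a * f y + f z.
  have h1 : u (a *: y) = complex.Re a * u y + complex.Im a * u (I *: y).
    by rewrite {1}[a]aE scalerDl uD uZ -scalerA uZ.
  have h2 : u (I *: (a *: y)) = complex.Re a * u (I *: y) - complex.Im a * u y.
    have -> : I *: (a *: y) = (complex.Re a)%:k *: (I *: y) + (- complex.Im a)%:k *: y.
      rewrite !scalerA -scalerDl {1}[a]aE; congr (_ *: _).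
      by apply/eqP; rewrite eq_complex /=; apply/andP; split; apply/eqP; ring.
    by rewrite uD !uZ mulNr.
  rewrite /f scalerDr !uD h1 h2; case: a h1 h2 => p q /= _ _.
  by apply/eqP; rewrite eq_complex /=; apply/andP; split; apply/eqP; ring.
have fx : f x != 0 by rewrite eq_complex /= ux oner_eq0.
have ub y : `|u y| <= b * nm y.
  rewrite ler_norml bu andbT lerNl -[- u y]mulN1r -uZ; apply: (le_trans (bu _)).
  by rewrite realN1 scaleN1r nmN.
have nI : nm I = 1 by rewrite /nm normc_def /= expr0n expr1n add0r sqrtr1.
exists (fun y => f y / f x); split.
- by move=> a y z; rewrite lf mulrDl mulrA.
- have nf := nm_gt0 fx; exists (2 * b / nm (f x)) => [|y].
    by rewrite divr_gt0// mulr_gt0.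
  rewrite nmM nmV [leRHS]mulrAC ler_pM2r ?invr_gt0//.
  apply: (le_trans (nm_le_ReIm _)) => /=; rewrite normrN.
  have := ub y; have := ub (I *: y); rewrite nmZ nI; lra.
- move=> y Fy; have -> : f y = 0; last by rewrite mul0r.
  by apply/eqP; rewrite eq_complex /= uF// uF ?oppr0 ?eqxx//; exact: sub_Z.
- by rewrite divff.
Qed.

End HahnBanach.

(** * Kato decomposition of semi-Fredholm operators *)

Section KatoDecomposition.
Variables (R : realType) (X : completeNormedModType R[i]).
Local Notation C := R[i].
Implicit Types (M N F A : set X) (x y z : X) (S : X -> X).

Definition dsum M M1 M2 := [/\ forall x, M x -> sumset M1 M2 x,
  forall x, M1 x -> M x, forall x, M2 x -> M x &
  forall x, M1 x -> M2 x -> x = 0].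

Definition nilfin S M := finite_dim M /\ exists p, forall x, M x -> iter p S x = 0.

Definition cinv S M := csub M /\ invariant S M.

(* [S] on [M] is [S] on [M'] plus a nilpotent part with [k] Jordan blocks *)
Definition shifted S M M' k := [/\
  forall n, has_indep [set 0] (ker_on S M) (n + k) <->
            has_indep [set 0] (ker_on S M') n,
  forall n, has_indep (ran_on S M) M (n + k) <-> has_indep (ran_on S M') M' n &
  eclosed (ran_on S M')].

Lemma finite_dim_span n (v : 'I_n -> X) : finite_dim (fspan v).
Proof. by exists n, v. Qed.

Lemma is_subspace_span n (v : 'I_n -> X) : is_subspace (fspan v).
Proof.
split; first by exists (fun=> 0); rewrite big1 // => i _; rewrite scale0r.
move=> a _ _ [c ->] [d ->]; exists (fun i => a * c i + d i).
rewrite scaler_sumr -big_split /=; apply: eq_bigr => i _.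
by rewrite scalerDl scalerA.
Qed.

(* A chain [u, S u, ..., S^k u = x] and a functional [f] with [f x = 1] vanishing
   on [S^(k+1) M] split off the Jordan block [Y] spanned by the chain; the
   complement is cut out by the functionals [f \o S^j], [j <= k]. *)
Lemma peel S M k x : bounded_op S -> cinv S M -> eclosed (ran_on S M) ->
  (forall m, (m <= k)%N -> ker_on S M `<=` ran_on (iter m S) M) ->
  ker_on S M x -> ~ ran_on (iter k.+1 S) M x ->
  exists M1 Y, [/\ cinv S M1, cinv S Y, dsum M M1 Y, nilfin S Y & shifted S M M1 1].
Proof.
move=> bS [cM iM] cR kR [Mx Sx] nx; have sM := cM.1.
have [u Mu uE] := kR k (leqnn k) x (conj Mx Sx).
have bSn := blin_iter bS.
(* The kernel inclusions up to [k] are just enough to close the range of the power [k.+1], which the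
   Hahn-Banach theorem needs. *)
have cRk : csub (ran_on (iter k.+1 S) M) by apply: csub_iter_ran.
have [f [lf [b b0 fb] fR fx]] := hahn_banach cRk nx.
have f0 : f 0 = 0 by apply: fR; exact: (sub_0 cRk.1).
have fD y z : f (y + z) = f y + f z by rewrite -{1}[y]scale1r lf mul1r.
have fZ a y : f (a *: y) = a * f y by rewrite -{1}[_ *: y]addr0 lf f0 addr0.
have fB y z : f (y - z) = f y - f z by rewrite fD -scaleN1r fZ mulN1r.
have fsum n (g : 'I_n -> X) : f (\sum_i g i) = \sum_i f (g i).
  exact: (big_morph f fD f0).
have iSD m y z : iter m S (y + z) = iter m S y + iter m S z by rewrite (blinD (bSn m)).
have iu m : (k < m)%N -> iter m S u = 0.
  move=> km; rewrite -(subnK km) iterD iterS uE Sx.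
  by rewrite (blin0 (bSn _)).
have Siu m : M (iter m S u) by exact: inv_iter.
pose M1 : set X := [set y | M y /\ forall j, (j <= k)%N -> f (iter j S y) = 0].
pose v (i : 'I_k.+1) := iter i S u; pose Y := fspan v.
have sY : is_subspace Y by exact: is_subspace_span.
have YM y : Y y -> M y by move=> [c ->]; apply: (sub_comb sM) => i; exact: Siu.
have Yi m : Y (iter m S u).
  have [mk|/iu ->] := leqP m k; last exact: (sub_0 sY).
  exists (fun i => (i == inord m)%:R); rewrite (bigD1 (inord m))//= eqxx scale1r.
  rewrite big1 ?addr0 => [|i /negPf ->]; last by rewrite scale0r.
  by rewrite /v inordK.
have sM1 : is_subspace M1.
  split; first by split=> [|j _]; [exact: (sub_0 sM)|rewrite (blin0 (bSn j))].
  move=> a y z [My fy] [Mz fz]; split=> [|j jk]; first exact: sM.2.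
  by rewrite (bSn j).1 lf fy// fz// mulr0 addr0.
have cM1 : csub M1.
  split=> // y H; split; first by apply: cM.2 => e /H[z [[Mz _] yz]]; exists z.
  move=> j jk; apply: nm_eq0; apply/ler_addgt0Pr => e e0; rewrite add0r.
  have [bj bj0 hbj] := (bSn j).2.
  have [z [[_ fz] yz]] := H _ (divr_gt0 e0 (mulr_gt0 b0 bj0)).
  rewrite -[f _]subr0 -(fz j jk) -fB -(blinB (bSn j)).
  apply: (le_trans (fb _)); have := hbj (y - z).
  move=> h; apply: (le_trans (ler_wpM2l (ltW b0) h)); rewrite mulrA mulrC.
  by rewrite -ler_pdivlMr ?mulr_gt0// ltW.
have iM1 : invariant S M1.
  apply/invP => y [My fy]; split; first by apply: iM; exists y.
  move=> j jk; rewrite -iterSr.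
  move: jk; rewrite leq_eqVlt => /orP[/eqP ->|]; last exact: fy.
  by apply: fR; exists y.
have iY : invariant S Y.
  apply/invP => y [c ->]; rewrite (blin_comb bS); apply: (sub_comb sY) => i.
  by rewrite /v -iterS.
have fiu i j : (i + j = k)%N -> f (iter j S (iter i S u)) = 1.
  by rewrite -iterD addnC => ->; rewrite uE.
have fiu0 i j : (k < i + j)%N -> f (iter j S (iter i S u)) = 0.
  by rewrite -iterD addnC => /iu ->.
have dis y : M1 y -> Y y -> y = 0.
  move=> [_ fy] [c yE].
  (* A triangular system: [f] after the power [k - i] of [S] reads off [c i] once the lower
     coefficients vanish, since the higher terms are pushed past [x] to 0. *)
  suff c0 m : forall i : 'I_k.+1, (i < m)%N -> c i = 0.
    by rewrite yE big1// => i _; rewrite (c0 k.+1)// scale0r.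
  elim: m => [//|m IH] i; rewrite ltnS leq_eqVlt => /orP[/eqP im|]; last exact: IH.
  have ik : (i <= k)%N by rewrite -ltnS.
  have := fy (k - i)%N (leq_subr _ _).
  rewrite yE (blin_comb (bSn _)) fsum (bigD1 i)//= fZ fiu ?subnKC// mulr1.
  rewrite big1 ?addr0// => j ji; rewrite fZ.
  have [jm|jm] := ltnP j m; first by rewrite IH// mul0r.
  rewrite fiu0 ?mulr0//.
  have : (m < j)%N by rewrite ltn_neqAle jm andbT -im eq_sym; move: ji; rewrite -val_eqE.
  by move: ik; rewrite im; lia.
(* The same triangular system is solved from [j = k] downwards; stage [l] corrects by a multiple of
   [iter l S u] without disturbing the equations already met. *)
have decl : forall l, (l <= k.+1)%N -> forall y, exists2 z, Y z &
    forall j, (j <= k)%N -> (k < j + l)%N -> f (iter j S (y - z)) = 0.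
  elim=> [_ y|l IH lk y].
    by exists 0; [exact: (sub_0 sY)|move=> j jk; rewrite addn0 ltnNge jk].
  have [z Yz Hz] := IH (ltnW lk) y.
  pose c := f (iter (k - l) S (y - z)).
  exists (z + c *: iter l S u); first by apply: (sub_D sY) => //; exact: (sub_Z sY).
  move=> j jk; rewrite opprD addrA (blinB (bSn j)) fB (blinZ (bSn j)) fZ.
  rewrite addnS ltnS leq_eqVlt => /orP[/eqP kE|h].
    have -> : j = (k - l)%N by lia.
    by rewrite fiu ?mulr1 ?subrr//; lia.
  by rewrite Hz// fiu0 ?mulr0 ?subr0// addnC.
have dec y : M y -> exists m z, [/\ M1 m, Y z & y = m + z].
  move=> My; have [z Yz Hz] := decl k.+1 (leqnn _) y.
  exists (y - z), z; rewrite subrK; split=> //; split.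
    by apply: (sub_B sM) => //; exact: YM.
  by move=> j jk; apply: Hz => //; lia.
have [n dY] := finite_dim_span v.
have cY : csub Y by apply: csub_findim dY.
have xY : Y x by rewrite -uE.
have sR := is_subspace_ran bS sM; have sR1 := is_subspace_ran bS sM1.
(* Both summands are invariant and [u] lies in [Y], so the [Y] component of a vector of [M1] must
   vanish. This gives the defect count and the closedness of the range on [M1]. *)
have M1R1 a : M1 a -> sumset (ran_on S M) (line u) a -> ran_on S M1 a.
  move=> M1a [_ [_ [[w Mw <-] [c ->] aE]]].
  have [m [z [M1m Yz wE]]] := dec _ Mw.
  exists m => //; apply/eqP; rewrite eq_sym -subr_eq0; apply/eqP; apply: dis.
    by apply: (sub_B sM1) => //; apply: iM1; exists m.
  have -> : a - S m = S z + c *: u.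
    by rewrite aE wE (blinD bS) [LHS](AC (3*1) ((1*4)*(2*3))) /= subrr add0r.
  apply: (sub_D sY); first by apply: iY; exists z.
  by apply: (sub_Z sY); exact: (Yi 0%N).
exists M1, Y; split=> //.
- by split=> // y [].
- split; first by exists n.
  exists k.+1 => y [c ->]; rewrite (blin_comb (bSn _)) big1// => i _.
  by rewrite /v -iterD iu ?scaler0// ltnS leq_addr.
split.
- move=> m; rewrite addn1.
  have sk := (csub_ker bS cM).1; have sk1 := (csub_ker bS cM1).1.
  rewrite (has_indep_line _ (is_subspace0 X) sk (conj Mx Sx)); last first.
    by move=> /= x0; apply: nx; rewrite x0; exact: (sub_0 cRk.1).
  symmetry; apply: has_indep_iso => //.
  + exact: is_subspace0.
  + by apply: is_subspaceD; [exact: is_subspace0|exact: is_subspace_line].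
  + by move=> y [[]].
  + move=> y [My Sy]; exists (y - f y *: x), (f y *: x); rewrite subrK; split=> //.
      split; last by rewrite (blinB bS) (blinZ bS) Sx Sy scaler0 subrr.
      split; first by apply: (sub_B sM) => //; exact: (sub_Z sM).
      move=> [|j] _; first by rewrite /= fB fZ fx mulr1 subrr.
      by rewrite iterSr (blinB bS) (blinZ bS) Sx Sy scaler0 subrr (blin0 (bSn j)).
    by exists 0, (f y *: x); rewrite add0r; split=> //; exists (f y).
  + move=> y; split.
      move=> ->; split; first exact: (sub_0 sk1).
      by exists 0, 0; rewrite addr0; split=> //; exists 0; rewrite scale0r.
    move=> [[M1y _] [_ [_ [-> [c ->] yE]]]]; apply: dis => //.
    by rewrite yE add0r; exact: (sub_Z sY).
- move=> m; rewrite addn1.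
  have nu : ~ ran_on S M u.
    by move=> [w Mw wE]; apply: nx; exists w => //; rewrite iterSr wE.
  rewrite (has_indep_line _ sR sM Mu nu).
  symmetry; apply: has_indep_iso => //.
  + by apply: is_subspaceD => //; exact: is_subspace_line.
  + by move=> y [].
  + move=> y /dec[m' [z [M1m [c ->] ->]]]; exists m', (\sum_i c i *: v i); split=> //.
    have sG : is_subspace (sumset (ran_on S M) (line u)).
      by apply: is_subspaceD => //; exact: is_subspace_line.
    apply: (sub_comb sG) => i; rewrite /v; case: (i : nat) => [|j].
      exists 0, u; rewrite add0r; split=> //; first exact: (sub_0 sR).
      by exists 1; rewrite scale1r.
    exists (iter j.+1 S u), 0; rewrite addr0; split=> //.
      by exists (iter j S u).
    by exists 0; rewrite scale0r.
  + move=> y; split; last by move=> [? ?]; exact: M1R1.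
    move=> [m' M1m <-]; split; first by apply: iM1; exists m'.
    exists (S m'), 0; rewrite addr0; split=> //; first by exists m' => //; exact: M1m.1.
    by exists 0; rewrite scale0r.
- have -> : ran_on S M1 = ran_on S M `&` M1.
    apply/seteqP; split=> y.
      by move=> [m' M1m <-]; split; [exists m' => //; exact: M1m.1|apply: iM1; exists m'].
    move=> [Ry M1y]; apply: M1R1 => //; exists y, 0; rewrite addr0; split=> //.
    by exists 0; rewrite scale0r.
  by have [_] := csubI (conj sR cR) cM1.
Qed.

(** One [n] bounds whichever of the two dimensions is finite; it is the measure of the induction in
    [Kato_decomposition]. *)
Definition semiFredholm S M := eclosed (ran_on S M) /\
  exists n, ~ has_indep [set 0] (ker_on S M) n.+1 \/ ~ has_indep (ran_on S M) M n.+1.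

Lemma dsum_id M : is_subspace M -> dsum M M [set 0].
Proof.
move=> sM; split=> //; last by move=> x ->; exact: sub_0.
by move=> x Mx; exists x, 0; rewrite addr0.
Qed.

Lemma dsum_trans M M1 Y M2 Y2 : is_subspace M -> is_subspace M1 ->
  dsum M M1 Y -> dsum M1 M2 Y2 -> dsum M M2 (sumset Y2 Y).
Proof.
move=> sM sM1 [h1 h2 h3 h4] [g1 g2 g3 g4]; split.
- move=> x /h1[m [y [/g1[a [c [M2a Yc ->]]] Yy ->]]].
  by exists a, (c + y); rewrite addrA; split=> //; exists c, y.
- by move=> x /g2/h2.
- by move=> _ [c [y [/g3/h2 Mc /h3 My ->]]]; exact: (sub_D sM).
- move=> x M2x [c [y [Yc Yy E]]].
  have y0 : y = 0.
    apply: h4 => //; have -> : y = x - c by rewrite E addrAC subrr add0r.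
    by apply: (sub_B sM1); [exact: g2|exact: g3].
  by apply: g4 => //; rewrite E y0 addr0.
Qed.

Lemma finite_dim_sum M N : finite_dim M -> finite_dim N -> finite_dim (sumset M N).
Proof.
move=> [m [v Mv]] [n [w Nw]]; exists (m + n)%N.
exists (fun i : 'I_(m + n) => match fintype.split i with inl j => v j | inr j => w j end).
move=> _ [x [y [/Mv[c ->] /Nw[d ->] ->]]].
exists (fun i : 'I_(m + n) => match fintype.split i with inl j => c j | inr j => d j end).
rewrite big_split_ord /=; congr (_ + _); apply: eq_bigr => i _.
  by rewrite (unsplitK (inl i)).
by rewrite (unsplitK (inr i)).
Qed.

Lemma nilfin_sum S M N : bounded_op S -> nilfin S M -> nilfin S N -> nilfin S (sumset M N).
Proof.
move=> bS [fM [p hp]] [fN [q hq]]; split; first exact: finite_dim_sum.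
exists (p + q)%N => _ [x [y [Mx Ny ->]]].
have bi n := blin_iter bS n.
have h1 : iter (p + q) S x = 0 by rewrite addnC iterD hp// (blin0 (bi q)).
have h2 : iter (p + q) S y = 0 by rewrite iterD hq// (blin0 (bi p)).
by rewrite (blinD (bi _)) h1 h2 addr0.
Qed.

Lemma cinv_add_findim S M N : bounded_op S -> cinv S M -> cinv S N -> finite_dim N ->
  cinv S (sumset M N).
Proof.
move=> bS [cM /invP iM] [cN /invP iN] [n dN]; split.
  by apply: csub_add_findim dN => //; exact: cN.1.
apply/invP => _ [x [y [Mx Ny ->]]]; exists (S x), (S y); rewrite (blinD bS).
by split=> //; [exact: iM|exact: iN].
Qed.

Lemma not_Kato_first S M : is_subspace M -> eclosed (ran_on S M) -> ~ Kato_on S M ->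
  exists k x, [/\ forall m, (m <= k)%N -> ker_on S M `<=` ran_on (iter m S) M,
    ker_on S M x & ~ ran_on (iter k.+1 S) M x].
Proof.
move=> sM cR nk.
have : exists m, `[< ~ ker_on S M `<=` ran_on (iter m S) M >].
  apply: contrapT => H; apply: nk; split; first exact/closedE.
  by move=> m; apply: contrapT => H2; apply: H; exists m; apply/asboolP.
case/ex_minnP => -[|k] /asboolP H Hmin.
  by exfalso; apply: H => x [Mx _]; exists x.
have /existsNP[x /not_implyP[kx nx]] := H; exists k, x; split=> // m mk.
apply: contrapT => H2.
have /Hmin : `[< ~ ker_on S M `<=` ran_on (iter m S) M >] by apply/asboolP.
by rewrite ltnNge mk.
Qed.

(** Each use of [peel] lowers kernel dimension and defect by one, so the finite one of the two
    limits how often the restriction can fail to be Kato. *)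
Lemma Kato_decomposition S M : bounded_op S -> cinv S M -> semiFredholm S M ->
  exists M1 M2 k, [/\ cinv S M1, cinv S M2, dsum M M1 M2, nilfin S M2 &
    Kato_on S M1 /\ shifted S M M1 k].
Proof.
move=> bS cM [cR [n]]; elim: n M cM cR => [|n IH] M cM cR hn.
all: have [kM|/(not_Kato_first cM.1.1 cR)[k [x [kR kx nx]]]] := pselect (Kato_on S M).
1,3: exists M, [set 0], 0%N; split=> //.
1,5: by split; [exact: csub0|apply/invP => x ->; exact: (blin0 bS)].
1,4: exact: dsum_id cM.1.1.
1,3: split; [by exists 0%N, (fun=> 0) => x ->; exists (fun=> 0); rewrite big_ord0|by exists 0%N].
1,2: by split=> //; split=> // m; rewrite addn0.
all: have [M1 [Y [cM1 cY dM fY [s1 s2 s3]]]] := peel bS cM cR kR kx nx.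
  case: hn => h; exfalso; apply: h.
    by apply/(s1 0%N); exact: has_indep0.
  by apply/(s2 0%N); exact: has_indep0.
have [|M2 [Y2 [l [cM2 cY2 dM1 fY2 [kM2 [t1 t2 t3]]]]]] := IH M1 cM1 s3.
  case: hn => h; [left|right] => h2; apply: h; rewrite -[n.+2]addn1.
    exact/s1.
  exact/s2.
exists M2, (sumset Y2 Y), l.+1; split=> //.
- by apply: cinv_add_findim => //; exact: fY.1.
- exact: dsum_trans cM.1.1 cM1.1.1 dM dM1.
- exact: nilfin_sum.
- split=> //; split=> // m; rewrite addnS -addn1; first by rewrite s1.
  by rewrite s2.
Qed.

End KatoDecomposition.

(** * Direct sums with a bijective summand *)

Section Profiles.
Variables (R : realType) (X : completeNormedModType R[i]).
Local Notation C := R[i].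
Implicit Types (M N F A : set X) (x y z : X) (S : X -> X).

(** Read as dimension at least [n], which covers infinite dimensions; equal dimensions are
    equivalent predicates. *)
Definition kerdim S M n := has_indep [set 0] (ker_on S M) n.
Definition randef S M n := has_indep (ran_on S M) M n.

Definition sameprof S M S' M' := [/\ forall n, kerdim S M n <-> kerdim S' M' n,
  forall n, randef S M n <-> randef S' M' n &
  eclosed (ran_on S M) <-> eclosed (ran_on S' M')].

Lemma has_indep1 F A : is_subspace F -> (~ has_indep F A 1) <-> A `<=` F.
Proof.
move=> sF; split=> [H x Ax|AF [g [Ag ig]]].
  apply: contrapT => nF; apply: H; exists (fun=> x); split=> // a.
  rewrite big_ord1 => Fa i; rewrite ord1; apply: contrapT => /eqP a0.
  by apply: nF; rewrite -[x]scale1r -(mulVf a0) -scalerA; exact: sub_Z.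
have : (1 : C) = 0.
  apply: (ig (fun=> 1) _ ord0); rewrite big_ord1 scale1r; exact: AF.
by move/eqP; rewrite oner_eq0.
Qed.

Definition bijective_on S M := (forall x, M x -> S x = 0 -> x = 0) /\
  (forall y, M y -> exists2 x, M x & S x = y).

Lemma bijective_profP S M : bounded_op S -> cinv S M ->
  bijective_on S M <-> ~ kerdim S M 1 /\ ~ randef S M 1.
Proof.
move=> bS [cM iM].
rewrite /kerdim /randef has_indep1; last exact: is_subspace0.
rewrite has_indep1; last by apply: (is_subspace_ran bS); exact: cM.1.
split=> -[H1 H2]; split.
- by move=> x [Mx Sx]; exact: H1.
- by move=> y /H2[x Mx <-]; exists x.
- by move=> x Mx Sx; exact: H1.
- by move=> y /H2[x Mx <-]; exists x.
Qed.

(** The open mapping theorem for addition from [M] times [N] to [F] bounds the projections, so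
    approximation by [A] plus [B] passes to the components. *)
Lemma csub_dsum F M N A B : csub F -> csub M -> csub N -> dsum F M N ->
  csub A -> csub B -> (forall x, A x -> M x) -> (forall x, B x -> N x) ->
  csub (sumset A B).
Proof.
move=> cF cM cN [dF FM FN dis] cA cB AM BN.
have sM := cM.1; have sN := cN.1; have sF := cF.1.
pose B' (r : R) : set X := [set y | exists m n,
    [/\ M m, N n, nm m <= r, nm n <= r & y = m + n]].
have [||||||c c0 H] := @open_mapping R X F B' cF.
- move=> y /dF[m [n [Mm Nn ->]]]; exists (nm m + nm n), m, n.
  by split=> //; rewrite ?lerDl ?lerDr nm_ge0.
- by move=> r y [m [n [/FM Fm /FN Fn _ _ ->]]]; exact: sub_D.
- by move=> r s y rs [m [n [Mm Nn h1 h2 ->]]]; exists m, n; split=> //; exact: le_trans rs.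
- move=> r s _ _ [m [n [Mm Nn h1 h2 ->]]] [m' [n' [Mm' Nn' h1' h2' ->]]].
  exists (m + m'), (n + n'); rewrite addrACA; split=> //.
  + exact: sub_D.
  + exact: sub_D.
  + by rewrite (le_trans (nmD _ _))// lerD.
  + by rewrite (le_trans (nmD _ _))// lerD.
- move=> r a _ [m [n [Mm Nn h1 h2 ->]]]; exists (a *: m), (a *: n).
  rewrite scalerDr !nmZ !ler_wpM2l ?nm_ge0//; split=> //; exact: sub_Z.
- move=> r y s /choice[m /choice[n mnP]] [b hb].
  have [|l lP] := @geo_lim R X (fun k => \sum_(j < k) m j) r.
    by move=> k; rewrite big_ord_recr /= addrAC subrr add0r; have [] := mnP k.
  have [|l' lP'] := @geo_lim R X (fun k => \sum_(j < k) n j) r.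
    by move=> k; rewrite big_ord_recr /= addrAC subrr add0r; have [] := mnP k.
  exists l, l'; split.
  + by apply: (eclosed_geo cM.2 _ lP) => k; apply: sub_sum => // j; have [] := mnP j.
  + by apply: (eclosed_geo cN.2 _ lP') => k; apply: sub_sum => // j; have [] := mnP j.
  + by have := lP 0%N; rewrite big_ord0 sub0r nmN /halfpow expr0 mulr1.
  + by have := lP' 0%N; rewrite big_ord0 sub0r nmN /halfpow expr0 mulr1.
  + apply: (@nm_halfpow_eq R X _ _ b (2 * r + 2 * r) _ hb) => k.
    have -> : \sum_(j < k) y j - (l + l') =
       (\sum_(j < k) m j - l) + (\sum_(j < k) n j - l').
      rewrite addrACA -opprD -big_split /=; congr (_ - _).
      by apply: eq_bigr => j _; have [] := mnP j.
    rewrite mulrDl; apply: (le_trans (nmD _ _)).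
    by apply: lerD; [exact: lP|exact: lP'].
have sAB := is_subspaceD cA.1 cB.1.
split=> // x clx.
have Fx : F x.
  apply: cF.2 => e /clx[_ [[a [b [/AM/FM Fa /BN/FN Fb ->]]] h]].
  by exists (a + b); split=> //; exact: sub_D.
have [m [n [Mm Nn xE]]] := dF x Fx.
have app e : 0 < e -> exists a b, [/\ A a, B b, nm (m - a) < e & nm (n - b) < e].
  move=> e0; have [_ [[a [b [Aa Bb ->]]] h]] := clx _ (divr_gt0 e0 c0).
  have Ma := AM _ Aa; have Nb := BN _ Bb.
  have [|m' [n' [Mm' Nn' h1 h2 E]]] := H (x - (a + b)).
    by apply: sub_B => //; apply: sub_D => //; [exact: FM|exact: FN].
  have Em : m - a - m' = n' - (n - b).
    have E' : m - a = m' + n' - (n - b) by rewrite -E xE (opprD a) addrACA addrK.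
    by rewrite E' addrAC (addrAC m' n') subrr add0r.
  have Z0 : m - a - m' = 0.
    apply: dis; first by do 2?apply: sub_B => //.
    by rewrite Em; do 2?apply: sub_B => //.
  have ma : m - a = m' by apply/eqP; rewrite -subr_eq0 Z0.
  have nb : n - b = n' by apply/eqP; rewrite eq_sym -subr_eq0 -Em Z0.
  have hc : c * nm (x - (a + b)) < e by rewrite mulrC -ltr_pdivlMr.
  by exists a, b; rewrite ma nb; split=> //; exact: le_lt_trans hc.
exists m, n; split=> //.
  by apply: cA.2 => e /app[a [b [Aa _ h _]]]; exists a.
by apply: cB.2 => e /app[a [b [_ Bb _ h]]]; exists b.
Qed.

Lemma dsum_ker S M N F x : bounded_op S -> cinv S M -> cinv S N -> dsum F M N ->
  ker_on S F x -> exists m n, [/\ ker_on S M m, ker_on S N n & x = m + n].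
Proof.
move=> bS [cM /invP iM] [cN /invP iN] [dF FM FN dis] [/dF[m [n [Mm Nn ->]]]].
rewrite (blinD bS) => E; have Sm : S m = 0.
  apply: dis; first exact: iM.
  move/eqP: E; rewrite addr_eq0 => /eqP ->.
  by apply: (sub_N cN.1); exact: iN.
by exists m, n; split=> //; split=> //; move: E; rewrite Sm add0r.
Qed.

(** The kernel on [F] lies in [M], and the range on [F] is the range on [M] plus all of [N], so the
    quotients by the ranges are isomorphic. *)
Lemma sameprof_dsum S F M N : bounded_op S -> csub F -> cinv S M -> cinv S N -> dsum F M N ->
  bijective_on S N -> sameprof S F S M.
Proof.
move=> bS cF cM cN dF [injN surN].
have [FMN FM FN dis] := dF; have sM := cM.1.1; have sN := cN.1.1; have sF := cF.1.
have kE : ker_on S F = ker_on S M.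
  apply/seteqP; split=> x; last by move=> [/FM].
  move=> /(dsum_ker bS cM cN dF)[m [n [km [Nn Sn] ->]]].
  by rewrite (injN _ Nn Sn) addr0.
have sRF := is_subspace_ran bS sF; have sRM := is_subspace_ran bS sM.
have /invP iM := cM.2; have /invP iN := cN.2.
have RME x : ran_on S M x <-> M x /\ ran_on S F x.
  split=> [[m Mm <-]|[Mx [_ /FMN[m [n [Mm Nn ->]]] xE]]].
    by split; [exact: iM|exists m => //; exact: FM].
  exists m => //; apply/eqP; rewrite eq_sym -subr_eq0; apply/eqP; apply: dis.
    by apply: (sub_B sM) => //; exact: iM.
  by rewrite -xE (blinD bS) addrAC subrr add0r; exact: iN.
have RFE : ran_on S F = sumset (ran_on S M) N.
  apply/seteqP; split=> x.
    move=> [_ /FMN[m [n [Mm Nn ->]]] <-]; exists (S m), (S n); rewrite (blinD bS).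
    by split=> //; [exists m|exact: iN].
  move=> [_ [_ [[m Mm <-] /surN[n Nn <-] ->]]]; rewrite -(blinD bS).
  by exists (m + n) => //; apply: (sub_D sF); [exact: FM|exact: FN].
split.
- by move=> n; rewrite /kerdim kE.
- move=> k; symmetry; apply: has_indep_iso => // x.
  move=> /FMN[m [n [Mm Nn ->]]]; exists m, n; split=> //.
  rewrite RFE; exists 0, n; rewrite add0r; split=> //; exact: (sub_0 sRM).
- split=> h.
    have -> : ran_on S M = M `&` ran_on S F by apply/seteqP; split=> x /RME.
    by have [] := csubI cM.1 (conj sRF h).
  rewrite RFE; have [] // := csub_dsum cF cM.1 cN.1 dF (conj sRM h) cN.1 _ _.
  by move=> x /RME[].
Qed.

Lemma bijective_dsum S F M N : bounded_op S -> csub F -> cinv S M -> cinv S N -> dsum F M N ->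
  bijective_on S N -> bijective_on S F <-> bijective_on S M.
Proof.
move=> bS cF cM cN dF bN; have [h1 h2 _] := sameprof_dsum bS cF cM cN dF bN.
have cF' : cinv S F.
  split=> //; apply/invP => x; have [FMN FM FN _] := dF.
  move=> /FMN[m [n [Mm Nn ->]]]; rewrite (blinD bS).
  by apply: (sub_D cF.1); [apply: FM; apply: cM.2; exists m|apply: FN; apply: cN.2; exists n].
rewrite !bijective_profP//; split=> -[a b]; split.
- by move=> /h1.
- by move=> /h2.
- by move=> /h1.
- by move=> /h2.
Qed.

Lemma cinv_opsub S l M : cinv S M -> cinv (opsub S l) M.
Proof. by move=> [cM iM]; split=> //; apply: inv_opsub => //; exact: cM.1. Qed.

Lemma cinv_opsubE S l M : cinv (opsub S l) M -> cinv S M.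
Proof. by move=> /(cinv_opsub (- l)); rewrite opsubD subrr opsub0. Qed.

Lemma nilpotent_bijective S M l p : bounded_op S -> cinv S M ->
  (forall x, M x -> iter p S x = 0) -> l != 0 -> bijective_on (opsub S l) M.
Proof.
move=> bS [cM /invP iM] nil l0; have sM := cM.1; split.
- move=> x Mx /eqP; rewrite subr_eq0 => /eqP Sx.
  have it : forall k, iter k S x = l ^+ k *: x.
    elim=> [|k IH]; first by rewrite expr0 scale1r.
    by rewrite iterS IH (blinZ bS) Sx scalerA exprSr.
  have := nil x Mx; rewrite it => /eqP; rewrite scaler_eq0 expf_eq0 (negPf l0) andbF /=.
  by move/eqP.
- suff H : forall q y, M y -> iter q S y = 0 -> exists2 x, M x & opsub S l x = y.
    by move=> y My; apply: (H p) => //; exact: nil.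
  elim=> [|q IH] y My; first by move=> /= ->; exists 0; [exact: sub_0|exact: (blin0 (blin_opsub bS l))].
  rewrite iterSr => /(IH _ (iM _ My))[x Mx xE].
  (* Since [x] solves the equation with right-hand side [S y], applying [S - l] to [x - y] leaves
     [l *: y]. *)
  exists (l^-1 *: (x - y)); first by apply: sub_Z => //; exact: sub_B.
  have bl := blin_opsub bS l.
  rewrite (blinZ bl) (blinB bl) xE /opsub opprB addrCA subrr addr0.
  by rewrite scalerA mulVf// scale1r.
Qed.

End Profiles.

(** * Riesz operators *)

Section RieszOperators.
Variables (R : realType) (X : completeNormedModType R[i]).
Local Notation C := R[i].
Implicit Types (M N F A : set X) (x y z : X) (S U : X -> X).

Lemma Phi_onP S M : bounded_op S -> cinv S M -> Phi_on S M <->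
  [/\ exists n, ~ kerdim S M n.+1, eclosed (ran_on S M) & exists n, ~ randef S M n.+1].
Proof.
move=> bS [cM iM]; have sk := (csub_ker bS cM).1; have sR := is_subspace_ran bS cM.1.
split=> [[[[n /(dim_leP _ sk) kn] /closedE cR] [m /(codim_leP _ sR cM.1) rm]]|].
  by split=> //; [exists n|exists m].
move=> [[n kn] cR [m rm]]; split; first split.
- by exists n; apply/(dim_leP _ sk).
- exact/closedE.
- by exists m; apply/(codim_leP _ sR cM.1).
Qed.

Lemma Phi_semiFredholm S M : bounded_op S -> cinv S M -> Phi_on S M -> semiFredholm S M.
Proof.
by move=> bS cM /(Phi_onP bS cM)[[n kn] cR _]; split=> //; exists n; left.
Qed.

Lemma finite_dim_sub A M : A `<=` M -> finite_dim M -> finite_dim A.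
Proof. by move=> AM [n [v H]]; exists n, v; exact: subset_trans H. Qed.

Lemma finite_dim_ran S M : bounded_op S -> finite_dim M -> finite_dim (ran_on S M).
Proof.
move=> bS [n [v H]]; exists n, (S \o v) => _ [x /H[c ->] <-].
by exists c; rewrite (blin_comb bS).
Qed.

Lemma Phi_add_findim U M N : bounded_op U -> cinv U M -> cinv U N -> finite_dim M ->
  (forall x, M x -> N x -> x = 0) -> Phi_on U N -> Phi_on U (sumset M N).
Proof.
move=> bU cM cN fM dis PN; have sM := cM.1.1; have sN := cN.1.1.
have dS : dsum (sumset M N) M N.
  split=> // x h; first by exists x, 0; rewrite addr0; split=> //; exact: sub_0.
  by exists 0, x; rewrite add0r; split=> //; exact: sub_0.
have [[fk /closedE cR] _] := PN.
have RE : ran_on U (sumset M N) = sumset (ran_on U N) (ran_on U M).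
  apply/seteqP; split=> x.
    move=> [_ [m [n [Mm Nn ->]]] <-]; exists (U n), (U m).
    by rewrite (blinD bU) addrC; split=> //; [exists n|exists m].
  move=> [_ [_ [[n Nn <-] [m Mm <-] ->]]]; exists (m + n); first by exists m, n.
  by rewrite (blinD bU) addrC.
have sRN := is_subspace_ran bU sN; have sRM := is_subspace_ran bU sM.
have sMN := is_subspaceD sM sN.
split; first split.
- apply: (@finite_dim_sub _ (sumset (ker_on U M) (ker_on U N))).
    by move=> x /(dsum_ker bU cM cN dS).
  by apply: finite_dim_sum => //; apply: finite_dim_sub fM => x [].
- apply/closedE; rewrite RE; have [n dn] := finite_dim_ran bU fM.
  by have [] := csub_add_findim (conj sRN cR) sRM dn.
- have [_ [b [v [Nv vP]]]] := PN; have [a [w Mw]] := fM.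
  exists (a + b)%N; apply/codim_leP => //; first by rewrite RE; exact: is_subspaceD.
  move=> [g [Ag ig]]; have sRS : is_subspace (ran_on U (sumset M N)).
    by rewrite RE; exact: is_subspaceD.
  apply: (@dependent _ _ _ _ _ (fun i : 'I_(a + b) =>
     match fintype.split i with inl j => w j | inr j => v j end) g sRS (ltnSn _) _ ig).
  move=> i; have [m [n [/Mw[c mE] /vP[r [y [[n' Nn' <-] [[d yE] nE]]]] gE]]] := Ag i.
  exists (U n'), (fun j : 'I_(a + b) =>
     match fintype.split j with inl k => c k | inr k => d k end); split.
    exists n' => //; exists 0, n'; rewrite add0r; split=> //; exact: sub_0.
  rewrite big_split_ord /= gE mE nE yE addrCA; congr (_ + (_ + _)).
    by apply: eq_bigr => k _; rewrite (unsplitK (inl k)).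
  by apply: eq_bigr => k _; rewrite (unsplitK (inr k)).
Qed.

Lemma cinv0 S : bounded_op S -> cinv S [set 0].
Proof.
by move=> bS; split; [exact: csub0|apply/invP => x ->; exact: (blin0 bS)].
Qed.

Lemma Riesz_add_findim S M N : bounded_op S -> cinv S M -> cinv S N -> finite_dim M ->
  (forall x, M x -> N x -> x = 0) -> Riesz_on S N -> Riesz_on S (sumset M N).
Proof.
move=> bS cM cN fM dis RN mu mu0; apply: Phi_add_findim => //.
- exact: blin_opsub.
- exact: cinv_opsub.
- exact: cinv_opsub.
- exact: RN.
Qed.

Lemma Riesz0 S : bounded_op S -> Riesz_on S [set 0].
Proof.
move=> bS mu _; have bm := blin_opsub bS mu; have c0 := cinv0 bm.
apply/(Phi_onP bm c0).
have RE : ran_on (opsub S mu) [set 0] = [set 0].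
  apply/seteqP; split=> x; first by move=> [y -> <-]; exact: (blin0 bm).
  by move=> ->; exists 0 => //; exact: (blin0 bm).
split.
- by exists 0%N; apply/has_indep1; [exact: is_subspace0|move=> x []].
- by rewrite RE; have [] := csub0 X.
- by exists 0%N; apply/has_indep1; rewrite RE //; exact: is_subspace0.
Qed.

Lemma Riesz_findim S M : bounded_op S -> cinv S M -> finite_dim M -> Riesz_on S M.
Proof.
move=> bS cM fM; have -> : M = sumset M [set 0].
  apply/seteqP; split=> x; first by move=> Mx; exists x, 0; rewrite addr0.
  by move=> [m [_ [Mm -> ->]]]; rewrite addr0.
apply: Riesz_add_findim => //; [exact: cinv0|exact: Riesz0].
Qed.

(** Beyond twice the norm bound of [S], the approximate solution [- w^-1 *: z] leaves an error of at
    most half of [nm z]. *)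
Lemma bijective_large S N : bounded_op S -> cinv S N -> exists2 b : R, 0 < b &
  forall w : C, b < nm w -> bijective_on (opsub S w) N.
Proof.
move=> bS [cN /invP iN]; have [b b0 hb] := bS.2; exists (2 * b); first by lra.
move=> w bw; have bl := blin_opsub bS w; have sN := cN.1.
have w0 : w != 0 by apply/eqP => w0; move: bw; rewrite w0 nm0; lra.
split=> [x Nx /eqP|y Ny].
  rewrite subr_eq0 => /eqP E; apply: nm_eq0; have := hb x; rewrite E nmZ.
  have := nm_ge0 x; nra.
have [|x [Nx <- _]] := approx_surjective bl cN (c := (nm w)^-1) _ Ny; last by exists x.
move=> z Nz; exists (- w^-1 *: z).
have NwZ : N (- w^-1 *: z) by exact: sub_Z.
have E : opsub S w (- w^-1 *: z) = - (w^-1 *: S z) + z.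
  rewrite /opsub (blinZ bS) scaleNr; congr (_ + _).
  by rewrite scalerA mulrN divff// scaleN1r opprK.
split=> //.
- by rewrite E; apply: (sub_D sN) => //; apply: (sub_N sN); apply: (sub_Z sN); exact: iN.
- by rewrite nmZ nmN nmV.
- rewrite E opprD opprK addrCA subrr addr0 nmZ nmV.
  rewrite mulrC ler_pdivrMr ?nm_gt0//; have := hb z; have := nm_ge0 z; nra.
Qed.

Section Riesz.
Variables (S : X -> X) (N : set X).
Hypotheses (bS : bounded_op S) (cN : cinv S N) (rN : Riesz_on S N).

(* Near any [z != 0] the operators [S - w], [w != z], are all bijective or all
   singular. *)
Lemma Riesz_dichotomy (z : C) : z != 0 -> exists N1 N2 (e : R),
  [/\ 0 < e, cinv S N1 /\ cinv S N2, dsum N N1 N2, finite_dim N2 &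
   forall l : C, 0 < nm l -> nm l <= e ->
    (bijective_on (opsub S (z + l)) N <-> bijective_on (opsub S z) N1)].
Proof.
move=> z0; have bz := blin_opsub bS z; have cz := cinv_opsub z cN.
have [N1 [N2 [k [c1 c2 dN [f2 [p n2]] [k1 _]]]]] :=
  Kato_decomposition bz cz (Phi_semiFredholm bz cz (rN z0)).
have [e [e0 eP]] := Kato_profile bz c1.1 c1.2 k1.
exists N1, N2, e; split=> // [|l l0 le].
  by split; [exact: cinv_opsubE c1|exact: cinv_opsubE c2].
have [_ h1 h2] := eP l le; rewrite -opsubD.
have bl := blin_opsub bz l.
have c1l := cinv_opsub l c1; have c2l := cinv_opsub l c2.
rewrite (bijective_dsum bl cN.1 c1l c2l dN); last first.
  apply: nilpotent_bijective n2 _ => //.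
  by apply/eqP => E; move: l0; rewrite E nm0 ltxx.
rewrite !bijective_profP//; split=> -[a b]; split.
- by move=> /h1.
- by move=> /h2.
- by move=> /h1.
- by move=> /h2.
Qed.

Let punct (z : C) (e : R) (P : C -> Prop) := 0 < e /\
  forall l : C, 0 < nm l -> nm l <= e -> P (z + l).

Let punct_excl (z : C) e e' : punct z e (fun w => bijective_on (opsub S w) N) ->
  punct z e' (fun w => ~ bijective_on (opsub S w) N) -> False.
Proof.
move=> [e0 H] [e0' H']; pose l : C := ((Num.min e e')%:C)%C.
have m0 : 0 < Num.min e e' by rewrite lt_min e0.
have nl : nm l = Num.min e e' by rewrite nmr gtr0_norm.
by apply: (H' l); [rewrite nl|rewrite nl ge_min lexx orbT|
  apply: H; rewrite nl// ge_min lexx].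
Qed.

(* Along the ray from [z] to infinity the two cases of [Riesz_dichotomy] are both
   open, and far out [S - w] is bijective. *)
Lemma Riesz_decomposition (z : C) : z != 0 -> exists N1 N2 (e : R),
  [/\ 0 < e, cinv S N1 /\ cinv S N2, dsum N N1 N2, finite_dim N2 &
   bijective_on (opsub S z) N1 /\ forall l : C, 0 < nm l -> nm l <= e ->
    bijective_on (opsub S (z + l)) N].
Proof.
move=> z0; have [N1 [N2 [e [e0 c12 dN f2 H]]]] := Riesz_dichotomy z0.
suff b1 : bijective_on (opsub S z) N1.
  by exists N1, N2, e; split=> //; split=> // l l0 le; apply/H.
apply: contrapT => nb1.
pose bad w := ~ bijective_on (opsub S w) N.
have alt w : w != 0 -> (exists e', punct w e' bad) \/
    (exists e', punct w e' (fun w => bijective_on (opsub S w) N)).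
  move=> w0; have [N1' [N2' [e' [e0' _ _ _ H']]]] := Riesz_dichotomy w0.
  have [h|h] := pselect (bijective_on (opsub S w) N1'); [right|left];
    exists e'; split=> // l l0 le; first exact/H'.
  by move=> /(H' l l0 le).
pose A := [set t : R | 1 <= t /\ exists e', punct ((t%:C)%C * z) e' bad].
have A1 : A 1.
  by split=> //; exists e; split=> // l l0 le; rewrite rmorph1 mul1r => /(H l l0 le).
have nz := nm_gt0 z0.
have [b b0 big] := bijective_large bS cN.
have supA : has_sup A.
  split; first by exists 1.
  (* The extra 1 absorbs the displacement [l] to a bad point, whose norm is at most 1. *)
  exists ((b + 1) / nm z) => t [t1 [e' [e0' He]]].
  rewrite leNgt; apply/negP; rewrite ltr_pdivrMr// => tb.
  pose l : C := ((Num.min e' 1)%:C)%C.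
  have m0 : 0 < Num.min e' 1 by rewrite lt_min e0' ltr01.
  have nl : nm l = Num.min e' 1 by rewrite nmr gtr0_norm.
  apply: (He l); [by rewrite nl|by rewrite nl ge_min lexx|].
  apply: big.
  have := nmB ((t%:C)%C * z + l) l; rewrite addrK nmM nmr ger0_norm; last by lra.
  have : nm l <= 1 by rewrite nl ge_min lexx orbT.
  lra.
have [_ ubA] := supA.
pose t0 := sup A; have t01 : 1 <= t0 by exact (ub_le_sup ubA A1).
have t0z : (t0%:C)%C * z != 0.
  rewrite mulf_neq0// (_ : 0 = (0%:C)%C)// (inj_eq (@complexI _)) gt_eqF//; lra.
have [[e' [e0' He]]|[e' Qe]] := alt _ t0z.
(* If the point at [t0] is bad, the point at distance [e' / 2] further out is bad with radius
   [e' / 4], against the supremum. *)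
- pose h := e' / (2 * nm z).
  have h0 : 0 < h by rewrite divr_gt0// mulr_gt0.
  have hz : nm ((h%:C)%C * z) = e' / 2.
    by rewrite nmM nmr gtr0_norm// /h; field; rewrite gt_eqF.
  have : A (t0 + h).
    split; first by lra.
    exists (e' / 4); split=> [|l l0 le]; first by lra.
    rewrite rmorphD mulrDl -addrA; apply: He.
      by have := nmB ((h%:C)%C * z + l) l; rewrite addrK; lra.
    by have := nmD ((h%:C)%C * z) l; lra.
  by move=> h2; have := ub_le_sup ubA h2; rewrite -/t0; lra.
(* If the point at [t0] is good, a parameter of [A] within [h] below [t0] supplies a bad point in
   the good punctured disc. *)
- have [e0' He] := Qe; pose h := e' / (2 * nm z).
  have h0 : 0 < h by rewrite divr_gt0// mulr_gt0.
  have [t At tt0] := sup_adherent h0 supA; have [t1 [e2 [e20 He2]]] := At.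
  have tle : t <= t0 := ub_le_sup ubA At.
  have [tE|tne] := eqVneq t t0.
    by apply: (punct_excl Qe (e' := e2)); rewrite -tE.
  have tlt : t < t0 by rewrite lt_neqAle tne.
  pose d : C := ((t - t0)%:C)%C * z.
  have nd : nm d = (t0 - t) * nm z by rewrite nmM nmr ltr0_norm ?subr_lt0// opprB.
  have d0 : 0 < nm d by rewrite nd mulr_gt0// subr_gt0.
  have de : nm d <= e' / 2.
    have -> : e' / 2 = h * nm z by rewrite /h; field; rewrite gt_eqF.
    rewrite nd ler_pM2r//; move: tt0; rewrite -/t0; lra.
  pose r := Num.min e2 (nm d / 2).
  have r0 : 0 < r by rewrite lt_min e20 divr_gt0.
  have nl : nm (r%:C)%C = r by rewrite nmr gtr0_norm.
  have rd : r <= nm d / 2 by rewrite ge_min lexx orbT.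
  apply: (He2 (r%:C)%C); [by rewrite nl|by rewrite nl ge_min lexx|].
  have -> : (t%:C)%C * z + (r%:C)%C = (t0%:C)%C * z + (d + (r%:C)%C).
    by rewrite /d rmorphB /=; ring.
  apply: He.
    by have := nmB (d + (r%:C)%C) (r%:C)%C; rewrite addrK nl; lra.
  by have := nmD d (r%:C)%C; rewrite nl; lra.
Qed.

(** A whole disc is produced, not just a point, so that a second dense set can be met inside it in
    [sigma_gap]. *)
Lemma Riesz_dense (z : C) (d : R) : 0 < d -> exists (z' : C) (d' : R), 0 < d' /\
  forall w, nm (w - z') <= d' ->
    [/\ nm (w - z) <= d, w != 0 & bijective_on (opsub S w) N].
Proof.
move=> d0.
have [z1 [z10 zz1]] : exists z1 : C, z1 != 0 /\ nm (z1 - z) <= d / 2.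
  have d2 : 0 < d / 2 by lra.
  have [->|z0] := eqVneq z 0; last by exists z; rewrite subrr nm0; split=> //; exact: ltW.
  exists ((d / 2)%:C)%C; rewrite subr0 nmr gtr0_norm//; split=> //.
  by rewrite (_ : 0 = (0%:C)%C)// (inj_eq (@complexI _)) gt_eqF.
have [N1 [N2 [e [e0 _ _ _ [_ H]]]]] := Riesz_decomposition z10.
have n1 := nm_gt0 z10.
(* Points within [r / 2] of [z1 + r] are between [r / 2] and [3 / 2 * r] away from [z1]: inside the
   punctured disc, near [z] and away from 0. *)
pose r := Num.min (e / 2) (Num.min (d / 4) (nm z1 / 4)).
have r0 : 0 < r by rewrite !lt_min !divr_gt0.
have re : r <= e / 2 by rewrite ge_min lexx.
have rd : r <= d / 4 by rewrite !ge_min lexx orbT.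
have rz : r <= nm z1 / 4 by rewrite !ge_min lexx !orbT.
have nr : nm (r%:C)%C = r by rewrite nmr gtr0_norm.
exists (z1 + (r%:C)%C), (r / 2); split=> [|w hw]; first by lra.
pose l := w - z1; have wE : w = z1 + l by rewrite /l addrC subrK.
have lr : nm (l - (r%:C)%C) <= r / 2 by rewrite /l -addrA -opprD.
have l1 : nm l <= 3 / 2 * r.
  by have := nmD (l - (r%:C)%C) (r%:C)%C; rewrite subrK nr; lra.
have l2 : r / 2 <= nm l.
  have := nmB l (l - (r%:C)%C); rewrite opprB addrCA subrr addr0 nr; lra.
split.
- have := nmD3 w z1 z; rewrite -/l; lra.
- apply/eqP => w0; move: l1; rewrite /l w0 sub0r nmN; lra.
- by rewrite wE; apply: H; lra.
Qed.
End Riesz.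

End RieszOperators.

(** * The nine classes of operators *)

Section Classes.
Variables (R : realType) (X : completeNormedModType R[i]).
Local Notation C := R[i].
Implicit Types (M N F A : set X) (x y z : X) (S : X -> X).
Implicit Type Rcl : (X -> X) -> set X -> Prop.

(* [Rcl] depends only on the kernel dimension, the defect and the closedness of
   the range, and survives the removal of a finite-dimensional nilpotent part. *)
Definition profile_class Rcl :=
  exists rho : (nat -> Prop) -> (nat -> Prop) -> Prop -> Prop,
  [/\ forall S M, bounded_op S -> cinv S M ->
        (Rcl S M <-> rho (kerdim S M) (randef S M) (eclosed (ran_on S M))),
      forall k r c j, k j -> r j -> (forall n, k n.+1 -> k n) ->
        (forall n, r n.+1 -> r n) -> rho k r c ->
        rho (fun n => k (n + j)%N) (fun n => r (n + j)%N) True &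
      forall S M, bounded_op S -> cinv S M -> Rcl S M -> semiFredholm S M].

Lemma profile_class_same Rcl S M S' M' : profile_class Rcl -> bounded_op S -> bounded_op S' ->
  cinv S M -> cinv S' M' -> sameprof S M S' M' -> Rcl S M -> Rcl S' M'.
Proof.
move=> [rho [rhoE _ _]] bS bS' cM cM' [h1 h2 h3].
rewrite !rhoE//.
have -> : kerdim S M = kerdim S' M' by apply/funext => n; exact/propext.
have -> : randef S M = randef S' M' by apply/funext => n; exact/propext.
by have -> : eclosed (ran_on S M) = eclosed (ran_on S' M') by exact/propext.
Qed.

Lemma profile_class_shift Rcl S M M' j : profile_class Rcl -> bounded_op S ->
  cinv S M -> cinv S M' -> shifted S M M' j -> Rcl S M -> Rcl S M'.
Proof.
move=> [rho [rhoE rhoS _]] bS cM cM' [h1 h2 h3].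
rewrite !rhoE// => h.
have -> : kerdim S M' = fun n => kerdim S M (n + j)%N.
  by apply/funext => n; apply/propext; symmetry; exact: h1.
have -> : randef S M' = fun n => randef S M (n + j)%N.
  by apply/funext => n; apply/propext; symmetry; exact: h2.
have -> : eclosed (ran_on S M') = True by apply/propext.
apply: rhoS h.
- by apply/(h1 0%N); exact: has_indep0.
- by apply/(h2 0%N); exact: has_indep0.
- by move=> n; exact: has_indep_tail.
- by move=> n; exact: has_indep_tail.
Qed.

Definition exactly (k : nat -> Prop) p := k p /\ ~ k p.+1.

Lemma exactly_ex (k : nat -> Prop) : k 0%N -> (exists n, ~ k n.+1) ->
  exists p, exactly k p.
Proof.
move=> k0 [n]; elim: n => [|n IH] h; first by exists 0%N.
by have [h'|/IH//] := pselect (k n.+1); exists n.+1.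
Qed.

Lemma mono_le (k : nat -> Prop) m n : (forall n, k n.+1 -> k n) -> (m <= n)%N ->
  k n -> k m.
Proof.
move=> H; elim: n => [|n IH]; first by rewrite leqn0 => /eqP ->.
by rewrite leq_eqVlt => /orP[/eqP ->//|/IH h /H].
Qed.

Lemma exactly_shift (k : nat -> Prop) p j : (forall n, k n.+1 -> k n) -> k j ->
  exactly k p -> (j <= p)%N /\ exactly (fun n => k (n + j)%N) (p - j).
Proof.
move=> H kj [kp nkp]; have jp : (j <= p)%N.
  by rewrite leqNgt; apply/negP => pj; apply: nkp; exact: mono_le kj.
by split=> //; rewrite /exactly addSn subnK.
Qed.

Lemma xget_least (P : nat -> Prop) p : P p -> (forall m, P m -> (p <= m)%N) ->
  xget 0%N [set n | P n /\ forall m, P m -> (n <= m)%N] = p.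
Proof.
move=> Pp pmin; case: xgetP => [n _ [Pn nmin]|/(_ p) H].
  by apply/eqP; rewrite eqn_leq nmin// pmin.
by exfalso; apply: H; split.
Qed.

Lemma fdimP S M p : bounded_op S -> cinv S M -> exactly (kerdim S M) p ->
  fdim (ker_on S M) = p.
Proof.
move=> bS [cM iM] [kp nkp]; have sk := (csub_ker bS cM).1.
apply: xget_least; first by apply/(dim_leP _ sk).
move=> m /(dim_leP _ sk) nm'; rewrite leqNgt; apply/negP => mp; apply: nm'.
exact: has_indep_leq kp.
Qed.

Lemma fcodimP S M p : bounded_op S -> cinv S M -> exactly (randef S M) p ->
  fcodim (ran_on S M) M = p.
Proof.
move=> bS [cM iM] [kp nkp]; have sR := is_subspace_ran bS cM.1.
apply: xget_least; first by apply/(codim_leP _ sR cM.1).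
move=> m /(codim_leP _ sR cM.1) nm'; rewrite leqNgt; apply/negP => mp; apply: nm'.
exact: has_indep_leq kp.
Qed.

Lemma Phi_plus_onP S M : bounded_op S -> cinv S M ->
  Phi_plus_on S M <-> (exists n, ~ kerdim S M n.+1) /\ eclosed (ran_on S M).
Proof.
move=> bS [cM iM]; have sk := (csub_ker bS cM).1.
split=> [[[n /(dim_leP _ sk) kn] /closedE]|[[n kn] cR]]; first by split=> //; exists n.
by split; [exists n; exact/(dim_leP _ sk)|exact/closedE].
Qed.

Lemma Phi_minus_onP S M : bounded_op S -> cinv S M ->
  Phi_minus_on S M <-> exists n, ~ randef S M n.+1.
Proof.
move=> bS [cM iM]; have sR := is_subspace_ran bS cM.1.
by split=> -[n h]; exists n; exact/(codim_leP _ sR cM.1).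
Qed.

Lemma closed_ran_defect S M : bounded_op S -> cinv S M -> (exists n, ~ randef S M n.+1) ->
  eclosed (ran_on S M).
Proof.
move=> bS [cM iM] [n h]; apply: (closed_codim bS cM iM (n := n)).
by apply/(codim_leP _ (is_subspace_ran bS cM.1) cM.1).
Qed.

Lemma kerdim0 S M : kerdim S M 0. Proof. exact: has_indep0. Qed.
Lemma randef0 S M : randef S M 0. Proof. exact: has_indep0. Qed.

Lemma exactly_kerdim S M : bounded_op S -> cinv S M -> (exists n, ~ kerdim S M n.+1) ->
  exactly (kerdim S M) (fdim (ker_on S M)).
Proof.
move=> bS cM /(exactly_ex (kerdim0 S M))[p ep].
by rewrite (fdimP bS cM ep).
Qed.

Lemma exactly_randef S M : bounded_op S -> cinv S M -> (exists n, ~ randef S M n.+1) ->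
  exactly (randef S M) (fcodim (ran_on S M) M).
Proof.
move=> bS cM /(exactly_ex (randef0 S M))[p ep].
by rewrite (fcodimP bS cM ep).
Qed.

Let shift_fin (k : nat -> Prop) j : (forall n, k n.+1 -> k n) ->
  (exists n, ~ k n.+1) -> exists n, ~ k (n.+1 + j)%N.
Proof.
move=> H [n nk]; exists n => h; apply: nk; apply: mono_le h => //.
exact: leq_addr.
Qed.

Let unshift_fin (k : nat -> Prop) j :
  (exists n, ~ k (n.+1 + j)%N) -> exists n, ~ k n.+1.
Proof. by move=> [n nk]; exists (n + j)%N; rewrite -addSn. Qed.

Let shift_one (k : nat -> Prop) j : (forall n, k n.+1 -> k n) ->
  ~ k 1%N -> ~ k (1 + j)%N.
Proof. by move=> H nk h; apply: nk; apply: mono_le h. Qed.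

Lemma profile_Phi_plus : profile_class (@Phi_plus_on R X).
Proof.
exists (fun k r c => (exists n, ~ k n.+1) /\ c); split.
- exact: Phi_plus_onP.
- by move=> k r c j kj rj mk mr [fk _]; split=> //; exact: shift_fin.
- by move=> S M bS cM /(Phi_plus_onP bS cM)[[n kn] cR]; split=> //; exists n; left.
Qed.

Let semi_defect S M : bounded_op S -> cinv S M -> (exists n, ~ randef S M n.+1) ->
  semiFredholm S M.
Proof.
move=> bS cM h; split; first exact: closed_ran_defect.
by have [n rn] := h; exists n; right.
Qed.

Lemma profile_Phi_minus : profile_class (@Phi_minus_on R X).
Proof.
exists (fun k r c => exists n, ~ r n.+1); split.
- exact: Phi_minus_onP.
- by move=> k r c j kj rj mk mr fr; exact: shift_fin.
- by move=> S M bS cM /(Phi_minus_onP bS cM); exact: semi_defect.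
Qed.

Lemma profile_Phi : profile_class (@Phi_on R X).
Proof.
exists (fun k r c => [/\ exists n, ~ k n.+1, c & exists n, ~ r n.+1]); split.
- exact: Phi_onP.
- by move=> k r c j kj rj mk mr [fk _ fr]; split=> //; exact: shift_fin.
- exact: Phi_semiFredholm.
Qed.

(** [fdim] and [fcodim] default to 0 on infinite dimensions, so the comparison is restated with
    [exactly], where both dimensions are known to be finite. *)
Lemma W_plus_onP S M : bounded_op S -> cinv S M -> W_plus_on S M <->
  [/\ exists n, ~ kerdim S M n.+1, eclosed (ran_on S M) &
    (exists n, ~ randef S M n.+1) -> exists p q,
      [/\ exactly (kerdim S M) p, exactly (randef S M) q & (p <= q)%N]].
Proof.
move=> bS cM; rewrite /W_plus_on Phi_plus_onP// Phi_minus_onP//.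
split=> [[[fk cR] H]|[fk cR H]]; split=> //.
  move=> fr; exists (fdim (ker_on S M)), (fcodim (ran_on S M) M).
  by split; [exact: exactly_kerdim|exact: exactly_randef|exact: H].
by move=> /H[p [q [ep eq pq]]]; rewrite (fdimP bS cM ep) (fcodimP bS cM eq).
Qed.

(** Removing [j] Jordan blocks lowers both dimensions by [j] and so preserves their order. *)
Lemma profile_W_plus : profile_class (@W_plus_on R X).
Proof.
exists (fun k r c => [/\ exists n, ~ k n.+1, c & (exists n, ~ r n.+1) ->
  exists p q, [/\ exactly k p, exactly r q & (p <= q)%N]]); split.
- exact: W_plus_onP.
- move=> k r c j kj rj mk mr [fk _ H]; split=> //; first exact: shift_fin.
  move=> /unshift_fin/H[p [q [/(exactly_shift mk kj)[_ ep] /(exactly_shift mr rj)[_ eq] pq]]].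
  by exists (p - j)%N, (q - j)%N; split=> //; exact: leq_sub2r.
- by move=> S M bS cM /(W_plus_onP bS cM)[[n kn] cR _]; split=> //; exists n; left.
Qed.

Lemma W_minus_onP S M : bounded_op S -> cinv S M -> W_minus_on S M <->
  (exists n, ~ randef S M n.+1) /\
    ((exists n, ~ kerdim S M n.+1) -> exists p q,
      [/\ exactly (kerdim S M) p, exactly (randef S M) q & (q <= p)%N]).
Proof.
move=> bS cM; rewrite /W_minus_on Phi_plus_onP// Phi_minus_onP//.
split=> [[fr H]|[fr H]]; split=> //.
  move=> fk; exists (fdim (ker_on S M)), (fcodim (ran_on S M) M).
  split; [exact: exactly_kerdim|exact: exactly_randef|apply: H; split=> //].
  exact: closed_ran_defect.
by move=> [/H[p [q [ep eq pq]]] _]; rewrite (fdimP bS cM ep) (fcodimP bS cM eq).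
Qed.

Lemma profile_W_minus : profile_class (@W_minus_on R X).
Proof.
exists (fun k r c => (exists n, ~ r n.+1) /\ ((exists n, ~ k n.+1) ->
  exists p q, [/\ exactly k p, exactly r q & (q <= p)%N])); split.
- exact: W_minus_onP.
- move=> k r c j kj rj mk mr [fr H]; split=> //; first exact: shift_fin.
  move=> /unshift_fin/H[p [q [/(exactly_shift mk kj)[_ ep] /(exactly_shift mr rj)[_ eq] pq]]].
  by exists (p - j)%N, (q - j)%N; split=> //; exact: leq_sub2r.
- by move=> S M bS cM /(W_minus_onP bS cM)[+ _]; exact: semi_defect.
Qed.

Lemma W_onP S M : bounded_op S -> cinv S M -> W_on S M <->
  [/\ exists n, ~ kerdim S M n.+1, eclosed (ran_on S M), exists n, ~ randef S M n.+1 &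
    exists p, exactly (kerdim S M) p /\ exactly (randef S M) p].
Proof.
move=> bS cM; rewrite /W_on Phi_onP//.
split=> [[[fk cR fr] H]|[fk cR fr [p [ep eq]]]]; split=> //.
  exists (fdim (ker_on S M)); split; first exact: exactly_kerdim.
  by rewrite H; exact: exactly_randef.
by rewrite (fdimP bS cM ep) (fcodimP bS cM eq).
Qed.

Lemma profile_W : profile_class (@W_on R X).
Proof.
exists (fun k r c => [/\ exists n, ~ k n.+1, c, exists n, ~ r n.+1 &
  exists p, exactly k p /\ exactly r p]); split.
- exact: W_onP.
- move=> k r c j kj rj mk mr [fk _ fr [p [/(exactly_shift mk kj)[_ ep] /(exactly_shift mr rj)[_ eq]]]].
  by split=> //; [exact: shift_fin|exact: shift_fin|exists (p - j)%N].
- by move=> S M bS cM /(W_onP bS cM)[[n kn] cR _ _]; split=> //; exists n; left.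
Qed.

Lemma bounded_below_onP S M : bounded_op S -> cinv S M ->
  bounded_below_on S M <-> ~ kerdim S M 1 /\ eclosed (ran_on S M).
Proof.
move=> bS [cM iM]; rewrite /kerdim has_indep1; last exact: is_subspace0.
split.
- move=> [c []]; rewrite ltcE /= => /andP[/eqP ci c0] H.
  have {}H x : M x -> nm x <= (complex.Re c)^-1 * nm (S x).
    move=> /H; rewrite !nmE (_ : c = ((complex.Re c)%:C)%C); last first.
      by case: c ci {H c0} => a b /= ->.
    by rewrite -rmorphM /= lecR mulrC -ler_pdivlMr// mulrC.
  split; first by move=> x [Mx Sx]; apply: nm_eq0; have := H x Mx; rewrite Sx nm0 mulr0.
  by apply: (lifts_closed_ran bS cM (c := (complex.Re c)^-1)) => x Mx; exists x; split=> //; exact: H.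
- move=> [inj cR]; have [c c0 om] := closed_ran_lifts bS cM cR.
  exists ((c^-1%:C)%C); split; first by rewrite ltcR invr_gt0.
  move=> x Mx; have [w [Mw Sw wc]] := om x Mx.
  have xw : x = w.
    apply/eqP; rewrite -subr_eq0; apply/eqP; apply: inj; split.
      exact: (sub_B cM.1).
    by rewrite (blinB bS) Sw subrr.
  by rewrite !nmE -rmorphM /= lecR mulrC ler_pdivrMr// mulrC {1}xw.
Qed.

Lemma profile_bounded_below : profile_class (@bounded_below_on R X).
Proof.
exists (fun k r c => ~ k 1%N /\ c); split.
- exact: bounded_below_onP.
- by move=> k r c j kj rj mk mr [k1 _]; split=> //; exact: shift_one.
- by move=> S M bS cM /(bounded_below_onP bS cM)[k1 cR]; split=> //; exists 0%N; left.
Qed.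

Lemma surjective_onP S M : bounded_op S -> cinv S M ->
  surjective_on S M <-> ~ randef S M 1.
Proof.
move=> bS [cM iM]; rewrite /randef has_indep1; last by apply: (is_subspace_ran bS); exact: cM.1.
split=> [E x Mx|H]; first by rewrite E.
by apply/seteqP; split=> // _ [x Mx <-]; apply: iM; exists x.
Qed.

Lemma profile_surjective : profile_class (@surjective_on R X).
Proof.
exists (fun k r c => ~ r 1%N); split.
- exact: surjective_onP.
- by move=> k r c j kj rj mk mr; exact: shift_one.
- move=> S M bS cM /(surjective_onP bS cM) r1; apply: semi_defect => //.
  by exists 0%N.
Qed.

Lemma invertible_onP S M : bounded_op S -> cinv S M ->
  invertible_on S M <-> ~ kerdim S M 1 /\ ~ randef S M 1.
Proof.
move=> bS cM; rewrite -bijective_profP//; split.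
- move=> [G [GM [GS [SG _]]]]; split=> [x Mx Sx|y My].
    rewrite -(GS x Mx) Sx -{1}(blin0 bS); apply: GS.
    exact: (sub_0 cM.1.1).
  by exists (G y); [apply: GM; exists y|exact: SG].
- move=> b; have [inj surj] := b.
  have /choice[G GP] : forall y, exists x, M y -> M x /\ S x = y.
    by move=> y; have [/surj[x Mx <-]|nM] := pselect (M y); [exists x|exists 0].
  have [_ r1] := (bijective_profP bS cM).1 b.
  have cR : eclosed (ran_on S M) by apply: closed_ran_defect => //; exists 0%N.
  have [c c0 om] := closed_ran_lifts bS cM.1 cR.
  have eqI x y : M x -> M y -> S x = S y -> x = y.
    move=> Mx My E; apply/eqP; rewrite -subr_eq0; apply/eqP; apply: inj.
      exact: (sub_B cM.1.1).
    by rewrite (blinB bS) E subrr.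
  exists G; split; first by move=> _ [y /GP[MG _] <-].
  split; first by move=> x Mx; have [|MG E] := GP (S x); [apply: cM.2; exists x|exact: eqI].
  split; first by move=> x /GP[].
  exists ((c%:C)%C) => x Mx; have [MG E] := GP x Mx.
  have [w [Mw Sw wc]] := om _ MG.
  by rewrite !nmE -rmorphM /= lecR (eqI _ _ MG Mw) ?Sw// (le_trans wc)// E.
Qed.

Lemma profile_invertible : profile_class (@invertible_on R X).
Proof.
exists (fun k r c => ~ k 1%N /\ ~ r 1%N); split.
- exact: invertible_onP.
- by move=> k r c j kj rj mk mr [k1 r1]; split; exact: shift_one.
- move=> S M bS cM /(invertible_onP bS cM)[_ r1]; apply: semi_defect => //.
  by exists 0%N.
Qed.

End Classes.

(** * Spectra *)

Section MainFact.
Variables (R : realType) (X : completeNormedModType R[i]).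
Local Notation C := R[i].
Implicit Types (M N F A : set X) (x y z : X) (S : X -> X).
Implicit Type Rcl : (X -> X) -> set X -> Prop.

Lemma sigmaP Rcl S (l : C) : ~ sigma_gDR_cls Rcl S l <-> exists M N,
  [/\ cinv (opsub S l) M, cinv (opsub S l) N, dsum setT M N,
      Rcl (opsub S l) M & Riesz_on (opsub S l) N].
Proof.
rewrite /sigma_gDR_cls /=; split.
- move/contrapT => [M [N [/csubE cM /csubE cN [D I] [iM iN] [RM RN]]]].
  exists M, N; split=> //; split=> //.
    by move=> x _; have [m [n [? [? ?]]]] := D x; exists m, n.
  by move=> x Mx Nx; have : (M `&` N) x by []; rewrite I.
- move=> [M [N [[cM iM] [cN iN] [D _ _ I] RM RN]]]; apply; exists M, N; split.
  + exact/csubE.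
  + exact/csubE.
  + split; first by move=> x; have [m [n [? ? ?]]] := D x Logic.I; exists m, n.
    apply/seteqP; split=> x; first by move=> [Mx Nx]; exact: I.
    by move=> ->; split; [exact: (sub_0 cM.1)|exact: (sub_0 cN.1)].
  + by [].
  + by [].
Qed.

Lemma dsum_sumset M N : is_subspace M -> is_subspace N ->
  (forall x, M x -> N x -> x = 0) -> dsum (sumset M N) M N.
Proof.
move=> sM sN dis; split=> // x h; first by exists x, 0; rewrite addr0; split=> //; exact: sub_0.
by exists 0, x; rewrite add0r; split=> //; exact: sub_0.
Qed.

Lemma dsum_sym F M N : dsum F M N -> dsum F N M.
Proof.
move=> [h1 h2 h3 h4]; split=> //.
  by move=> x /h1[m [n [Mm Nn ->]]]; exists n, m; rewrite addrC.
by move=> x Nx Mx; exact: h4.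
Qed.

Lemma sumsetC M N : sumset M N = sumset N M.
Proof.
by apply/seteqP; split=> x [m [n [? ? ->]]]; exists n, m; rewrite addrC.
Qed.

Lemma cinv_sumset S F M N A : bounded_op S -> csub F -> cinv S M -> cinv S N ->
  dsum F M N -> cinv S A -> (forall x, A x -> N x) -> cinv S (sumset M A).
Proof.
move=> bS cF cM cN dF cA AN; split.
  exact: (csub_dsum cF cM.1 cN.1 dF cM.1 cA.1).
have /invP iM := cM.2; have /invP iA := cA.2.
apply/invP => _ [m [n [Mm An ->]]]; exists (S m), (S n); rewrite (blinD bS).
by split=> //; [exact: iM|exact: iA].
Qed.

(** The nilpotent summand [M2] is finite-dimensional and can be moved into the Riesz summand. *)
Lemma sigma_gKR_sub Rcl S : profile_class Rcl -> bounded_op S ->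
  sigma_gKR S `<=` sigma_gDR_cls Rcl S.
Proof.
move=> pc bT l; apply: contraPP => /sigmaP[M [N [cM cN dMN RM RN]]].
suff : ~ sigma_gDR_cls (@Kato_on R X) S l by [].
apply/sigmaP; have bS := blin_opsub bT l.
have [rho [_ _ semi]] := pc.
have [M1 [M2 [k [c1 c2 dM [f2 n2] [k1 s1]]]]] := Kato_decomposition bS cM (semi _ _ bS cM RM).
have dT : dsum setT M1 (sumset M2 N) by exact: dsum_trans (csubT X).1 cM.1.1 dMN dM.
have [_ M1M M2M _] := dM; have [_ _ _ dis] := dMN.
exists M1, (sumset M2 N); split=> //.
- rewrite sumsetC; apply: (cinv_sumset bS (csubT X) cN cM (dsum_sym dMN) c2 M2M).
- apply: Riesz_add_findim => //.
  by move=> x M2x Nx; apply: dis => //; exact: M2M.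
Qed.

(* Points outside the spectrum close to [l] provide arbitrarily close [w] with
   [S - w] itself in the class (the Riesz parts become invertible); restricting to
   the Kato part and moving back to [l] preserves the profile. *)
Lemma sigma_gap Rcl S (l : C) : profile_class Rcl -> bounded_op S -> ~ sigma_gKR S l ->
  (forall e : R, 0 < e -> exists m : C, nm (m - l) < e /\ ~ sigma_gDR_cls Rcl S m) ->
  exists e : R, 0 < e /\ forall m : C, nm (m - l) < e -> ~ sigma_gDR_cls Rcl S m.
Proof.
move=> pc bT /sigmaP[M [N [cM cN dMN kM RN]]] clos.
have [rho [_ _ semi]] := pc.
set K := opsub S l in cM cN kM RN; have bK : bounded_op K by exact: blin_opsub.
have [e [e0 eP]] := Kato_profile bK cM.1 cM.2 kM.
have same q : nm q <= e -> sameprof (opsub K q) M K M.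
  move=> qe; have [h1 h2 h3] := eP q qe; split=> //; split=> // _.
  by have [/closedE] := kM.
have RK : Rcl K M.
  have e2 : 0 < e / 2 by lra.
  have [m [ml /sigmaP[M' [N' [cM' cN' dMN' RM' RN']]]]] := clos _ e2.
  set U := opsub S m in cM' cN' RM' RN'; have bU : bounded_op U by exact: blin_opsub.
  have [M1 [M2 [k [c1 c2 dM' [f2 [p n2]] [k1 s1]]]]] :=
    Kato_decomposition bU cM' (semi _ _ bU cM' RM').
  have [e1 [e10 e1P]] := Kato_profile bU c1.1 c1.2 k1.
  (* The shift [w] from [m] must stay in the disc of [M1], and together with [m - l] in the disc of
     radius [e] around [l]. *)
  have d0 : 0 < Num.min e1 (e / 2) by rewrite lt_min e10.
  (* A disc that is good for the Riesz part at [m] is translated by [m - l], and a point good for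
     the Riesz part at [l] is chosen in it. *)
  have [z1 [d1 [d10 H1]]] := Riesz_dense bU cN' RN' 0 d0.
  have [z2 [d2 [d20 H2]]] := Riesz_dense bK cN RN (m - l + z1) d10.
  have [|hz z20 bN] := H2 z2; first by rewrite subrr nm0 ltW.
  pose w := z2 - (m - l).
  have [|hw w0 bN'] := H1 w; first by rewrite /w -addrA -opprD.
  rewrite subr0 le_min in hw; case/andP: hw => we1 we2.
  have VE : opsub U w = opsub K z2.
    by rewrite /U /K !opsubD; congr opsub; rewrite /w; ring.
  set V := opsub U w in VE bN'; have bV : bounded_op V by exact: blin_opsub.
  have c1V : cinv V M1 by exact: cinv_opsub.
  have c2V : cinv V M2 by exact: cinv_opsub.
  have cM'V : cinv V M' by exact: cinv_opsub.
  have cN'V : cinv V N' by exact: cinv_opsub.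
  have cMV : cinv V M by rewrite VE; exact: cinv_opsub.
  have cNV : cinv V N by rewrite VE; exact: cinv_opsub.
  have cTV : cinv V setT by split; [exact: (csubT X)|exact/invP].
  (* The class travels from [U] on [M'] to [U] on [M1], then to [V] on [M1], [M'], the whole space
     and [M], and finally to [K] on [M]. *)
  have VM1 : Rcl V M1.
    have RM1 := profile_class_shift pc bU cM' c1 s1 RM'.
    apply: (profile_class_same pc bU bV c1 c1V _ RM1).
    have [h3 h1 h2] := e1P w we1; split=> [n|n|]; [symmetry; exact: h1|symmetry; exact: h2|].
    by split=> // _; have [/closedE] := k1.
  have VM' : Rcl V M'.
    have [h1 h2 h3] : sameprof V M' V M1.
      apply: (sameprof_dsum bV cM'.1 c1V c2V dM').
      exact: nilpotent_bijective bU c2 n2 w0.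
    apply: (profile_class_same pc bV bV c1V cM'V _ VM1).
    by split=> [n|n|]; symmetry; [exact: h1|exact: h2|exact: h3].
  have VT : Rcl V setT.
    have [h1 h2 h3] := sameprof_dsum bV (csubT X) cM'V cN'V dMN' bN'.
    apply: (profile_class_same pc bV bV cM'V cTV _ VM').
    by split=> [n|n|]; symmetry; [exact: h1|exact: h2|exact: h3].
  have VM : Rcl V M.
    have bNV : bijective_on V N by rewrite VE.
    have h := sameprof_dsum bV (csubT X) cMV cNV dMN bNV.
    exact: (profile_class_same pc bV bV cTV cMV h VT).
  have z2e : nm z2 <= e.
    have := nmD w (m - l); rewrite /w subrK -/w; lra.
  rewrite VE in VM bV cMV.
  exact: (profile_class_same pc _ bK cMV cM (same _ z2e) VM).
exists e; split=> // m me; apply/sigmaP.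
pose q := m - l; have -> : opsub S m = opsub K q.
  by rewrite /K opsubD /q addrC subrK.
have bq := blin_opsub bK q.
have [q0|q0] := eqVneq q 0.
  by exists M, N; rewrite q0 opsub0.
(* [K - q] is bijective on [N1], which therefore joins [M]; the finite-dimensional [N2] is the new
   Riesz summand. *)
have [N1 [N2 [d [d0 [c1 c2] dN f2 [b1 _]]]]] := Riesz_decomposition bK cN RN q0.
have [_ N1N N2N dis2] := dN; have [_ _ _ dis] := dMN.
have c1q := cinv_opsub q c1; have c2q := cinv_opsub q c2.
have cMq := cinv_opsub q cM.
have cMN1 : cinv (opsub K q) (sumset M N1).
  exact: (cinv_sumset bq (csubT X) cMq (cinv_opsub q cN) dMN c1q N1N).
have dMN1 : dsum (sumset M N1) M N1.
  apply: dsum_sumset; [exact: cM.1.1|exact: c1.1.1|].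
  by move=> x Mx /N1N Nx; exact: dis.
exists (sumset M N1), N2; split=> //.
- have := dsum_trans (csubT X).1 cN.1.1 (dsum_sym dMN) (dsum_sym dN).
  by rewrite sumsetC => /dsum_sym.
- have RqM : Rcl (opsub K q) M.
    apply: (profile_class_same pc bK bq cM cMq _ RK).
    have [h1 h2 h3] := same q (ltW me).
    by split=> [n|n|]; symmetry; [exact: h1|exact: h2|exact: h3].
  have [h1 h2 h3] := sameprof_dsum bq cMN1.1 cMq c1q dMN1 b1.
  apply: (profile_class_same pc bq bq cMq cMN1 _ RqM).
  by split=> [n|n|]; symmetry; [exact: h1|exact: h2|exact: h3].
- exact: Riesz_findim.
Qed.

Lemma sigma_bounded S : bounded_op S -> exists b : R, forall l : C,
  sigma_gDR S l -> nm l <= b.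
Proof.
move=> bS; have cT : cinv S setT by split; [exact: (csubT X)|exact/invP].
have [b b0 H] := bijective_large bS cT; exists b => l; apply: contraPP => /negP.
rewrite -ltNge => /H bl; suff : ~ sigma_gDR_cls (@invertible_on R X) S l by [].
have bSl := blin_opsub bS l; have cTl := cinv_opsub l cT.
apply/sigmaP; exists setT, [set 0]; split=> //.
- exact: cinv0.
- exact: dsum_id (csubT X).1.
- by apply/(invertible_onP bSl cTl); apply/bijective_profP.
- exact: Riesz0.
Qed.

Lemma sigma_sub Rcl Rcl' S : bounded_op S ->
  (forall U M, bounded_op U -> cinv U M -> Rcl U M -> Rcl' U M) ->
  sigma_gDR_cls Rcl' S `<=` sigma_gDR_cls Rcl S.
Proof.
move=> bS H l; apply: contraPP => /sigmaP[M [N [cM cN d RM RN]]].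
suff : ~ sigma_gDR_cls Rcl' S l by [].
apply/sigmaP; exists M, N; split=> //; apply: H => //; exact: blin_opsub.
Qed.

End MainFact.

(** * Inclusions between the classes *)

Section ClassInclusions.
Variables (R : realType) (X : completeNormedModType R[i]).
Variables (S : X -> X) (M : set X) (bS : bounded_op S) (cM : cinv S M).

Lemma bounded_below_W_plus : bounded_below_on S M -> W_plus_on S M.
Proof.
move=> /(bounded_below_onP bS cM)[k1 cR]; apply/(W_plus_onP bS cM); split=> //.
  by exists 0%N.
move=> /(exactly_ex (randef0 S M))[q eq]; exists 0%N, q; split=> //.
by split=> //; exact: kerdim0.
Qed.

Lemma W_plus_Phi_plus : W_plus_on S M -> Phi_plus_on S M.
Proof. by case. Qed.

Lemma surjective_W_minus : surjective_on S M -> W_minus_on S M.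
Proof.
move=> /(surjective_onP bS cM) r1; apply/(W_minus_onP bS cM); split; first by exists 0%N.
move=> /(exactly_ex (kerdim0 S M))[p ep]; exists p, 0%N; split=> //.
by split=> //; exact: randef0.
Qed.

Lemma W_minus_Phi_minus : W_minus_on S M -> Phi_minus_on S M.
Proof. by case. Qed.

Lemma invertible_bounded_below : invertible_on S M -> bounded_below_on S M.
Proof.
move=> /(invertible_onP bS cM)[k1 r1]; apply/(bounded_below_onP bS cM); split=> //.
by apply: closed_ran_defect => //; exists 0%N.
Qed.

Lemma invertible_surjective : invertible_on S M -> surjective_on S M.
Proof. by move=> /(invertible_onP bS cM)[k1 r1]; apply/(surjective_onP bS cM). Qed.

Lemma invertible_W : invertible_on S M -> W_on S M.
Proof.
move=> /(invertible_onP bS cM)[k1 r1]; apply/(W_onP bS cM); split.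
- by exists 0%N.
- by apply: closed_ran_defect => //; exists 0%N.
- by exists 0%N.
- by exists 0%N; split; split=> //; [exact: kerdim0|exact: randef0].
Qed.

Lemma W_Phi : W_on S M -> Phi_on S M.
Proof. by case. Qed.

Lemma Phi_Phi_plus : Phi_on S M -> Phi_plus_on S M.
Proof. by case. Qed.

Lemma Phi_Phi_minus : Phi_on S M -> Phi_minus_on S M.
Proof. by case. Qed.

Lemma W_W_plus : W_on S M -> W_plus_on S M.
Proof. by move=> [[h1 _] E]; split=> // _; rewrite E. Qed.

Lemma W_W_minus : W_on S M -> W_minus_on S M.
Proof. by move=> [[_ h1] E]; split=> // _; rewrite E. Qed.

End ClassInclusions.

(** * Boundaries and connected hulls *)

Section Boundaries.
Variable R : realType.
Local Notation C := R[i].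
Implicit Types K : set C^o.

Lemma nbhs_nm (z : C^o) (A : set C^o) :
  nbhs z A <-> exists e : R, 0 < e /\ forall w : C, nm (w - z) < e -> A w.
Proof.
split=> [/nbhs_ballP[e /=]|[e [e0 H]]].
  rewrite ltcE /= => /andP[/eqP ei e0] H; exists (complex.Re e); split=> // w wz.
  apply: H; rewrite -ball_normE /= distrC nmE ltcE /= ei eqxx; exact: wz.
apply/nbhs_ballP; exists (e%:C)%C => /=; first by rewrite ltcR.
move=> w; rewrite -ball_normE /= distrC nmE ltcR; exact: H.
Qed.

Lemma interior_nm (z : C^o) (A : set C^o) :
  interior A z <-> exists e : R, 0 < e /\ forall w : C, nm (w - z) < e -> A w.
Proof. exact: nbhs_nm. Qed.

Lemma closure_nm (z : C^o) (A : set C^o) :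
  closure A z <-> forall e : R, 0 < e -> exists w : C, nm (w - z) < e /\ A w.
Proof.
split=> [clz e e0|H B /nbhs_nm[e [e0 eB]]].
  have [|w [Aw wz]] := clz [set w : C^o | nm ((w : C) - z) < e].
    by apply/nbhs_nm; exists e.
  by exists w.
by have [w [wz Aw]] := H e e0; exists w; split=> //; exact: eB.
Qed.

(* Off [K1], the complement of [K2] is locally everything or locally nothing. *)
Definition gapped K1 K2 := forall z : C^o, ~ K1 z -> closure (~` K2) z ->
  interior (~` K2) z.

(** A boundary point of [K2] outside the closure of [K1] would be off [K0] and a limit of the
    complement of [K2]; the gap would then give a disc free of [K2] around it. *)
Lemma cboundary_sub K0 K1 K2 : K0 `<=` K1 -> K1 `<=` K2 -> gapped K0 K2 ->
  cboundary K2 `<=` cboundary K1.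
Proof.
move=> K01 K12 gap z [clz nintz]; split; last first.
  move=> /interior_nm[e [e0 H]]; apply: nintz; apply/interior_nm.
  by exists e; split=> // w /H/K12.
apply: contrapT => ncl.
have n1 : ~ K1 z by move=> K1z; apply: ncl; exact: subset_closure.
have cl2 : closure (~` K2) z.
  apply/closure_nm => e e0; apply: contrapT => H; apply: nintz; apply/interior_nm.
  exists e; split=> // w wz; apply: contrapT => nw; apply: H; by exists w.
have /interior_nm[e [e0 H]] := gap z (fun k => n1 (K01 _ k)) cl2.
move/closure_nm: clz => /(_ e e0)[w [wz K2w]].
exact: H w wz K2w.
Qed.

Lemma bounded_nm (A : set C^o) (b : R) : (forall w, A w -> nm (w : C) <= b) ->
  bounded_set A.
Proof.
move=> H; exists (b%:C)%C; split.
  by apply/complex_realP; exists b.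
move=> x bx w /H wb; rewrite /= nmE; apply: ltW; apply: le_lt_trans bx.
by rewrite lecR.
Qed.

Lemma bounded_subset (A B : set C^o) : A `<=` B -> bounded_set B -> bounded_set A.
Proof.
by move=> AB [b [br H]]; exists b; split=> // x /H Hx w /AB; exact: Hx.
Qed.

Lemma component_max (A D : set C^o) z : D z -> D `<=` A -> connected D ->
  D `<=` connected_component A z.
Proof. by move=> Dz DA cD w Dw; exists D. Qed.

(** In an unbounded component [D] of the complement of [K1], the part outside [K2] is relatively
    open and closed by the gap, and nonempty because [K2] is bounded. Hence [D] misses [K2], and
    both sets leave the same unbounded components. *)
Lemma chull_eq K1 K2 (b : R) : K1 `<=` K2 -> gapped K1 K2 ->
  (forall z, K2 z -> nm (z : C) <= b) -> chull K1 = chull K2.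
Proof.
move=> K12 gap bd; apply/seteqP; split=> z nz.
- move=> [w [nw [ub cz]]]; apply: nz; exists w; split; first by move=> /K12.
  have sub : connected_component (~` K2) w `<=` connected_component (~` K1) w.
    move=> v [D [Dw DK cD] Dv]; exists D => //; split=> //.
    by move=> u /DK nu /K12.
  by split; [move=> /(bounded_subset sub)|exact: sub].
- move=> [w [nw [ub cz]]]; apply: nz.
  set D := connected_component (~` K1) w in ub cz.
  have cD : connected D by exact: component_connected.
  have Dw : D w by exists [set w] => //; split=> //; [move=> _ ->|exact: connected1].
  have DK1 : D `<=` ~` K1 by exact: connected_component_sub.
  suff DK2 : D `<=` ~` K2.
    have sub := component_max Dw DK2 cD.
    exists w; split; first exact: DK2.
    by split; [move=> /(bounded_subset sub)|exact: sub].
  suff -> : D = D `&` ~` K2 by move=> ? [].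
  symmetry; apply: cD.
  + apply: contrapT => H; apply: ub; apply: (@bounded_nm _ b) => v Dv.
    by apply: bd; apply: contrapT => nv; apply: H; exists v.
  + exists (interior (~` K2)); first exact: open_interior.
    apply/seteqP; split=> v [Dv h]; split=> //.
      by apply: gap; [exact: DK1|exact: subset_closure].
    exact: interior_subset.
  + exists (closure (~` K2)); first exact: closed_closure.
    apply/seteqP; split=> v [Dv h]; split=> //; first exact: subset_closure.
    by apply: interior_subset; apply: gap => //; exact: DK1.
Qed.

End Boundaries.

(** * Boundaries and hulls of the spectra *)

Lemma sigma_gapped (R : realType) (X : completeNormedModType R[i])
  (Rcl : (X -> X) -> set X -> Prop) (S : X -> X) : profile_class Rcl -> bounded_op S ->
  gapped (sigma_gKR S) (sigma_gDR_cls Rcl S).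
Proof.
move=> pc bS z nz /closure_nm cl; apply/interior_nm.
exact: (sigma_gap pc bS nz cl).
Qed.

Theorem theorem3p17 (R : realType) (X : completeNormedModType R[i])
  (T : {linear X -> X}) (Tcont : continuous T)
  (Xinf : forall (n : nat) (v : 'I_n -> X), ~ (setT `<=` fspan v)) :
  let sDR := sigma_gDR T in
  let sKR := sigma_gKR T in
  let sM := sigma_gDR_cls (@bounded_below_on R X) T in
  let sQ := sigma_gDR_cls (@surjective_on R X) T in
  let sPp := sigma_gDR_cls (@Phi_plus_on R X) T in
  let sPm := sigma_gDR_cls (@Phi_minus_on R X) T in
  let sP := sigma_gDR_cls (@Phi_on R X) T in
  let sWp := sigma_gDR_cls (@W_plus_on R X) T in
  let sWm := sigma_gDR_cls (@W_minus_on R X) T in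
  let sW := sigma_gDR_cls (@W_on R X) T in
  (* first chain *)
  [/\ cboundary sDR `<=` cboundary sM, cboundary sM `<=` cboundary sWp,
      cboundary sWp `<=` cboundary sPp & cboundary sPp `<=` cboundary sKR] /\
  (* second chain *)
  [/\ cboundary sDR `<=` cboundary sW, cboundary sW `<=` cboundary sP
    & cboundary sP `<=` cboundary sKR] /\
  (* third chain *)
  [/\ cboundary sDR `<=` cboundary sQ, cboundary sQ `<=` cboundary sWm,
      cboundary sWm `<=` cboundary sPm & cboundary sPm `<=` cboundary sKR] /\
  (* cross inclusions *)
  [/\ cboundary sP `<=` cboundary sPp, cboundary sP `<=` cboundary sPm,
      cboundary sW `<=` cboundary sWp & cboundary sW `<=` cboundary sWm] /\
  (* connected hulls *)
  [/\ chull sKR = chull sPp, chull sPp = chull sWp, chull sWp = chull sM,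
      chull sM = chull sPm & chull sPm = chull sWm] /\
  [/\ chull sWm = chull sQ, chull sQ = chull sP, chull sP = chull sW
    & chull sW = chull sDR].
Proof.
move=> sDR sKR sM sQ sPp sPm sP sWp sWm sW.
have bT : bounded_op T by exact: linear_blin.
have sub Rcl Rcl' (H : forall U M, bounded_op U -> cinv U M -> Rcl U M -> Rcl' U M) :=
  sigma_sub bT H.
have pDR := @profile_invertible R X; have pM := @profile_bounded_below R X.
have pQ := @profile_surjective R X; have pPp := @profile_Phi_plus R X.
have pPm := @profile_Phi_minus R X; have pP := @profile_Phi R X.
have pWp := @profile_W_plus R X; have pWm := @profile_W_minus R X.
have pW := @profile_W R X.
have bnd Rcl Rcl' : profile_class Rcl -> profile_class Rcl' ->
    sigma_gDR_cls Rcl' T `<=` sigma_gDR_cls Rcl T ->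
    cboundary (sigma_gDR_cls Rcl T) `<=` cboundary (sigma_gDR_cls Rcl' T).
  move=> p p' h; apply: (cboundary_sub (K0 := sKR)) h _; first exact: sigma_gKR_sub.
  exact: sigma_gapped.
have bndK Rcl : profile_class Rcl -> cboundary (sigma_gDR_cls Rcl T) `<=` cboundary sKR.
  move=> p; apply: (cboundary_sub (K0 := sKR)) => //; first exact: sigma_gKR_sub.
  exact: sigma_gapped.
have [b bP] := sigma_bounded bT.
(* Every hull is compared with that of [sKR]; the bound comes from [sDR], the largest of the
   spectra. *)
have hull Rcl : profile_class Rcl -> sigma_gDR_cls Rcl T `<=` sDR ->
    chull sKR = chull (sigma_gDR_cls Rcl T).
  move=> p h; apply: (chull_eq (b := b)); first exact: sigma_gKR_sub.
    exact: sigma_gapped.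
  by move=> z /h; exact: bP.
have iM : sM `<=` sDR by apply: sub; exact: invertible_bounded_below.
have iQ : sQ `<=` sDR by apply: sub; exact: invertible_surjective.
have iW : sW `<=` sDR by apply: sub; exact: invertible_W.
have WpM : sWp `<=` sM by apply: sub; exact: bounded_below_W_plus.
have WmQ : sWm `<=` sQ by apply: sub; exact: surjective_W_minus.
have PpWp : sPp `<=` sWp by apply: sub => U M _ _; exact: W_plus_Phi_plus.
have PmWm : sPm `<=` sWm by apply: sub => U M _ _; exact: W_minus_Phi_minus.
have PW : sP `<=` sW by apply: sub => U M _ _; exact: W_Phi.
have PpP : sPp `<=` sP by apply: sub => U M _ _; exact: Phi_Phi_plus.
have PmP : sPm `<=` sP by apply: sub => U M _ _; exact: Phi_Phi_minus.
have WpW : sWp `<=` sW by apply: sub => U M _ _; exact: W_W_plus.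
have WmW : sWm `<=` sW by apply: sub => U M _ _; exact: W_W_minus.
have hM := hull _ pM iM; have hQ := hull _ pQ iQ; have hW := hull _ pW iW.
have hWp := hull _ pWp (subset_trans WpM iM).
have hWm := hull _ pWm (subset_trans WmQ iQ).
have hP := hull _ pP (subset_trans PW iW).
have hPp := hull _ pPp (subset_trans PpWp (subset_trans WpM iM)).
have hPm := hull _ pPm (subset_trans PmWm (subset_trans WmQ iQ)).
have hDR := hull _ pDR (@subset_refl _ _).
split; first by split; [exact: bnd|exact: bnd|exact: bnd|exact: bndK].
split; first by split; [exact: bnd|exact: bnd|exact: bndK].
split; first by split; [exact: bnd|exact: bnd|exact: bnd|exact: bndK].
split; first by split; exact: bnd.
split.
  split; [exact: hPp|by rewrite -hPp -hWp|by rewrite -hWp -hM|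
    by rewrite -hM -hPm|by rewrite -hPm -hWm].
by split; [rewrite -hWm -hQ|rewrite -hQ -hP|rewrite -hP -hW|rewrite -hW; exact: hDR].
Qed.
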